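(* Let $d\in\mathbb{N}$ be fixed and let $X_i$, $i\in\mathbb{N}$, be i.i.d. random variables on $(\Omega,\mathcal{A},\mathbb{P})$ with values in $\mathbb{R}^d$ such that $\mathbb{E}[X_1]=0$ and $\mathbb{E}[\|X_1\|^2]<\infty$. Let $V_n:=n\|\overline{X}_n\|^2$ with $\overline{X}_n:=n^{-1}\sum_{i=1}^nX_i$, and let $V_n^*(\omega)$ be its bootstrap version. Then $$\sup_{x\in\mathbb{R}}|\mathbb{P}^*(V_n^*(\omega)\le x)-\mathbb{P}(V_n\le x)|\to 0,\quad n\to\infty,\quad\text{for }\mathbb{P}\text{-almost all }\omega\in\Omega.$$
   Context: $\|\cdot\|$ is the Euclidean norm on $\mathbb{R}^d$. Bootstrap construction: for every $n\in\mathbb{N}$ let $i_{n1},\ldots,i_{nn}$ be random variables on some probability space $(\Omega^*,\mathcal{A}^*,\mathbb{P}^* )$ that are $\mathbb{P}^*$-independent and each uniformly distributed on $\{1,\ldots,n\}$. For $\omega\in\Omega$ and $1\le k\le n$ define $\xi_{nk}(\omega):\Omega^*\to\mathbb{R}^d$ by $\xi_{nk}(\omega)(\omega^* ):=X_{i_{nk}(\omega^* )}(\omega)$. Put $\overline{\xi}_n(\omega):=n^{-1}\sum_{i=1}^n(\xi_{ni}(\omega)-\overline{X}_n(\omega))$ and $V_n^*(\omega):=n\|\overline{\xi}_n(\omega)\|^2$; for each fixed $\omega$, $V_n^*(\omega)$ is a random variable on $(\Omega^*,\mathcal{A}^*,\mathbb{P}^* )$. *)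

(* Defs.v *)
From HB Require Import structures.
From mathcomp Require Import all_boot all_order all_algebra.
From mathcomp Require Import all_classical all_reals all_analysis.

Set Implicit Arguments.
Unset Strict Implicit.
Unset Printing Implicit Defensive.

Import Order.TTheory GRing.Theory Num.Theory.
Import numFieldNormedType.Exports.

Local Open Scope classical_set_scope.
Local Open Scope ring_scope.

(* R^d with the sigma-algebra generated by the product topology of 'rV[R]_d;
   that is also the topology of the Euclidean norm. Convertible to 'rV[R]_d. *)
Definition borel_rV (R : realType) (d : nat) :=
  g_sigma_algebraType (@open 'rV[R]_d).

(* The library norm `|x| on 'rV[R]_d is the sup norm, hence this definition. *)
Definition enorm (R : realType) (d : nat) (x : 'rV[R]_d) : R :=
  Num.sqrt (\sum_(j < d) x ord0 j ^+ 2).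

(* Product rule over every finite subfamily. *)
Definition mutually_independent (R : realType)
    (dO : measure_display) (Omega : measurableType dO) (P : probability Omega R)
    (dE : measure_display) (E : measurableType dE)
    (J : choiceType) (Y : J -> {RV P >-> E}) : Prop :=
  forall (s : seq J) (A : J -> set E), uniq s ->
    (forall j, j \in s -> measurable (A j)) ->
    P (\bigcap_(j in [set` s]) (Y j @^-1` A j)) =
    (\prod_(j <- s) P (Y j @^-1` A j))%E.

(* Restricted to measurable sets, as [distribution P Y] is a function on all
   subsets of E whose values elsewhere are irrelevant. *)
Definition identically_distributed (R : realType)
    (dO : measure_display) (Omega : measurableType dO) (P : probability Omega R)
    (dE : measure_display) (E : measurableType dE)
    (J : Type) (Y : J -> {RV P >-> E}) : Prop :=
  forall (i j : J) (A : set E), measurable A ->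
    distribution P (Y i) A = distribution P (Y j) A.

(* Uniform distribution on {0, ..., n-1}. *)
Definition uniform_index (R : realType)
    (dO : measure_display) (Omega : measurableType dO) (P : probability Omega R)
    (n : nat) (i : {RV P >-> nat}) : Prop :=
  forall j : nat, (j < n)%N -> distribution P i [set j] = (n%:R^-1)%:E.

Section bootstrap.
Context {R : realType} {d : nat} {Omega Omega' : Type}.
(* Zero-based: [X i] is the (i+1)-st observation, [idx n k] is the (k+1)-st
   resampling index of the n-th row, with values in {0, ..., n-1}. *)
Variables (X : nat -> Omega -> 'rV[R]_d) (idx : forall n, 'I_n -> Omega' -> nat).

Definition sample_mean (n : nat) (w : Omega) : 'rV[R]_d :=
  n%:R^-1 *: \sum_(i < n) X i w.

Definition V_stat (n : nat) (w : Omega) : R :=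
  n%:R * enorm (sample_mean n w) ^+ 2.

Definition xi (n : nat) (k : 'I_n) (w : Omega) (w' : Omega') : 'rV[R]_d :=
  X (idx k w') w.

Definition xi_mean (n : nat) (w : Omega) (w' : Omega') : 'rV[R]_d :=
  n%:R^-1 *: \sum_(k < n) (xi k w w' - sample_mean n w).

Definition V_boot (n : nat) (w : Omega) (w' : Omega') : R :=
  n%:R * enorm (xi_mean n w w') ^+ 2.

End bootstrap.

(* Main.v *)
(** Both the statistic and its bootstrap version are squared norms of sums of
    independent centered vectors, and both are compared, by Lindeberg replacement,
    with a third sum whose law can be controlled directly; no Gaussian limit is
    needed. Given the data, let [c i] be the centered observations, [S] their
    empirical covariance and [j0] a coordinate with [S j0 j0 > 0]. Regressing [c i]
    on its coordinate [j0] leaves a residual, and replacing the regressor by an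
    independent random sign keeps the mean and the covariance. Conditionally on the
    residuals, the sum of the replaced vectors moves on a line by a sum of random
    signs, so the bound [n * 'C(n, k) ^ 2 <= 4 ^ n] makes its squared norm spread
    out uniformly over intervals. Smoothing the indicator of a ball then turns
    closeness on smooth functions into uniform closeness of distribution functions.

    The replacement errors vanish for almost every sample by the strong law of large
    numbers: empirical means and covariances converge, and hence the largest
    observation is [o(sqrt n)], which is Lindeberg's condition for the bootstrap. The
    strong law is proved, for pairwise independent variables, by truncation along
    [k = c * 2 ^ n] for every [c], followed by interpolation between these [k]. *)

Require Import Defs.
From HB Require Import structures.
From mathcomp Require Import all_boot all_order all_algebra.
From mathcomp Require Import all_classical all_reals all_analysis.
From mathcomp Require Import measurable_realfun.
From mathcomp Require Import ring lra zify.

Set Implicit Arguments.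
Unset Strict Implicit.
Unset Printing Implicit Defensive.

Import Order.TTheory GRing.Theory Num.Theory.
Import numFieldNormedType.Exports.

Local Open Scope classical_set_scope.
Local Open Scope ring_scope.

(** * Expectations and independence *)

(** The covariance may be singular, so the vectors need not spread out in all directions and no
    density can be assumed. The spread of the norm therefore has to come from one direction: a sum
    of random signs along a single line is enough, whatever the other coordinates do. If no
    coordinate has positive variance, this fails altogether and the law is a point mass; that case
    is separated at the end. The third sum is rebuilt from the sample for every [n], so all
    comparisons are nonasymptotic inequalities, in terms of empirical quantities whose limits are
    inserted only at the end. Only second moments exist; hence Taylor remainders are measured by
    [min(1, |h|) * |h|^2] instead of [|h|^3]. Test functions are functions of the squared norm,
    which is smooth at the origin. Their derivatives are bounded uniformly only for thresholds
    [x <= K]; above [K], Markov's inequality puts both distribution functions close to 1. The width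
    [delta] and the level [K] are fixed before [n], so that the constants they produce multiply
    quantities tending to 0. *)

Section expectation.
Context {R : realType} {d} {T : measurableType d} (P : probability T R).

Lemma bounded_integrable (f : T -> R) (C : R) : measurable_fun setT f ->
  (forall t, `|f t| <= C) -> P.-integrable setT (EFin \o f).
Proof.
move=> mf fC; apply: measurable_bounded_integrable => //.
  by rewrite -ge0_fin_numE// fin_num_measure.
exists C; split; first exact: num_real.
by move=> x Cx t _ /=; rewrite (le_trans (fC t))// ltW.
Qed.

Lemma integrableZlR (f : T -> R) k : P.-integrable setT (EFin \o f) ->
  P.-integrable setT (EFin \o (fun t => k * f t)).
Proof. exact: integrableZl. Qed.

Lemma integrableDR (f g : T -> R) : P.-integrable setT (EFin \o f) ->
  P.-integrable setT (EFin \o g) ->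
  P.-integrable setT (EFin \o (fun t => f t + g t)).
Proof. exact: integrableD. Qed.

Lemma integrable_sumR (I : Type) (s : seq I) (Q : pred I) (f : I -> T -> R) :
  (forall i, Q i -> P.-integrable setT (EFin \o f i)) ->
  P.-integrable setT (EFin \o (fun t => \sum_(i <- s | Q i) f i t)).
Proof.
move=> h; have := @integrable_sum _ _ _ P setT measurableT I s Q (fun i => EFin \o f i) h.
by apply: eq_integrable => // t _ /=; rewrite sumEFin.
Qed.

Lemma Rintegral_sumR (I : Type) (s : seq I) (Q : pred I) (f : I -> T -> R) :
  (forall i, Q i -> P.-integrable setT (EFin \o f i)) ->
  \int[P]_t (\sum_(i <- s | Q i) f i t) = \sum_(i <- s | Q i) \int[P]_t f i t.
Proof.
move=> h; elim: s => [|i s IH].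
  rewrite big_nil -[RHS](@mul0r _ (fine (P setT))) -Rintegral_cst//.
  by apply: eq_Rintegral => t _; rewrite big_nil.
rewrite big_cons; case: ifP => Qi.
  rewrite -IH -RintegralD//; [|exact: h|exact: integrable_sumR].
  by apply: eq_Rintegral => t _; rewrite big_cons Qi.
by rewrite -IH; apply: eq_Rintegral => t _; rewrite big_cons Qi.
Qed.

Lemma le_integrableR (f g : T -> R) : measurable_fun setT f ->
  (forall t, `|f t| <= g t) -> P.-integrable setT (EFin \o g) ->
  P.-integrable setT (EFin \o f).
Proof.
move=> mf fg; apply: le_integrable => //; first exact/measurable_EFinP.
by move=> t _ /=; rewrite lee_fin (le_trans (fg t))// ler_norm.
Qed.

Lemma le_normr_RintegralR (f g : T -> R) : measurable_fun setT f ->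
  (forall t, `|f t| <= g t) -> P.-integrable setT (EFin \o g) ->
  `|\int[P]_t f t| <= \int[P]_t g t.
Proof.
move=> mf fg ig; have iF := le_integrableR mf fg ig.
rewrite (le_trans (le_normr_Rintegral _ iF))//.
by apply: le_Rintegral => //; exact: (integrable_norm iF).
Qed.

Lemma Rintegral_cstR (r : R) : \int[P]_t r = r.
Proof.
rewrite Rintegral_cst//; set x := fine _.
have -> : x = 1 by transitivity (fine (1 : \bar R)) => //; congr fine; exact: probability_setT.
exact: mulr1.
Qed.

Lemma integrable_measurableR (f : T -> R) :
  P.-integrable setT (EFin \o f) -> measurable_fun setT f.
Proof. by move=> /measurable_int /measurable_EFinP. Qed.

Definition independent2 (U W : T -> R) := forall A B : set R,
  measurable A -> measurable B ->
  P (U @^-1` A `&` W @^-1` B) = (P (U @^-1` A) * P (W @^-1` B))%E.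

(** Independence makes the joint law of [(U, W)] agree with the product of the two laws on
    rectangles, hence everywhere, and Fubini applies. Nothing is bounded here, so integrability of
    the product is itself obtained from Tonelli under the product law. *)
Lemma Rintegral_independentM (U W : T -> R) :
  P.-integrable setT (EFin \o U) -> P.-integrable setT (EFin \o W) ->
  independent2 U W ->
  P.-integrable setT (EFin \o (fun t => U t * W t)) /\
  \int[P]_t (U t * W t) = \int[P]_t U t * \int[P]_t W t.
Proof.
move=> iU iW indep.
have mU := integrable_measurableR iU; have mW := integrable_measurableR iW.
pose mfU := mfun_Sub (mem_set mU : U \in mfun).
pose mfW := mfun_Sub (mem_set mW : W \in mfun).
have mUW : measurable_fun setT (fun t => (U t, W t)).
  exact: measurable_fun_pair.
pose mfUW := mfun_Sub (mem_set mUW : (fun t => (U t, W t)) \in mfun).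
pose mu1 := distribution P mfU; pose mu2 := distribution P mfW.
pose mu := distribution P mfUW.
have E A : measurable A -> (mu1 \x mu2)%E A = mu A.
  by apply: (@product_measure_unique _ _ _ _ _ mu1 mu2 mu) => B C mB mC; exact: indep.
have Eint g : (\int[(mu1 \x mu2)%E]_z g z = \int[mu]_z g z)%E.
  by apply: eq_measure_integral => A mA _; exact: E.
pose f (z : R * R) := (z.1 * z.2)%:E.
have mf : measurable_fun setT f.
  by apply/measurable_EFinP; exact: measurable_funM.
have iabs (V : T -> R) (iV : P.-integrable setT (EFin \o V))
    (X : {mfun T >-> R}) : X = V :> (T -> R) ->
    (\int[distribution P X]_x `|x%:E| < +oo)%E.
  move=> XV; rewrite (@ge0_integral_distribution _ _ _ _ _ P X (fun x => `|x%:E|%E))//.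
    by move/integrableP : iV => [_]; rewrite XV.
  by apply/measurable_EFinP; exact: normr_measurable.
have ifU := iabs _ iU mfU erefl; have ifW := iabs _ iW mfW erefl.
have if12 : (mu1 \x mu2)%E.-integrable setT f.
  apply/integrable12ltyP => //=.
  have mabs : measurable_fun [set: R] (fun y : R => `|y%:E|%E).
    by apply/measurable_EFinP; exact: normr_measurable.
  set K := (\int[mu2]_y `|y%:E|)%E in ifW.
  have -> : (\int[mu1]_x \int[mu2]_y `|f (x, y)|)%E = (\int[mu1]_x (`|x%:E| * K))%E.
    apply: eq_integral => x _; rewrite -ge0_integralZl//.
    by apply: eq_integral => y _; rewrite /f EFinM abseM.
  rewrite ge0_integralZr//; last exact: integral_ge0.
  apply: lte_mul_pinfty => //; first exact: integral_ge0.
  by rewrite ge0_fin_numE//; exact: integral_ge0.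
have iff : mu.-integrable setT f.
  apply/integrableP; split=> //.
  by rewrite -Eint; move/integrableP : if12 => [].
have mUWm : measurable_fun setT (fun t => U t * W t) by exact: measurable_funM.
have iUW : P.-integrable setT (EFin \o (fun t => U t * W t)).
  apply/integrableP; split; first exact/measurable_EFinP.
  move/integrableP : iff => [_].
  rewrite (@ge0_integral_distribution _ _ _ _ _ P mfUW (fun x => `|f x|%E))//.
  exact: measurableT_comp.
split=> //; rewrite /Rintegral.
have -> : (\int[P]_t (U t * W t)%:E = \int[mu]_z f z)%E.
  by rewrite (@integral_distribution _ _ _ _ _ P mfUW f).
rewrite -Eint -integral12_prod_meas1// /fubini_F /f/=.
have dist (V : T -> R) (X : {mfun T >-> R}) : X = V :> (T -> R) ->
    P.-integrable setT (EFin \o V) ->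
    (\int[distribution P X]_x x%:E = (\int[P]_t V t)%:E)%E.
  move=> XV iV; rewrite (@integral_distribution _ _ _ _ _ P X EFin)//; last first.
  - by rewrite XV.
  - by rewrite /Rintegral fineK ?XV//; exact: (integrable_fin_num measurableT iV).
have idist (V : T -> R) (X : {mfun T >-> R}) : X = V :> (T -> R) ->
    P.-integrable setT (EFin \o V) -> (distribution P X).-integrable setT EFin.
  move=> XV iV; apply/integrableP; split => //.
  exact: (iabs V).
under eq_integral => x _.
  under eq_integral do rewrite EFinM.
  rewrite integralZl//; last exact: (idist W).
  rewrite (dist W)//.
  over.
rewrite integralZr//; last exact: (idist U).
by rewrite (dist U).
Qed.


End expectation.

(** * The sigma-algebra of the past and its independence from the next variable *)

Section independence.
Context {R : realType} {d d'} {T : measurableType d} {E : measurableType d'}.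
Variables (P : probability T R) (Y : nat -> T -> E).
Hypothesis mY : forall k, measurable_fun setT (Y k).

Definition past_rectangles (k : nat) : set (set T) :=
  [set S | exists2 A : nat -> set E, (forall i, measurable (A i)) &
     S = \bigcap_(i in `I_k) (Y i @^-1` A i)].

(** The space [T] under the sigma-algebra of [Y 0, ..., Y (k - 1)]: measurability with respect to
    the past becomes a matter of typing, and [past_rectangles] is the pi-system for Dynkin's
    theorem. *)
Definition past (k : nat) := g_sigma_algebraType (past_rectangles k).

(** All [n] events enter the product; subfamilies are reached by putting [setT] at the other
    indices. *)
Definition independent_upto (n : nat) := forall A : nat -> set E,
  (forall i, measurable (A i)) ->
  P (\bigcap_(i in `I_n) (Y i @^-1` A i)) = (\prod_(i < n) P (Y i @^-1` A i))%E.

Lemma past_rectangles_measurable k : past_rectangles k `<=` measurable.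
Proof.
move=> _ [A mA ->]; apply: bigcap_measurableType => // i _.
by rewrite -[X in measurable X]setTI; exact: mY.
Qed.

Lemma past_measurable k (S : set T) : <<s past_rectangles k >> S -> measurable S.
Proof.
apply: smallest_sub; first exact: sigma_algebra_measurable.
exact: past_rectangles_measurable.
Qed.

Lemma past_measurable_fun d2 (U : measurableType d2) k (f : T -> U) :
  measurable_fun setT (f : past k -> U) -> measurable_fun setT f.
Proof.
move=> mf _ A mA; apply: (@past_measurable k).
exact: (mf measurableT A mA).
Qed.

Lemma measurable_past i k : (i < k)%N -> measurable_fun setT (Y i : past k -> E).
Proof.
move=> ik _ A mA; rewrite setTI; apply: sub_sigma_algebra.
exists (fun j => if j == i then A else setT).
  by move=> j; case: ifP.
apply/seteqP; split=> [t YA j _ /=|t /(_ i ik) /=]; last by rewrite eqxx.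
by case: eqP => // ->.
Qed.

Lemma past_rectangles_setI k : setI_closed (past_rectangles k).
Proof.
move=> _ _ [A mA ->] [B mB ->]; exists (fun i => A i `&` B i).
  by move=> i; exact: measurableI.
apply/seteqP; split=> [t [hA hB] i ik|t h].
  by split; [exact: hA|exact: hB].
by split=> i ik; have [] := h i ik.
Qed.

(** Dynkin's pi-lambda theorem: for a fixed event of [Y k] the sets [S] obeying the product rule
    form a lambda-system. On rectangles the rule compares two products over all [n] indices that
    differ only in the factor at [k], [setT] against [B]. *)
Lemma independent_past n k (S : set T) (B : set E) : independent_upto n ->
  (k < n)%N -> <<s past_rectangles k >> S -> measurable B ->
  P (S `&` Y k @^-1` B) = (P S * P (Y k @^-1` B))%E.
Proof.
move=> indep kn sS mB.
have mC : measurable (Y k @^-1` B) by rewrite -[X in measurable X]setTI; exact: mY.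
set C := Y k @^-1` B.
have meas (F : set (past k)) : measurable F -> measurable (F : set T).
  exact: past_measurable.
pose Q (F : set (past k)) := P (F `&` C : set T) = (P (F : set T) * P C)%E.
suff : forall F : set (past k), <<s past_rectangles k >> F -> Q F by exact.
apply: dynkin_induction => //.
- exact: past_rectangles_setI.
- by rewrite /Q setTI probability_setT mul1e.
- move=> _ [A mA ->]; rewrite /Q.
  pose A' i := if (i < k)%N then A i else setT.
  pose A'' i := if i == k then B else A' i.
  have mA' i : measurable (A' i) by rewrite /A'; case: ifP.
  have mA'' i : measurable (A'' i) by rewrite /A''; case: ifP.
  have -> : \bigcap_(i in `I_k) (Y i @^-1` A i) `&` C =
      \bigcap_(i in `I_n) (Y i @^-1` A'' i).
    apply/seteqP; split=> [t [h Ct] i _ /=|t h].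
      rewrite /A''; case: eqP => [->//|_]; rewrite /A'; case: ifP => // ik.
      exact: h.
    split; last by have := h k kn; rewrite /A''/= eqxx.
    move=> i /= ik; have := h i (ltn_trans ik kn).
    by rewrite /A''/= /A' ik; case: eqP ik => // ->; rewrite ltnn.
  have -> : \bigcap_(i in `I_k) (Y i @^-1` A i) =
      \bigcap_(i in `I_n) (Y i @^-1` A' i).
    apply/seteqP; split=> [t h i _ /=|t h i /= ik].
      by rewrite /A'; case: ifP => // ik; exact: h.
    by have := h i (ltn_trans ik kn); rewrite /A'/= ik.
  rewrite !indep// (bigD1 (Ordinal kn))//= [in RHS](bigD1 (Ordinal kn))//=.
  rewrite {1}/A'' eqxx {1}/A' ltnn preimage_setT probability_setT mul1e muleC.
  by congr (_ * _)%E; apply: eq_bigr => i /negPf; rewrite /A'' -val_eqE/= => ->.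
- move=> F /meas mF QF; rewrite /Q.
  have PF : (P F \is a fin_num) by exact: fin_num_measure.
  have PC : (P C \is a fin_num) by exact: fin_num_measure.
  have -> : ~` F `&` C = C `\` F by rewrite setDE setIC.
  rewrite measureD//; last by rewrite -ge0_fin_numE.
  transitivity (P C - P (F : set T) * P C)%E.
    congr (_ - _)%E; transitivity (P ((F : set T) `&` C)); last exact: QF.
    by congr (P _); exact: setIC.
  have -> : P (~` F : set T) = (1 - P (F : set T))%E by exact: probability_setC.
  by rewrite muleBl ?mul1e//; exact: fin_num_adde_defl.
- move=> F mF tF QF; rewrite /Q setI_bigcupl.
  rewrite measure_bigcup//; last 2 first.
  - by move=> i _; apply: measurableI => //; exact: meas.
  - exact: trivIset_setIr.
  rewrite measure_bigcup//; last by move=> i _; exact: meas.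
  have PC : (P C \is a fin_num) by exact: fin_num_measure.
  rewrite muleC -[X in (X * _)%E](fineK PC) -nneseriesZl//.
  by apply: eq_eseriesr => i _; rewrite fineK// muleC; exact: QF.
Qed.

Lemma independent2_past n k (U : T -> R) (w : E -> R) : independent_upto n ->
  (k < n)%N -> measurable_fun setT (U : past k -> R) ->
  measurable_fun setT w -> independent2 P U (w \o Y k).
Proof.
move=> indep kn mU mw A B mA mB; rewrite comp_preimage.
apply: (independent_past indep kn).
  by rewrite -[X in _ X]setTI; exact: (mU measurableT A mA).
by rewrite -[X in measurable X]setTI; exact: mw.
Qed.

End independence.

(** * The Lindeberg replacement method *)

Section lindeberg_class.
Context {R : realType} {d : nat}.
Implicit Types (x y h : 'rV[R]_d).

Definition nsq x : R := \sum_(j < d) x ord0 j ^+ 2.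

Lemma nsq_ge0 x : 0 <= nsq x.
Proof. by apply: sumr_ge0 => j _; exact: sqr_ge0. Qed.

Lemma enorm_ge0 x : 0 <= enorm x.
Proof. exact: sqrtr_ge0. Qed.

Lemma enorm_sq x : enorm x ^+ 2 = nsq x.
Proof. by rewrite sqr_sqrtr// nsq_ge0. Qed.

Lemma coord_sq_le x j : x ord0 j ^+ 2 <= nsq x.
Proof.
rewrite /nsq (bigD1 j)//= lerDl; apply: sumr_ge0 => i _; exact: sqr_ge0.
Qed.

Lemma coordM_le x i j : `|x ord0 i * x ord0 j| <= nsq x.
Proof.
have := coord_sq_le x i; have := coord_sq_le x j.
move: (x ord0 i) (x ord0 j) => a b; rewrite ler_norml; nra.
Qed.

Lemma coord_le x j : `|x ord0 j| <= 1 + nsq x.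
Proof. by have := coord_sq_le x j; move: (x ord0 j) => a; rewrite ler_norml; nra. Qed.

(** The Lindeberg quantity: cubic for short [h], where a third-order Taylor bound is available, and
    quadratic for long [h], so that a finite second moment makes it integrable. *)
Definition lrem h : R := Num.min 1 (enorm h) * nsq h.

Lemma lrem_ge0 h : 0 <= lrem h.
Proof. by rewrite mulr_ge0 ?nsq_ge0// le_min ler01 enorm_ge0. Qed.

Lemma lrem_le h : lrem h <= nsq h.
Proof. by rewrite ler_piMl ?nsq_ge0// ge_min lexx. Qed.

Lemma lrem_le_max h (t : R) : enorm h <= t -> lrem h <= t * nsq h.
Proof. by move=> ht; rewrite ler_wpM2r ?nsq_ge0// ge_min ht orbT. Qed.

(* Measurability with respect to the coordinates, avoiding any choice of a
   sigma-algebra on row vectors. *)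
Definition coord_measurable (f : 'rV[R]_d -> R) := forall (d1 : measure_display)
    (T : measurableType d1) (u : T -> 'rV[R]_d),
  (forall j, measurable_fun setT (fun t => u t ord0 j)) ->
  measurable_fun setT (fun t => f (u t)).

Lemma coord_measurable_nsq : coord_measurable nsq.
Proof.
by move=> d1 T u mu; apply: measurable_sum => j; apply: measurable_funX; exact: mu.
Qed.

Lemma coord_measurable_lrem : coord_measurable lrem.
Proof.
move=> d1 T u mu; apply: measurable_funM; last exact: coord_measurable_nsq.
apply: measurable_minr => //.
apply: (measurableT_comp (f := @Num.sqrt R)); last exact: coord_measurable_nsq.
by apply: continuous_measurable_fun; exact: sqrt_continuous.
Qed.

(* The last field is a second-order Taylor expansion whose remainder is uniform
   in [y], and of the size that Lindeberg's condition controls. *)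
Record lindeberg (C : R) (f : 'rV[R]_d -> R) (g : 'I_d -> 'rV[R]_d -> R)
    (H : 'I_d -> 'I_d -> 'rV[R]_d -> R) : Prop := Lindeberg {
  lind_mf : coord_measurable f;
  lind_mg : forall j, coord_measurable (g j);
  lind_mH : forall i j, coord_measurable (H i j);
  lind_bf : forall y, `|f y| <= C;
  lind_bg : forall j y, `|g j y| <= C;
  lind_bH : forall i j y, `|H i j y| <= C;
  lind_exp : forall y h,
    `|f (y + h) - f y - \sum_j g j y * h ord0 j
      - \sum_i \sum_j H i j y * (h ord0 i * h ord0 j)| <= C * lrem h }.

(** The expectation of [f (y + W)] for [W] uniform on the family [w]. Iterated [n] times from [0] it
    is the expectation of [f] at a sum of [n] independent copies, so the third sum needs no
    probability space of its own. *)
Definition Avg {I : finType} (w : I -> 'rV[R]_d) (f : 'rV[R]_d -> R) y : R :=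
  #|I|%:R^-1 * \sum_i f (y + w i).

Section Avg.
Context {I : finType} (w : I -> 'rV[R]_d).
Hypothesis I_gt0 : (0 < #|I|)%N.

Let cI_neq0 : (#|I|%:R : R) != 0.
Proof. by rewrite pnatr_eq0 -lt0n. Qed.

Lemma avg_cst (c : R) : #|I|%:R^-1 * (\sum_(i : I) c) = c.
Proof. by rewrite sumr_const -[c *+ _]mulr_natl mulrA mulVf ?mul1r. Qed.

Lemma avg_le (a b : I -> R) : (forall i, a i <= b i) ->
  #|I|%:R^-1 * (\sum_i a i) <= #|I|%:R^-1 * (\sum_i b i).
Proof. by move=> ab; rewrite ler_wpM2l ?invr_ge0// ler_sum. Qed.

Lemma avg_norm (a : I -> R) :
  `|#|I|%:R^-1 * (\sum_i a i)| <= #|I|%:R^-1 * (\sum_i `|a i|).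
Proof.
by rewrite normrM ger0_norm ?invr_ge0// ler_wpM2l ?invr_ge0// ler_norm_sum.
Qed.

Lemma coord_measurable_Avg f : coord_measurable f -> coord_measurable (Avg w f).
Proof.
move=> mf d1 T u mu; apply: measurable_funM => //.
apply: measurable_sum => i; apply: mf => j.
under eq_fun do rewrite mxE.
by apply: measurable_funD.
Qed.

Lemma Avg_bounded f C : (forall y, `|f y| <= C) -> forall y, `|Avg w f y| <= C.
Proof.
by move=> fC y; rewrite (le_trans (avg_norm _))// -[leRHS]avg_cst avg_le.
Qed.

(** Averaging only translates the base point, and the remainder is uniform in it, so [C] does not
    grow. Hence the averaged function can serve as the next test function. *)
Lemma lindeberg_Avg C f g H : lindeberg C f g H ->
  lindeberg C (Avg w f) (fun j => Avg w (g j)) (fun i j => Avg w (H i j)).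
Proof.
case=> mf mg mH bf bg bH fexp; split.
- exact: coord_measurable_Avg.
- by move=> j; exact: coord_measurable_Avg.
- by move=> i j; exact: coord_measurable_Avg.
- exact: Avg_bounded.
- by move=> j; exact: Avg_bounded.
- by move=> i j; exact: Avg_bounded.
move=> y h; set lhs := (X in `|X|).
have -> : lhs = #|I|%:R^-1 * (\sum_i (f (y + w i + h) - f (y + w i)
    - \sum_j g j (y + w i) * h ord0 j
    - \sum_k \sum_j H k j (y + w i) * (h ord0 k * h ord0 j))).
  rewrite !sumrB /lhs /Avg !mulrBr; congr (_ - _ - _ - _).
  - by congr (_ * _); apply: eq_bigr => i _; rewrite addrAC.
  - rewrite [in RHS]exchange_big/= [RHS]mulr_sumr; apply: eq_bigr => j _.
    by rewrite -mulr_suml [RHS]mulrA.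
  - rewrite [in RHS]exchange_big/= [RHS]mulr_sumr; apply: eq_bigr => k _.
    rewrite [in RHS]exchange_big/= [RHS]mulr_sumr; apply: eq_bigr => j _.
    by rewrite -mulr_suml [RHS]mulrA.
by rewrite (le_trans (avg_norm _))// -[leRHS]avg_cst avg_le.
Qed.

Definition avg_cov (i j : 'I_d) : R :=
  #|I|%:R^-1 * \sum_k w k ord0 i * w k ord0 j.

Lemma Avg_expansion C f g H y (r : R) : 0 <= C -> lindeberg C f g H ->
  (forall j, \sum_k w k ord0 j = 0) ->
  #|I|%:R^-1 * (\sum_k lrem (w k)) <= r ->
  `|Avg w f y - f y - \sum_i \sum_j H i j y * avg_cov i j| <= C * r.
Proof.
move=> C0 L w0 wr.
have -> : Avg w f y - f y - \sum_i \sum_j H i j y * avg_cov i j =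
    #|I|%:R^-1 * (\sum_k (f (y + w k) - f y - \sum_j g j y * w k ord0 j
    - \sum_i \sum_j H i j y * (w k ord0 i * w k ord0 j))).
  rewrite !sumrB /Avg !mulrBr avg_cst; congr (_ - _).
    rewrite exchange_big/= [X in _ - _ * X]big1 ?mulr0 ?subr0// => j _.
    by rewrite -mulr_sumr w0 mulr0.
  rewrite [in RHS]exchange_big/= [RHS]mulr_sumr; apply: eq_bigr => i _.
  rewrite [in RHS]exchange_big/= [RHS]mulr_sumr; apply: eq_bigr => j _.
  by rewrite -mulr_sumr mulrCA.
rewrite (le_trans (avg_norm _))// (le_trans (avg_le (fun k => lind_exp L y (w k))))//.
by rewrite -mulr_sumr mulrCA ler_wpM2l.
Qed.

End Avg.

End lindeberg_class.

Section lindeberg_replacement.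
Context {R : realType} {d : nat} {d1 d2} {T : measurableType d1} {E : measurableType d2}.
Variables (P : probability T R) (Y : nat -> T -> E) (z : E -> 'rV[R]_d) (n : nat).
Hypothesis mY : forall k, measurable_fun setT (Y k).
Hypothesis indep : independent_upto P Y n.
Hypothesis mz : forall j, measurable_fun setT (fun e => z e ord0 j).
Variables (Q : 'I_d -> 'I_d -> R) (r : R).
Hypothesis int_sq : forall k, (k < n)%N ->
  P.-integrable setT (EFin \o (fun t => nsq (z (Y k t)))).
Hypothesis mean0 : forall k j, (k < n)%N -> \int[P]_t z (Y k t) ord0 j = 0.
Hypothesis covQ : forall k i j, (k < n)%N ->
  \int[P]_t (z (Y k t) ord0 i * z (Y k t) ord0 j) = Q i j.
Hypothesis rem_le : forall k, (k < n)%N -> \int[P]_t lrem (z (Y k t)) <= r.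

Definition psum (k : nat) (t : T) : 'rV[R]_d := \sum_(i < k) z (Y i t).

Let mZ k j : measurable_fun setT (fun t => z (Y k t) ord0 j).
Proof. exact: (measurableT_comp (mz j)). Qed.

Lemma psum_past k j :
  measurable_fun setT (fun t : past Y k => psum k t ord0 j).
Proof.
under eq_fun do rewrite summxE.
apply: measurable_sum => i; apply: (measurableT_comp (mz j)).
exact: measurable_past.
Qed.

(** [psum k] belongs to the past and [Y k] is independent of it, so expectations of products factor:
    the gradient term vanishes with the mean, and the Hessian term sees [Y k] only through [Q]. *)
Lemma lindeberg_step C f g H k : 0 <= C -> lindeberg C f g H -> (k < n)%N ->
  `|\int[P]_t f (psum k.+1 t) - \int[P]_t f (psum k t)
    - \sum_i \sum_j (\int[P]_t H i j (psum k t)) * Q i j| <= C * r.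
Proof.
move=> C0 L kn.
have pm f0 : coord_measurable f0 ->
    measurable_fun setT (fun t : past Y k => f0 (psum k t)).
  by move=> mf0; apply: mf0 => j; exact: psum_past.
have pm' f0 : coord_measurable f0 -> measurable_fun setT (fun t => f0 (psum k t)).
  by move=> mf0; apply: (past_measurable_fun mY (pm _ mf0)).
have mS j : measurable_fun setT (fun t => psum k t ord0 j).
  exact: (past_measurable_fun mY (@psum_past k j)).
have psumS t : psum k.+1 t = psum k t + z (Y k t) by rewrite /psum big_ord_recr.
have isq := int_sq kn.
have iZ j : P.-integrable setT (EFin \o (fun t => z (Y k t) ord0 j)).
  apply: (le_integrableR _ (fun t => coord_le (z (Y k t)) j)) => //.
  by apply: (integrableDR _ isq); exact: finite_measure_integrable_cst.
have iZZ i j : P.-integrable setT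
    (EFin \o (fun t => z (Y k t) ord0 i * z (Y k t) ord0 j)).
  apply: (le_integrableR _ (fun t => coordM_le (z (Y k t)) i j)) => //.
  exact: measurable_funM.
have irem : P.-integrable setT (EFin \o (fun t => lrem (z (Y k t)))).
  apply: (le_integrableR (g := fun t => nsq (z (Y k t)))) => //.
    by apply: coord_measurable_lrem.
  by move=> t; rewrite ger0_norm ?lrem_ge0// lrem_le.
have ig0 f0 : coord_measurable f0 -> (forall y, `|f0 y| <= C) ->
    P.-integrable setT (EFin \o (fun t => f0 (psum k t))).
  by move=> mf0 bf0; apply: (@bounded_integrable _ _ _ _ _ C) => //; exact: pm'.
have iS1 : P.-integrable setT (EFin \o (fun t => f (psum k.+1 t))).
  apply: (@bounded_integrable _ _ _ _ _ C) => [|t]; last exact: (lind_bf L).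
  apply: (lind_mf L) => j.
  under eq_fun do rewrite psumS mxE.
  exact: measurable_funD.
have igZ j : P.-integrable setT
    (EFin \o (fun t => g j (psum k t) * z (Y k t) ord0 j)) /\
    \int[P]_t (g j (psum k t) * z (Y k t) ord0 j) = 0.
  have [] := @Rintegral_independentM _ _ _ P (fun t => g j (psum k t))
    (fun t => z (Y k t) ord0 j) (ig0 _ (lind_mg L j) (lind_bg L j)) (iZ j).
    exact: (independent2_past mY indep kn (pm _ (lind_mg L j)) (mz j)).
  by move=> ? ->; rewrite mean0// mulr0.
have iHZ i j : P.-integrable setT
    (EFin \o (fun t => H i j (psum k t) * (z (Y k t) ord0 i * z (Y k t) ord0 j))) /\
    \int[P]_t (H i j (psum k t) * (z (Y k t) ord0 i * z (Y k t) ord0 j)) =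
    (\int[P]_t H i j (psum k t)) * Q i j.
  have [] := @Rintegral_independentM _ _ _ P (fun t => H i j (psum k t))
    (fun t => z (Y k t) ord0 i * z (Y k t) ord0 j)
    (ig0 _ (lind_mH L i j) (lind_bH L i j)) (iZZ i j).
    apply: (independent2_past mY indep kn (pm _ (lind_mH L i j))
      (w := fun e => z e ord0 i * z e ord0 j)).
    exact: measurable_funM.
  by move=> ? ->; rewrite covQ.
have iSg : P.-integrable setT
    (EFin \o (fun t => \sum_j g j (psum k t) * z (Y k t) ord0 j)).
  by apply: integrable_sumR => j _; case: (igZ j).
have iSH : P.-integrable setT
    (EFin \o (fun t => \sum_i \sum_j H i j (psum k t) * (z (Y k t) ord0 i * z (Y k t) ord0 j))).
  apply: integrable_sumR => i _; apply: integrable_sumR => j _.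
  by case: (iHZ i j).
have if_ := ig0 _ (lind_mf L) (lind_bf L).
have iB (a b : T -> R) : P.-integrable setT (EFin \o a) ->
    P.-integrable setT (EFin \o b) ->
    P.-integrable setT (EFin \o (fun t => a t - b t)).
  by move=> ia ib; exact: (integrableB measurableT ia ib).
pose D t := f (psum k.+1 t) - f (psum k t)
  - \sum_j g j (psum k t) * z (Y k t) ord0 j
  - \sum_i \sum_j H i j (psum k t) * (z (Y k t) ord0 i * z (Y k t) ord0 j).
have iD : P.-integrable setT (EFin \o D) by apply: (iB) => //; apply: (iB) => //; exact: iB.
have -> : \int[P]_t f (psum k.+1 t) - \int[P]_t f (psum k t)
    - \sum_i \sum_j (\int[P]_t H i j (psum k t)) * Q i j = \int[P]_t D t.
  rewrite /D RintegralB//; last by apply: (iB) => //; exact: iB.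
  rewrite RintegralB//; last exact: iB.
  have -> : \int[P]_t (\sum_j g j (psum k t) * z (Y k t) ord0 j) = 0.
    rewrite Rintegral_sumR; last by move=> j _; case: (igZ j).
    by apply: big1 => j _; case: (igZ j).
  rewrite RintegralB// subr0.
  congr (_ - _); rewrite Rintegral_sumR; last first.
    by move=> i _; apply: integrable_sumR => j _; case: (iHZ i j).
  apply: eq_bigr => i _; rewrite Rintegral_sumR; last by move=> j _; case: (iHZ i j).
  by apply: eq_bigr => j _; case: (iHZ i j).
have iCr := integrableZlR C irem.
rewrite (le_trans (le_normr_RintegralR (g := fun t => C * lrem (z (Y k t))) _ _ iCr))//.
- exact: integrable_measurableR iD.
- by move=> t; rewrite /D psumS; exact: (lind_exp L).
- by rewrite RintegralZl// ler_wpM2l// rem_le.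
Qed.

Context {I : finType} (w : I -> 'rV[R]_d).
Hypothesis I_gt0 : (0 < #|I|)%N.
Hypothesis w0 : forall j, \sum_k w k ord0 j = 0.
Variable r' : R.
Hypothesis rem_w : #|I|%:R^-1 * (\sum_k lrem (w k)) <= r'.

Definition replacement_error := r + r' + \sum_i \sum_j `|Q i j - avg_cov w i j|.

(** The true and the averaged last summand are expanded around the same [psum k]; their difference
    leaves the two remainders and the Hessian paired with [Q - avg_cov w]. *)
Lemma lindeberg_replace C f g H k : 0 <= C -> lindeberg C f g H -> (k < n)%N ->
  `|\int[P]_t f (psum k.+1 t) - \int[P]_t Avg w f (psum k t)|
    <= C * replacement_error.
Proof.
move=> C0 L kn.
have step := lindeberg_step C0 L kn.
have LA := lindeberg_Avg w I_gt0 L.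
have pm' f0 : coord_measurable f0 -> measurable_fun setT (fun t => f0 (psum k t)).
  move=> mf0; apply: mf0 => j.
  exact: (past_measurable_fun mY (@psum_past k j)).
have ig0 f0 : coord_measurable f0 -> (forall y, `|f0 y| <= C) ->
    P.-integrable setT (EFin \o (fun t => f0 (psum k t))).
  by move=> mf0 bf0; apply: (@bounded_integrable _ _ _ _ _ C) => //; exact: pm'.
have iB (a b : T -> R) : P.-integrable setT (EFin \o a) ->
    P.-integrable setT (EFin \o b) ->
    P.-integrable setT (EFin \o (fun t => a t - b t)).
  by move=> ia ib; exact: (integrableB measurableT ia ib).
have if_ := ig0 _ (lind_mf L) (lind_bf L).
have iA := ig0 _ (lind_mf LA) (lind_bf LA).
have iH i j := ig0 _ (lind_mH L i j) (lind_bH L i j).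
have iHc i j : P.-integrable setT (EFin \o (fun t => H i j (psum k t) * avg_cov w i j)).
  by under eq_fun do rewrite /= mulrC; exact: integrableZlR.
have iHs : P.-integrable setT
    (EFin \o (fun t => \sum_i \sum_j H i j (psum k t) * avg_cov w i j)).
  by apply: integrable_sumR => i _; exact: integrable_sumR.
have stepA : `|\int[P]_t Avg w f (psum k t) - \int[P]_t f (psum k t)
    - \sum_i \sum_j (\int[P]_t H i j (psum k t)) * avg_cov w i j| <= C * r'.
  pose D t := Avg w f (psum k t) - f (psum k t)
    - \sum_i \sum_j H i j (psum k t) * avg_cov w i j.
  have iD : P.-integrable setT (EFin \o D) by apply: (iB) => //; exact: iB.
  set lhs := (X in `|X|); have -> : lhs = \int[P]_t D t.
    rewrite /D RintegralB//; last exact: iB.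
    rewrite RintegralB// Rintegral_sumR; last by move=> i _; exact: integrable_sumR.
    congr (_ - _); apply: eq_bigr => i _; rewrite Rintegral_sumR//.
    by apply: eq_bigr => j _; rewrite RintegralZr.
  rewrite -[leRHS](Rintegral_cstR P); apply: le_normr_RintegralR.
  - exact: integrable_measurableR iD.
  - by move=> t; rewrite /D; exact: (Avg_expansion I_gt0 _ C0 L w0 rem_w).
  - exact: finite_measure_integrable_cst.
pose e i j := (\int[P]_t H i j (psum k t)) * (Q i j - avg_cov w i j).
have bE i j : `|\int[P]_t H i j (psum k t)| <= C.
  rewrite -[leRHS](Rintegral_cstR P); apply: le_normr_RintegralR.
  - by apply: pm'; exact: (lind_mH L).
  - by move=> t; exact: (lind_bH L).
  - exact: finite_measure_integrable_cst.
have eE : \sum_i \sum_j e i j =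
    \sum_i \sum_j (\int[P]_t H i j (psum k t)) * Q i j
    - \sum_i \sum_j (\int[P]_t H i j (psum k t)) * avg_cov w i j.
  rewrite -sumrB; apply: eq_bigr => i _; rewrite -sumrB; apply: eq_bigr => j _.
  by rewrite /e mulrBr.
have be : `|\sum_i \sum_j e i j| <= C * \sum_i \sum_j `|Q i j - avg_cov w i j|.
  rewrite (le_trans (ler_norm_sum _ _ _))// mulr_sumr ler_sum// => i _.
  rewrite (le_trans (ler_norm_sum _ _ _))// mulr_sumr ler_sum// => j _.
  by rewrite /e normrM ler_wpM2r.
rewrite /replacement_error !mulrDr.
move: step stepA be; rewrite eE.
set a := \int[P]_t f (psum k.+1 t); set b := \int[P]_t f _.
set c := \int[P]_t Avg w f _.
set x := \sum_i \sum_j _ * Q i j; set y := \sum_i \sum_j _ * avg_cov _ _ _.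
rewrite !ler_norml => /andP[? ?] /andP[? ?] /andP[? ?].
by apply/andP; split; lra.
Qed.

Lemma lindeberg_compare C f g H : 0 <= C -> lindeberg C f g H ->
  `|\int[P]_t f (psum n t) - iter n (Avg w) f 0| <= n%:R * (C * replacement_error).
Proof.
move=> C0 L.
(* The claim is generalized over [f]: the last summand is replaced first, and [Avg w f] becomes the
   test function for the [k] summands that remain. *)
suff h k : (k <= n)%N -> forall f g H, lindeberg C f g H ->
    `|\int[P]_t f (psum k t) - iter k (Avg w) f 0| <= k%:R * (C * replacement_error).
  exact: h L.
elim: k => [_ {L}f {}g {}H L|k IH kn {L}f {}g {}H L].
  rewrite mul0r normr_le0 subr_eq0; apply/eqP.
  rewrite -[RHS](Rintegral_cstR P); apply: eq_Rintegral => t _.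
  by rewrite /psum big_ord0.
rewrite iterSr -natr1 mulrDl mul1r.
have h1 := IH (ltnW kn) _ _ _ (lindeberg_Avg w I_gt0 L).
have h2 := lindeberg_replace C0 L kn.
rewrite (le_trans _ (lerD h1 h2))//.
rewrite -[X in `|X|](subrKA (\int[P]_t Avg w f (psum k t))) addrC.
exact: ler_normD.
Qed.

End lindeberg_replacement.

(** * Smooth radial test functions *)

Section cubic_step.
Context {R : realType}.
Implicit Types t u v : R.

Definition pos_part t := Num.max t 0.

Lemma pos_part_id t : 0 <= t -> pos_part t = t.
Proof. by move=> t0; rewrite /pos_part max_l. Qed.

Lemma pos_part_eq0 t : t <= 0 -> pos_part t = 0.
Proof. by move=> t0; rewrite /pos_part max_r. Qed.

Definition third_diff (F : R -> R) t :=
  F t - 3 * F (t - 1) + 3 * F (t - 2) - F (t - 3).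

(* Third differences of the truncated powers: [step] decreases from 1 to 0 on
   [0, 3], and the error of its second-order Taylor polynomial, with
   coefficients [step1] and [step2], is cubic. *)
Definition step t := 1 - third_diff (fun s => pos_part s ^+ 3) t / 6.
Definition step1 t := - third_diff (fun s => pos_part s ^+ 2) t / 2.
Definition step2 t := - third_diff pos_part t / 2.

Lemma cubic_taylor u v :
  `|pos_part v ^+ 3 - pos_part u ^+ 3 - 3 * pos_part u ^+ 2 * (v - u)
    - 3 * pos_part u * (v - u) ^+ 2| <= `|v - u| ^+ 3.
Proof.
rewrite /pos_part; case: (lerP u 0) => u0; case: (lerP v 0) => v0.
- by rewrite !expr0n/= !(mulr0, mul0r, subr0) normr0 exprn_ge0.
- rewrite !expr0n/= !(mulr0, mul0r, subr0) !ger0_norm ?exprn_ge0 ?subr_ge0; try lra.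
  by rewrite lerXn2r ?nnegrE; lra.
- rewrite expr0n/= [X in _ <= X ^+ _]ler0_norm; last by lra.
  have [w0 wu] : 0 <= u - v /\ 0 <= (u - v) - u by split; lra.
  rewrite (_ : v - u = - (u - v)); last by ring.
  (* In terms of [w = u - v] the error is [(w - u) ^ 3 - w ^ 3], where [0 <= w - u <= w]. *)
  move: (u - v) w0 wu => w w0 wu.
  have h1 : 0 <= (w - u) ^+ 3 by rewrite exprn_ge0.
  have h2 : (w - u) ^+ 3 <= w ^+ 3 by rewrite lerXn2r ?nnegrE; lra.
  by rewrite opprK ler0_norm; nra.
- rewrite -normrX le_eqVlt; apply/orP; left; apply/eqP; congr `|_|; ring.
Qed.

(** The weights 1, 3, 3, 1 of the third difference add up to 8, and [8 / 6 <= 2]. *)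
Lemma step_taylor u v :
  `|step v - step u - step1 u * (v - u) - step2 u * (v - u) ^+ 2|
    <= 2 * `|v - u| ^+ 3.
Proof.
have h0 := cubic_taylor u v.
have h1 := cubic_taylor (u - 1) (v - 1).
have h2 := cubic_taylor (u - 2) (v - 2).
have h3 := cubic_taylor (u - 3) (v - 3).
have shift a : v - a - (u - a) = v - u by ring.
rewrite !shift in h1 h2 h3.
rewrite /step /step1 /step2 /third_diff.
move: (`|v - u| ^+ 3) h0 h1 h2 h3 => c.
rewrite !ler_norml => /andP[? ?] /andP[? ?] /andP[? ?] /andP[? ?].
by apply/andP; split; lra.
Qed.

Let posP (t c : R) : (t <= c /\ pos_part (t - c) = 0) \/
  (c <= t /\ pos_part (t - c) = t - c).
Proof.
have [h|h] := lerP (t - c) 0; [left|right].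
  by rewrite pos_part_eq0//; split => //; lra.
by rewrite pos_part_id; [split => //; lra|lra].
Qed.

Lemma step_eq1 t : t <= 0 -> step t = 1.
Proof.
move=> t0; rewrite /step /third_diff /pos_part !max_r; lra.
Qed.

(** From 3 on the truncated powers are plain polynomials: the third difference of the cube is 6, and
    lower degrees give 0. *)
Lemma third_diff_ge3 t : 3 <= t -> [/\ step t = 0, step1 t = 0 & step2 t = 0].
Proof.
move=> t0; rewrite /step /step1 /step2 /third_diff /pos_part !max_l; try lra.
by split; field.
Qed.

Lemma step_itv t : 0 <= step t <= 1.
Proof.
have [/step_eq1 ->|t0] := lerP t 0; first by rewrite ler01 lexx.
have [/third_diff_ge3[-> _ _]|t3] := lerP 3 t; first by rewrite ler01 lexx.
rewrite /step /third_diff; have [t1|t1] := lerP t 1.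
  rewrite (@pos_part_id t) ?(@pos_part_eq0 (t - 1)) ?(@pos_part_eq0 (t - 2))
    ?(@pos_part_eq0 (t - 3)); try lra.
  rewrite expr0n/= !(mulr0, subr0, addr0).
  have t3' : t ^+ 3 <= 1 by rewrite exprn_ile1// ltW.
  have t3'' : 0 <= t ^+ 3 by rewrite exprn_ge0// ltW.
  by apply/andP; split; lra.
have [t2|t2] := lerP t 2.
  rewrite (@pos_part_id t) ?(@pos_part_id (t - 1)) ?(@pos_part_eq0 (t - 2))
    ?(@pos_part_eq0 (t - 3)); try lra.
  rewrite expr0n/= !(mulr0, subr0, addr0).
  have [s ts] : exists s, t = s + 1 by exists (t - 1); ring.
  have [s0 s1] : 0 <= s /\ 0 <= 1 - s by split; lra.
  rewrite ts.
  have h1 : 0 <= s * (1 - s) ^+ 2 by rewrite mulr_ge0// exprn_ge0.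
  have h2 : 0 <= s * s * (1 - s) by rewrite !mulr_ge0.
  have h3 : 0 <= s * s by rewrite mulr_ge0.
  have h4 : 0 <= s * (1 - s) by rewrite mulr_ge0.
  by apply/andP; split; lra.
(* On [[2, 3]] the value of [step t] is [(3 - t) ^ 3 / 6]. *)
rewrite (@pos_part_id t) ?(@pos_part_id (t - 1)) ?(@pos_part_id (t - 2))
  ?(@pos_part_eq0 (t - 3)); try lra.
rewrite expr0n/= subr0.
have t3' : (3 - t) ^+ 3 <= 1 by rewrite exprn_ile1//; lra.
have t3'' : 0 <= (3 - t) ^+ 3 by rewrite exprn_ge0//; lra.
by apply/andP; split; lra.
Qed.

Lemma step1_bound t : `|step1 t| <= 2.
Proof.
have [t0|t0] := lerP t 0.
  rewrite /step1 /third_diff /pos_part !max_r; try lra.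
  by rewrite expr0n/= !(mulr0, subr0, addr0, oppr0, mul0r) normr0.
have [/third_diff_ge3[_ -> _]|t3] := lerP 3 t; first by rewrite normr0.
rewrite /step1 /third_diff; have := posP t 0; rewrite subr0.
have := posP t 1; have := posP t 2; have := posP t 3.
by case=> -[? ->]; case=> -[? ->]; case=> -[? ->]; case=> -[? ->];
  rewrite ?expr0n/= ler_norml; apply/andP; split; nra.
Qed.

Lemma step2_bound t : `|step2 t| <= 2.
Proof.
have [t0|t0] := lerP t 0.
  rewrite /step2 /third_diff /pos_part !max_r; try lra.
  by rewrite !(mulr0, subr0, addr0, oppr0, mul0r) normr0.
have [/third_diff_ge3[_ _ ->]|t3] := lerP 3 t; first by rewrite normr0.
rewrite /step2 /third_diff; have := posP t 0; rewrite subr0.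
have := posP t 1; have := posP t 2; have := posP t 3.
by case=> -[? ->]; case=> -[? ->]; case=> -[? ->]; case=> -[? ->];
  rewrite ler_norml; apply/andP; split; lra.
Qed.

Lemma measurable_third_diff n :
  measurable_fun setT (third_diff (fun s => pos_part s ^+ n)).
Proof.
have m c : measurable_fun setT (fun t => pos_part (t - c) ^+ n).
  apply: measurable_funX; apply: measurable_maxr => //.
  exact: measurable_funB.
have m0 : measurable_fun setT (fun t : R => pos_part t ^+ n).
  by apply: measurable_funX; exact: measurable_maxr.
apply: measurable_funB => //; apply: measurable_funD; last exact: measurable_funM.
apply: measurable_funB => //; exact: measurable_funM.
Qed.

Lemma measurable_step : measurable_fun setT step.
Proof.
apply: measurable_funB => //; apply: measurable_funM => //.
exact: measurable_third_diff.
Qed.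

Lemma measurable_step1 : measurable_fun setT step1.
Proof.
by apply: measurable_funM => //; apply: measurable_funN; exact: measurable_third_diff.
Qed.

Lemma measurable_step2 : measurable_fun setT step2.
Proof.
by apply: measurable_funM => //; apply: measurable_funN; exact: (measurable_third_diff 1).
Qed.

End cubic_step.

Section dot_product.
Context {R : realType} {d : nat}.
Implicit Types (x y h : 'rV[R]_d).

Definition dot x y : R := \sum_(j < d) x ord0 j * y ord0 j.

Lemma nsqD x y : nsq (x + y) = nsq x + 2 * dot x y + nsq y.
Proof.
rewrite /nsq /dot mulr_sumr -!big_split/=; apply: eq_bigr => j _.
by rewrite mxE; ring.
Qed.

Lemma nsqD_le x y : nsq (x + y) <= 2 * nsq x + 2 * nsq y.
Proof.
rewrite /nsq !mulr_sumr -big_split/=; apply: ler_sum => j _; rewrite mxE.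
by have := sqr_ge0 (x ord0 j - y ord0 j); lra.
Qed.

Lemma nsqZ (a : R) x : nsq (a *: x) = a ^+ 2 * nsq x.
Proof. by rewrite /nsq mulr_sumr; apply: eq_bigr => j _; rewrite mxE exprMn. Qed.

Lemma dotZr (a : R) x y : dot x (a *: y) = a * dot x y.
Proof. by rewrite /dot mulr_sumr; apply: eq_bigr => j _; rewrite mxE mulrCA. Qed.

Lemma dot_sq_le x y : dot x y ^+ 2 <= nsq x * nsq y.
Proof.
have [y0|y0] := eqVneq (nsq y) 0.
  suff -> : dot x y = 0 by rewrite expr0n/= y0 mulr0.
  apply: big1 => j _; suff -> : y ord0 j = 0 by rewrite mulr0.
  by apply/eqP; rewrite -sqrf_eq0 eq_le sqr_ge0 -y0 coord_sq_le.
have y1 : 0 < nsq y by rewrite lt_neqAle eq_sym y0 nsq_ge0.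
have := nsq_ge0 (x + (- (dot x y / nsq y)) *: y).
rewrite nsqD nsqZ dotZr => h.
rewrite -subr_ge0 -(pmulr_lge0 _ y1).
set a := dot x y in h *; set b := nsq y in y0 y1 h *.
have -> : (nsq x * b - a ^+ 2) * b = b ^+ 2 * (nsq x + 2 * (- (a / b) * a) + (- (a / b)) ^+ 2 * b).
  by field.
by rewrite mulr_ge0// exprn_ge0// ltW.
Qed.

Lemma dot_norm_le x y (k t : R) : 0 <= k -> 0 <= t ->
  nsq x <= k ^+ 2 -> nsq y = t ^+ 2 -> `|dot x y| <= k * t.
Proof.
move=> k0 t0 xk yt.
rewrite -(@ler_pXn2r _ 2)// ?nnegrE ?mulr_ge0// real_normK ?num_real//.
by rewrite exprMn (le_trans (dot_sq_le x y))// yt ler_wpM2r// exprn_ge0.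
Qed.

End dot_product.

Section radial_step.
Context {R : realType} {d : nat}.
Implicit Types (x : R) (y h : 'rV[R]_d).

Variables (delta K : R).
Hypothesis delta_gt0 : 0 < delta.
Hypothesis K_ge0 : 0 <= K.

(** A smooth stand-in for the indicator of [nsq y <= x], descending over [[x, x + 3 * delta]] on the
    scale of the squared norm, which is also the scale of the statistic. *)
Definition rstep x y := step ((nsq y - x) / delta).

Lemma rstep_itv x y : 0 <= rstep x y <= 1.
Proof. exact: step_itv. Qed.

Lemma rstep_eq1 x y : nsq y <= x -> rstep x y = 1.
Proof. by move=> yx; apply: step_eq1; rewrite pmulr_lle0 ?invr_gt0// subr_le0. Qed.

Lemma rstep_eq0 x y : x + 3 * delta <= nsq y -> rstep x y = 0.
Proof.
move=> yx; have dl := delta_gt0; suff /third_diff_ge3[] : 3 <= (nsq y - x) / delta by [].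
by rewrite ler_pdivlMr//; lra.
Qed.

Let a x y := step1 ((nsq y - x) / delta) / delta.
Let b x y := step2 ((nsq y - x) / delta) / delta ^+ 2.
Let B1 := 2 / delta.
Let B2 := 2 / delta ^+ 2.
Let C1 := 2 / delta ^+ 3.
(** A radius outside which neither [y] nor [y + h] with [enorm h <= 1] meets the region where the
    step varies, for any [x <= K]: it rests on [nsq (y + h) >= nsq y / 2 - nsq h]. *)
Let k := Num.sqrt (2 * (K + 3 * delta) + 2).
(** A sum of nonnegative terms, so that it dominates each bound required by [lindeberg]. It does not
    involve [x]: one constant serves all thresholds up to [K]. *)
Definition rstep_bound := 1 + C1 * (2 * k + 1) ^+ 3 + B2 * (4 * k + 1)
  + B1 * (2 * k + 1) + 4 * B2 * k ^+ 2.

Let B1_ge0 : 0 <= B1. Proof. by rewrite divr_ge0// ltW. Qed.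
Let B2_ge0 : 0 <= B2. Proof. by rewrite divr_ge0// exprn_ge0// ltW. Qed.
Let C1_ge0 : 0 <= C1. Proof. by rewrite divr_ge0// exprn_ge0// ltW. Qed.
Let k2E : k ^+ 2 = 2 * (K + 3 * delta) + 2.
Proof.
rewrite sqr_sqrtr//; have : 0 <= delta by exact: ltW.
by move: K_ge0; lra.
Qed.
Let k_ge0 : 0 <= k. Proof. exact: sqrtr_ge0. Qed.

Let ba x y : `|a x y| <= B1.
Proof.
rewrite /a normrM [`|delta^-1|]ger0_norm ?invr_ge0 ?(ltW delta_gt0)//.
by rewrite /B1 ler_wpM2r ?invr_ge0 ?(ltW delta_gt0)// step1_bound.
Qed.

Let bb x y : `|b x y| <= B2.
Proof.
rewrite /b normrM [`|(delta ^+ 2)^-1|]ger0_norm ?invr_ge0 ?exprn_ge0 ?(ltW delta_gt0)//.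
by rewrite /B2 ler_wpM2r ?invr_ge0 ?exprn_ge0 ?(ltW delta_gt0)// step2_bound.
Qed.

Let ab_eq0 x y : x <= K -> K + 3 * delta <= nsq y -> a x y = 0 /\ b x y = 0.
Proof.
move=> xK yK; have dl := delta_gt0; have : 3 <= (nsq y - x) / delta by rewrite ler_pdivlMr//; lra.
by rewrite /a /b => /third_diff_ge3[_ -> ->]; rewrite !mul0r.
Qed.

Let taylor x y (v : R) :
  `|step ((v - x) / delta) - rstep x y - a x y * (v - nsq y) - b x y * (v - nsq y) ^+ 2|
   <= C1 * `|v - nsq y| ^+ 3.
Proof.
have d0 : delta != 0 by rewrite gt_eqF.
have := step_taylor ((nsq y - x) / delta) ((v - x) / delta).
have -> : (v - x) / delta - (nsq y - x) / delta = (v - nsq y) / delta by field.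
rewrite normrM [`|delta^-1|]ger0_norm ?invr_ge0 ?(ltW delta_gt0)// exprMn exprVn.
rewrite /a /b /C1 /rstep => h.
set lhs := (X in `|X| <= _); set rhs := (X in _ <= X).
move: h; set lhs' := (X in `|X| <= _ -> _); set rhs' := (X in _ <= X -> _).
have <- : lhs' = lhs by rewrite /lhs /lhs'; field.
by have <- : rhs' = rhs by rewrite /rhs /rhs'; field.
Qed.

Definition rgrad (x : R) (j : 'I_d) y := 2 * a x y * y ord0 j.
(** Half the Hessian of [rstep x], since the quadratic term of [lind_exp] carries no factor [1 / 2];
    [b] is already half of a second derivative. *)
Definition rhess (x : R) (i j : 'I_d) y :=
  a x y * (i == j)%:R + 4 * b x y * (y ord0 i * y ord0 j).

Let gradE x y h : \sum_j rgrad x j y * h ord0 j = 2 * a x y * dot y h.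
Proof. by rewrite /rgrad /dot mulr_sumr; apply: eq_bigr => j _; ring. Qed.

Let hessE x y h : \sum_i \sum_j rhess x i j y * (h ord0 i * h ord0 j) =
  a x y * nsq h + 4 * b x y * dot y h ^+ 2.
Proof.
rewrite expr2 {1}/dot mulr_suml [in X in _ + X]mulr_sumr /nsq [in X in X + _]mulr_sumr.
rewrite -big_split/=; apply: eq_bigr => i _.
rewrite /dot [in X in _ + X]mulr_sumr [in X in _ + X]mulr_sumr.
rewrite /rhess; under eq_bigr do rewrite mulrDl.
rewrite big_split/=; congr (_ + _).
  rewrite (bigD1 i)//= eqxx mulr1 big1 ?addr0// => j /negPf ij.
  by rewrite eq_sym ij mulr0 mul0r.
by apply: eq_bigr => j _; ring.
Qed.

Let coord_measurable_a x : coord_measurable (a x).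
Proof.
move=> d1 T u mu; apply: measurable_funM => //.
apply: (measurableT_comp measurable_step1); apply: measurable_funM => //.
by apply: measurable_funB => //; exact: coord_measurable_nsq.
Qed.

Let coord_measurable_b x : coord_measurable (b x).
Proof.
move=> d1 T u mu; apply: measurable_funM => //.
apply: (measurableT_comp measurable_step2); apply: measurable_funM => //.
by apply: measurable_funB => //; exact: coord_measurable_nsq.
Qed.

Lemma coord_measurable_rstep x : coord_measurable (rstep x).
Proof.
move=> d1 T u mu; apply: (measurableT_comp measurable_step).
apply: measurable_funM => //.
by apply: measurable_funB => //; exact: coord_measurable_nsq.
Qed.

Let bound_terms : [/\ 0 <= C1 * (2 * k + 1) ^+ 3, 0 <= B2 * (4 * k + 1),
  0 <= B1, 0 <= B1 * k & 0 <= B2 * k ^+ 2].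
Proof.
have k0 := k_ge0; have k1 : 0 <= 2 * k + 1 by lra.
have k2 : 0 <= 4 * k + 1 by lra.
split; [exact/mulr_ge0/exprn_ge0|exact: mulr_ge0|by []|exact: mulr_ge0|].
exact/mulr_ge0/exprn_ge0.
Qed.

Let bound_parts : [/\ 1 <= rstep_bound,
  C1 * (2 * k + 1) ^+ 3 + B2 * (4 * k + 1) <= rstep_bound,
  1 + B1 * (2 * k + 1) + 4 * B2 * k ^+ 2 <= rstep_bound,
  B1 * (2 * k) <= rstep_bound & B1 + 4 * B2 * k ^+ 2 <= rstep_bound].
Proof.
rewrite /rstep_bound; case: bound_terms; move: B1 B2 C1 k => b1 b2 c1 l.
by move=> *; split; lra.
Qed.

Lemma rstep_bound_ge0 : 0 <= rstep_bound.
Proof. by case: bound_parts => h _ _ _ _; exact: le_trans h. Qed.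

Let remainder x y h : x <= K ->
  `|rstep x (y + h) - rstep x y - 2 * a x y * dot y h
    - (a x y * nsq h + 4 * b x y * dot y h ^+ 2)| <= rstep_bound * lrem h.
Proof.
move=> xK; have dl := delta_gt0; have K0 := K_ge0; have k0 := k_ge0.
have t0 := enorm_ge0 h; have q := enorm_sq h.
set t := enorm h in t0 q *; set p := dot y h.
have [_ hs1 hs2 _ _] := bound_parts.
have [_ _ b0 bk0 bkk0] := bound_terms.
have [t1|t1] := lerP t 1.
  have -> : lrem h = t ^+ 3 by rewrite /lrem -/t -q min_r// -exprS.
  have [yK|yK] := lerP (k ^+ 2) (nsq y).
    have y2 : K + 3 * delta <= nsq (y + h).
      (* Nonnegativity at [y + 2 h] is the inequality [nsq (y + h) >= nsq y / 2 - nsq h]; with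
         [nsq h <= 1] it explains the summand 2 in [k ^ 2]. *)
      have := nsq_ge0 (y + (2 : R) *: h); rewrite nsqD nsqD nsqZ dotZr -q -/p.
      have : t ^+ 2 <= 1 by rewrite exprn_ile1.
      by move: yK; rewrite k2E; lra.
    have y1 : K + 3 * delta <= nsq y by move: yK; rewrite k2E; lra.
    have [-> ->] := ab_eq0 xK y1.
    rewrite !rstep_eq0; [|lra|lra].
    by rewrite !(mulr0, mul0r, subr0, addr0) normr0 mulr_ge0 ?exprn_ge0 ?rstep_bound_ge0.
  have pk : `|p| <= k * t by apply: dot_norm_le => //; exact: ltW.
  have := taylor x y (nsq (y + h)); rewrite -/(rstep x (y + h)).
  have -> : nsq (y + h) - nsq y = 2 * p + t ^+ 2 by rewrite nsqD q -/p; ring.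
  move=> h1.
  have h2 : `|2 * p + t ^+ 2| <= (2 * k + 1) * t.
    rewrite (le_trans (ler_normD _ _))// normrM (@ger0_norm _ 2)// (@ger0_norm _ (t ^+ 2)) ?exprn_ge0//.
    have : t ^+ 2 <= t by rewrite expr2 ler_piMr.
    by lra.
  have h3 : `|2 * p + t ^+ 2| ^+ 3 <= (2 * k + 1) ^+ 3 * t ^+ 3.
    by rewrite -exprMn lerXn2r// nnegrE mulr_ge0//; lra.
  (* The one-variable expansion has [(2 p + t^2)^2] where the Hessian has [4 p^2]; the excess is of
     third order in [t]. *)
  have h4 : `|b x y * (4 * p * t ^+ 2 + t ^+ 4)| <= B2 * ((4 * k + 1) * t ^+ 3).
    rewrite normrM ler_pM// (le_trans (ler_normD _ _))//.
    rewrite (normrM _ (t ^+ 2)) (normrM 4) (@ger0_norm _ 4)//.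
    rewrite (@ger0_norm _ (t ^+ 2)) ?exprn_ge0// (@ger0_norm _ (t ^+ 4)) ?exprn_ge0//.
    rewrite [leRHS]mulrDl mul1r lerD//; last first.
      by rewrite [t ^+ 4]exprS ler_piMl ?exprn_ge0.
    by have := ler_wpM2r (exprn_ge0 2 t0) pk; lra.
  have h5 := ler_wpM2l C1_ge0 h3.
  have h6 : (C1 * (2 * k + 1) ^+ 3 + B2 * (4 * k + 1)) * t ^+ 3 <= rstep_bound * t ^+ 3.
    by rewrite ler_wpM2r ?exprn_ge0//.
  move: h1 h4; rewrite -q -/p !ler_norml => /andP[? ?] /andP[? ?].
  by apply/andP; split; lra.
have -> : lrem h = t ^+ 2 by rewrite /lrem -/t -q min_l ?mul1r// ltW.
have t2 : 1 <= t ^+ 2 by rewrite exprn_ege1// ltW.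
have r0 : `|rstep x (y + h) - rstep x y| <= 1.
  have /andP[? ?] := rstep_itv x (y + h); have /andP[? ?] := rstep_itv x y.
  by rewrite ler_norml; apply/andP; split; lra.
have h6 : (1 + B1 * (2 * k + 1) + 4 * B2 * k ^+ 2) * t ^+ 2 <= rstep_bound * t ^+ 2.
  by rewrite ler_wpM2r ?exprn_ge0//.
apply: le_trans h6; rewrite -q.
have [yK|yK] := lerP (K + 3 * delta) (nsq y).
  have [-> ->] := ab_eq0 xK yK.
  rewrite !(mulr0, mul0r, subr0, addr0) (le_trans r0)// (le_trans t2)//.
  rewrite -[leLHS]mul1r ler_wpM2r ?exprn_ge0//.
  by move: b0 bk0 bkk0; lra.
have pk : `|p| <= k * t by apply: dot_norm_le => //; rewrite k2E; lra.
have h1 : `|2 * a x y * p| <= B1 * (2 * k) * t ^+ 2.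
  rewrite normrM normrM (@ger0_norm _ 2)//.
  have e1 := ler_pM (normr_ge0 _) (normr_ge0 _) (ba x y) pk.
  have tt : t <= t ^+ 2 by rewrite expr2 ler_peMr// ltW.
  by have := ler_wpM2l bk0 tt; lra.
have h2 : `|a x y * t ^+ 2| <= B1 * t ^+ 2.
  by rewrite normrM (@ger0_norm _ (_ ^+ _)) ?exprn_ge0// ler_wpM2r ?exprn_ge0.
have h3 : `|4 * b x y * p ^+ 2| <= 4 * B2 * k ^+ 2 * t ^+ 2.
  rewrite normrM normrM (@ger0_norm _ 4)// normrX.
  have e2 : `|p| ^+ 2 <= (k * t) ^+ 2 by rewrite lerXn2r ?nnegrE ?mulr_ge0.
  have := ler_pM (normr_ge0 _) (exprn_ge0 2 (normr_ge0 p)) (bb x y) e2.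
  by rewrite exprMn; lra.
move: r0 h1 h2 h3; rewrite -/p !ler_norml => /andP[? ?] /andP[? ?] /andP[? ?] /andP[? ?].
by apply/andP; split; lra.
Qed.

Lemma lindeberg_rstep (x : R) : x <= K ->
  lindeberg rstep_bound (rstep x) (rgrad x) (rhess x).
Proof.
move=> xK; have dl := delta_gt0; have K0 := K_ge0; have k0 := k_ge0.
have [hs1 _ _ hs2 hs3] := bound_parts.
have yk y : nsq y < K + 3 * delta -> nsq y <= k ^+ 2 by rewrite k2E; lra.
have yjk y j : nsq y < K + 3 * delta -> `|y ord0 j| <= k.
  move=> /yk yk2; rewrite -(@ler_pXn2r _ 2)// ?nnegrE// real_normK ?num_real//.
  by rewrite (le_trans (coord_sq_le y j)).
split.
- exact: coord_measurable_rstep.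
- move=> j d1 T u mu; apply: measurable_funM => //.
  by apply: measurable_funM => //; exact: coord_measurable_a.
- move=> i j d1 T u mu; apply: measurable_funD.
    by apply: measurable_funM => //; exact: coord_measurable_a.
  apply: measurable_funM; last exact: measurable_funM.
  by apply: measurable_funM => //; exact: coord_measurable_b.
- move=> y; have /andP[? ?] := rstep_itv x y.
  by rewrite ger0_norm// (le_trans _ hs1).
- move=> j y; rewrite /rgrad.
  have [yK|yK] := lerP (K + 3 * delta) (nsq y).
    have [-> _] := ab_eq0 xK yK.
    by rewrite mulr0 mul0r normr0 rstep_bound_ge0.
  apply: le_trans hs2.
  by rewrite normrM normrM (@ger0_norm _ 2)// [2 * _]mulrC -mulrA ler_pM// ?ler_wpM2l// ?mulr_ge0// yjk.
- move=> i j y; rewrite /rhess.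
  have [yK|yK] := lerP (K + 3 * delta) (nsq y).
    have [-> ->] := ab_eq0 xK yK.
    by rewrite mulr0 !mul0r addr0 normr0 rstep_bound_ge0.
  apply: le_trans hs3; rewrite (le_trans (ler_normD _ _))// lerD//.
    rewrite normrM (le_trans _ (ba x y))// ler_piMr//.
    by case: (i == j); rewrite ?normr1 ?normr0.
  rewrite normrM normrM (@ger0_norm _ 4)// ler_pM// ?mulr_ge0// ?ler_wpM2l//.
  by rewrite (le_trans (coordM_le y i j))// yk.
- by move=> y h; rewrite gradE hessE; exact: remainder.
Qed.

End radial_step.

(** * Anticoncentration of random sign sums *)

Section binomial_bound.

(** The step of the induction multiplies the left side by [4 (2m + 1)(2m + 3) / (m + 1)^2], which is
    below 16 because [(2m + 1)(2m + 3) <= (2m + 2)^2]. The factor [2m + 1], rather than [2m], also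
    covers odd sizes later. *)
Lemma central_bin_sq m : (m.*2.+1 * 'C(m.*2, m) ^ 2 <= 16 ^ m)%N.
Proof.
elim: m => [//|m IH].
have e1 : (m.*2.+1 * 'C(m.*2, m) = m.+1 * 'C(m.*2.+1, m))%N.
  have := mul_bin_down m.*2.+1 m; rewrite /= => ->.
  by congr (_ * _)%N; rewrite -addnn -addnS -addSnnS addnK.
have e2 : (m.*2.+2 * 'C(m.*2.+1, m) = m.+1 * 'C(m.*2.+2, m.+1))%N.
  exact: mul_bin_diag m.*2.+2 m.
rewrite doubleS (expnS 16 m).
set c0 := 'C(m.*2, m) in IH e1 *; set c1 := 'C(m.*2.+1, m) in e1 e2.
set c2 := 'C(m.*2.+2, m.+1) in e2 *.
have e3 : c2 = (2 * c1)%N.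
  apply/eqP; rewrite -(eqn_pmul2l (ltn0Sn m)) -e2; apply/eqP; rewrite -muln2; nia.
rewrite -(@leq_pmul2l (m.+1 ^ 2)) ?expn_gt0//.
rewrite e3; rewrite -muln2 in IH e1 *.
have : (m.+1 * c1 * (m.+1 * c1) = (m * 2).+1 * c0 * ((m * 2).+1 * c0))%N by rewrite e1.
move: (16 ^ m)%N IH; rewrite -!mulnn => K IH e.
have -> : (m.+1 * m.+1 * ((m * 2).+3 * (2 * c1 * (2 * c1))) =
    4 * (m * 2).+3 * (m * 2).+1 * ((m * 2).+1 * (c0 * c0)))%N.
  transitivity (4 * (m * 2).+3 * (m.+1 * c1 * (m.+1 * c1)))%N; first by lia.
  by rewrite e; lia.
apply: (@leq_trans (4 * (m * 2).+3 * (m * 2).+1 * K)); first by rewrite leq_mul2l IH orbT.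
by rewrite mulnA leq_mul2r; apply/orP; right; lia.
Qed.

Lemma bin_le_central m k : ('C(m.*2, k) <= 'C(m.*2, m))%N.
Proof.
have low i j : (i + j = m)%N -> ('C(m.*2, i) <= 'C(m.*2, m))%N.
  elim: j i => [|j IH] i ij; first by rewrite -ij addn0.
  apply: leq_trans (IH i.+1 _); last by rewrite addSnnS.
  rewrite -(leq_pmul2l (ltn0Sn i)) mul_bin_left leq_mul2r; apply/orP; right.
  by rewrite -addnn; lia.
have [km|mk] := leqP k m; first by apply: (low k (m - k)%N); rewrite subnKC.
have [k2|k2] := leqP k m.*2; last by rewrite bin_small.
rewrite -bin_sub//; apply: (low _ (k - m)%N); rewrite -addnn in k2 *; lia.
Qed.

(** No value of a sum of [n] random signs has probability above [1 / sqrt n]; the squared form stays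
    within [nat]. Odd [n] is reduced to even [n] by Pascal's rule. *)
Lemma bin_sq_le n k : (n * 'C(n, k) ^ 2 <= 4 ^ n)%N.
Proof.
rewrite -(odd_double_half n); set m := n./2.
have h := central_bin_sq m.
have e4 : (4 ^ m.*2 = 16 ^ m)%N by rewrite -muln2 mulnC expnM.
case: (odd n) => /=; last first.
  rewrite add0n e4; apply: leq_trans h; apply: leq_mul => //.
  by rewrite leq_exp2r// bin_le_central.
rewrite add1n (expnS 4) e4.
have : ('C(m.*2.+1, k) <= 2 * 'C(m.*2, m))%N.
  case: k => [|k]; first by rewrite bin0 muln_gt0 bin_gt0 -addnn leq_addr.
  by rewrite binS mul2n -[leqRHS]addnn leq_add// bin_le_central.
move: ('C(m.*2.+1, k)) ('C(m.*2, m)) h => a b h ab.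
apply: (@leq_trans (m.*2.+1 * (2 * b) ^ 2)).
  by rewrite leq_mul2l leq_exp2r ?ab ?orbT.
by rewrite expnMn mulnCA leq_mul2l h orbT.
Qed.

Lemma card_diameter (R : realDomainType) N (A : {set 'I_N}) (D : R) : 0 <= D ->
  (forall i j : 'I_N, i \in A -> j \in A -> (i <= j)%N -> (j - i)%:R <= D) ->
  #|A|%:R <= D + 1.
Proof.
move=> D0 AD; case: (set_0Vmem A) => [->|[x xA]]; first by rewrite cards0 addr_ge0.
have [i0 i0A i0P] : exists2 i0 : 'I_N, i0 \in A & forall j : 'I_N, j \in A -> (i0 <= j)%N.
  case: (@arg_minnP 'I_N x (fun i => i \in A) (fun i => i : nat) xA) => i ? ?.
  by exists i.
have [j0 j0A j0P] : exists2 j0 : 'I_N, j0 \in A & forall j : 'I_N, j \in A -> (j <= j0)%N.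
  case: (@arg_maxnP 'I_N x (fun i => i \in A) (fun i => i : nat) xA) => i ? ?.
  by exists i.
have cA : (#|A| <= (j0 - i0).+1)%N.
  rewrite cardE -(size_map val) -(size_iota i0 (j0 - i0).+1).
  apply: uniq_leq_size; first by rewrite map_inj_uniq ?enum_uniq//; exact: val_inj.
  move=> k /mapP[i]; rewrite mem_enum => iA ->.
  rewrite mem_iota i0P//= addnS subnKC ?i0P// ltnS; exact: j0P.
apply: (@le_trans _ _ (j0 - i0).+1%:R); first by rewrite ler_nat.
by rewrite -natr1 lerD2r AD// i0P.
Qed.

End binomial_bound.

(** * Sums of independent draws from finite families, as iterated averages *)

Section iterated_average.
Context {R : realType} {d : nat}.
Implicit Types (y : 'rV[R]_d) (f g : 'rV[R]_d -> R).

Section general.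
Context {I : finType} (w : I -> 'rV[R]_d).
Hypothesis I_gt0 : (0 < #|I|)%N.

Lemma Avg_le f g : (forall y, f y <= g y) -> forall y, Avg w f y <= Avg w g y.
Proof. by move=> fg y; apply: avg_le => i. Qed.

Lemma iter_Avg_le n f g : (forall y, f y <= g y) ->
  forall y, iter n (Avg w) f y <= iter n (Avg w) g y.
Proof. by move=> fg; elim: n => //= n IH; exact: Avg_le. Qed.

Lemma iter_Avg_ub n f (C : R) : (forall y, f y <= C) ->
  forall y, iter n (Avg w) f y <= C.
Proof.
move=> fC; elim: n => //= n IH y.
by rewrite -[leRHS](avg_cst I_gt0) avg_le.
Qed.

Lemma AvgB f g y : Avg w (fun y => f y - g y) y = Avg w f y - Avg w g y.
Proof. by rewrite /Avg sumrB mulrBr. Qed.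

Lemma iter_AvgB n f g y :
  iter n (Avg w) (fun y => f y - g y) y = iter n (Avg w) f y - iter n (Avg w) g y.
Proof.
elim: n y => //= n IH y; rewrite -AvgB; congr (Avg w _ y).
by apply/funext => x; exact: IH.
Qed.

(** Second moments of centered independent draws add up. The form [1 - a * nsq y] is the minorant
    needed for Markov's inequality. *)
Lemma iter_Avg_nsq n (a v : R) y : (forall j, \sum_k w k ord0 j = 0) ->
  #|I|%:R^-1 * (\sum_k nsq (w k)) = v ->
  iter n (Avg w) (fun y => 1 - a * nsq y) y = 1 - a * (nsq y + n%:R * v).
Proof.
move=> w0 wv; elim: n y => [|n IH] y; first by rewrite mul0r addr0.
rewrite iterS /Avg; under eq_bigr do rewrite IH.
rewrite sumrB mulrBr avg_cst//; congr (_ - _).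
rewrite -mulr_sumr mulrCA; congr (_ * _).
under eq_bigr do rewrite nsqD.
rewrite !big_split/= -mulr_sumr.
have -> : \sum_k dot y (w k) = 0.
  rewrite /dot exchange_big/= big1// => j _.
  by rewrite -mulr_sumr w0 mulr0.
rewrite mulr0 addr0 !mulrDr !avg_cst// wv -natr1; ring.
Qed.

End general.

Lemma AvgC (I J : finType) (w : I -> 'rV[R]_d) (v : J -> 'rV[R]_d) f y :
  Avg w (Avg v f) y = Avg v (Avg w f) y.
Proof.
rewrite /Avg -!mulr_sumr mulrCA exchange_big/=; congr (_ * (_ * _)).
by apply: eq_bigr => j _; apply: eq_bigr => i _; rewrite addrAC.
Qed.

(** Averages commute, so all draws from [v] can be carried out before those from [w]. This is
    conditioning on the draws from [w]. *)
Lemma iter_AvgM (I J : finType) (w : I -> 'rV[R]_d) (v : J -> 'rV[R]_d) n f y :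
  iter n (Avg (fun ij : I * J => w ij.1 + v ij.2)) f y =
  iter n (Avg w) (iter n (Avg v) f) y.
Proof.
have prodE g x : Avg (fun ij : I * J => w ij.1 + v ij.2) g x = Avg w (Avg v g) x.
  rewrite /Avg card_prod natrM invfM -mulrA; congr (_ * _).
  rewrite -mulr_sumr (pair_big predT predT (fun i j => g (x + w i + v j)))/=.
  by congr (_ * _); apply: eq_bigr => ij _; rewrite addrA.
have comm m g x : Avg v (iter m (Avg w) g) x = iter m (Avg w) (Avg v g) x.
  elim: m x => //= m IH x; rewrite AvgC; congr (Avg w _ x).
  by apply/funext => z; exact: IH.
elim: n y => //= n IH y; rewrite prodE; congr (Avg w _ y).
apply/funext => z.
rewrite -comm; congr (Avg v _ z).
by apply/funext => u; exact: IH.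
Qed.

Definition flip (b : 'rV[R]_d) (s : bool) : 'rV[R]_d := if s then b else - b.

Lemma iter_flip (b : 'rV[R]_d) n f y : iter n (Avg (flip b)) f y =
  2^-n * \sum_(k < n.+1) 'C(n, k)%:R * f (y + ((2 * k)%:R - n%:R) *: b).
Proof.
elim: n y => [|n IH] y.
  by rewrite big_ord1 /= expr0 invr1 !mul1r muln0 subrr scale0r addr0.
rewrite iterS {1}/Avg card_bool.
rewrite (bigD1 true)//= (bigD1 false)//= big1 ?addr0; last by case.
rewrite !IH -mulrDr mulrA -invfM -exprS; congr (_ * _).
have -> : \sum_(k < n.+2) 'C(n.+1, k)%:R * f (y + ((2 * k)%:R - n.+1%:R) *: b) =
   \sum_(k < n.+1) 'C(n, k)%:R * f (y + ((2 * k.+1)%:R - n.+1%:R) *: b) +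
   \sum_(k < n.+1) 'C(n, k)%:R * f (y + ((2 * k)%:R - n.+1%:R) *: b).
  rewrite big_ord_recl/= [X in _ = _ + X]big_ord_recl/= !bin0 addrCA; congr (_ + _).
  under eq_bigr do rewrite /bump/= add1n binS natrD mulrDl.
  rewrite big_split/= addrC; congr (_ + _).
  by rewrite big_ord_recr/= (bin_small (ltnSn n)) mul0r addr0.
congr (_ + _); apply: eq_bigr => k _; congr (_ * f _).
  rewrite -addrA; congr (_ + _); rewrite -{1}[b]scale1r -scalerDl; congr (_ *: _).
  by rewrite mulnS natrD -natr1; ring.
rewrite -addrA; congr (_ + _); rewrite -scaleN1r -scalerDl; congr (_ *: _).
by rewrite -natr1; ring.
Qed.

(** Along the line [y + s *: b] the squared norm is [B * (s + s0) ^ 2] plus a constant. On one side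
    of the vertex [(v - u) ^ 2 <= v ^ 2 - u ^ 2], so the values of [s] landing in the shell span at
    most [sqrt ((hi - lo) / B)]. Consecutive [s k] are 2 apart, whence the 4 and at most [D + 1]
    indices on each side; each index has probability at most [1 / sqrt n]. *)
Lemma flip_anticoncentration (b : 'rV[R]_d) (lo hi : R) n f y :
  (0 < n)%N -> 0 < nsq b -> lo <= hi -> (forall y, f y <= 1) ->
  (forall y, 0 < f y -> lo <= nsq y <= hi) ->
  iter n (Avg (flip b)) f y <=
    2 / Num.sqrt n%:R * (Num.sqrt ((hi - lo) / (4 * nsq b)) + 1).
Proof.
move=> n0 b0 lohi f1 fs; rewrite iter_flip.
set B := nsq b in b0 *; pose s0 := dot y b / B.
pose s (k : nat) : R := (2 * k)%:R - n%:R.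
pose D := Num.sqrt ((hi - lo) / (4 * B)).
have D0 : 0 <= D by exact: sqrtr_ge0.
have nsqE k : nsq (y + s k *: b) = B * (s k + s0) ^+ 2 + (nsq y - B * s0 ^+ 2).
  have complete_square (B' p u v : R) : B' != 0 ->
      v + 2 * (u * p) + u ^+ 2 * B' = B' * (u + p / B') ^+ 2 + (v - B' * (p / B') ^+ 2).
    by move=> ?; field.
  by rewrite nsqD nsqZ dotZr complete_square ?gt_eqF.
pose S k := 0 < f (y + s k *: b).
pose A1 : {set 'I_n.+1} := finset (fun k : 'I_n.+1 => S k && (0 <= s k + s0)).
pose A2 : {set 'I_n.+1} := finset (fun k : 'I_n.+1 => S k && (s k + s0 <= 0)).
have close (u v : R) : 0 <= u -> u <= v -> B * v ^+ 2 - B * u ^+ 2 <= hi - lo ->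
    B * (v - u) ^+ 2 <= hi - lo.
  move=> u0 uv; apply: le_trans; rewrite -mulrBr ler_wpM2l//; first exact: ltW.
  have h : 0 <= u * (v - u) by rewrite mulr_ge0 ?subr_ge0.
  by lra.
have diam (i j : nat) : (i <= j)%N -> B * (s j - s i) ^+ 2 <= hi - lo -> (j - i)%:R <= D.
  move=> ij h; rewrite /D -(ler_sqr _ _)/= ?nnegrE//.
  have -> : D ^+ 2 = (hi - lo) / (4 * B).
    by rewrite sqr_sqrtr// divr_ge0 ?subr_ge0// mulr_ge0// ltW.
  rewrite ler_pdivlMr ?mulr_gt0//; apply: le_trans h.
  rewrite natrB// le_eqVlt; apply/orP; left; apply/eqP.
  by rewrite /s !natrM; ring.
have cond (i j : nat) : S i -> S j ->
    B * (s j + s0) ^+ 2 - B * (s i + s0) ^+ 2 <= hi - lo.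
  move=> /fs; rewrite nsqE => /andP[l1 h1] /fs; rewrite nsqE => /andP[l2 h2]; lra.
have c1 : #|A1|%:R <= D + 1.
  apply: (@card_diameter R n.+1 A1 D D0) => i j; rewrite !inE => /andP[Si i0] /andP[Sj j0] ij.
  apply: diam => //; have <- : s j + s0 - (s i + s0) = s j - s i by ring.
  apply: close => //; last exact: cond.
  by rewrite lerD2r /s lerD2r ler_nat leq_mul2l ij.
have c2 : #|A2|%:R <= D + 1.
  apply: (@card_diameter R n.+1 A2 D D0) => i j; rewrite !inE => /andP[Si i0] /andP[Sj j0] ij.
  apply: diam => //; have <- : - (s i + s0) - (- (s j + s0)) = s j - s i by ring.
  apply: close; last by rewrite !sqrrN; exact: cond.
    by rewrite oppr_ge0.
  by rewrite lerN2 lerD2r /s lerD2r ler_nat leq_mul2l ij.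
have sn0 : 0 < Num.sqrt n%:R :> R by rewrite sqrtr_gt0 ltr0n.
have bin_le k : 'C(n, k)%:R <= 2 ^+ n / Num.sqrt n%:R :> R.
  rewrite ler_pdivlMr// -(ler_sqr _ _) ?nnegrE ?mulr_ge0 ?exprn_ge0 ?sqrtr_ge0//.
  rewrite exprMn sqr_sqrtr// -exprM mulnC exprM -!natrX -natrM ler_nat mulnC.
  exact: bin_sq_le.
apply: (@le_trans _ _ (2^-n * \sum_(k in A1 :|: A2) 2 ^+ n / Num.sqrt n%:R)).
  rewrite ler_wpM2l ?invr_ge0 ?exprn_ge0//.
  rewrite [leRHS]big_mkcond/=; apply: ler_sum => k _.
  have r0 : 0 <= 2 ^+ n / Num.sqrt n%:R :> R by rewrite divr_ge0 ?exprn_ge0// ltW.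
  have [Sk|] := boolP (S k); last first.
    rewrite /S -leNgt => fk; apply: (@le_trans _ _ 0); last by case: ifP.
    by rewrite mulr_ge0_le0.
  have -> : (k \in A1 :|: A2).
    by rewrite !inE Sk/=; case: (lerP 0 (s k + s0)) => // /ltW ->.
  rewrite (le_trans _ (bin_le k))// ler_piMr//.
rewrite sumr_const -[X in _ * X]mulr_natl mulrCA mulKf ?expf_neq0 ?pnatr_eq0//.
rewrite -/D [leRHS]mulrAC ler_pM2r ?invr_gt0//.
have cU : #|A1 :|: A2|%:R <= #|A1|%:R + #|A2|%:R :> R.
  by rewrite -natrD ler_nat cardsU leq_subr.
by lra.
Qed.

End iterated_average.

(** * Smoothing a finite sample *)

Section smoothing.
Context {R : realType} {d n : nat}.
Variables (c : 'I_n -> 'rV[R]_d) (j0 : 'I_d).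
Hypothesis n_gt0 : (0 < n)%N.
Hypothesis c0 : forall j, \sum_i c i ord0 j = 0.

Definition scov (j k : 'I_d) : R := n%:R^-1 * \sum_i c i ord0 j * c i ord0 k.
Hypothesis q_gt0 : 0 < scov j0 j0.

Local Notation q := (scov j0 j0).
Definition strace : R := \sum_j scov j j.

(* [c i = r i + (c i)_j0 / sqrt q *: b] splits off the linear regression on the
   coordinate [j0]. Replacing the regressor [(c i)_j0 / sqrt q] by an independent
   random sign preserves mean and covariance. *)
Definition smooth_dir : 'rV[R]_d := \row_j (scov j j0 / Num.sqrt q).
Definition smooth_res (i : 'I_n) : 'rV[R]_d := c i - (c i ord0 j0 / Num.sqrt q) *: smooth_dir.

Local Notation b := smooth_dir.
Local Notation sn := (Num.sqrt n%:R : R).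

(** A uniform pair makes the sign independent of the residual, and the sum form is the one that
    [iter_AvgM] separates. The scaling makes [n] draws together have the empirical covariance. *)
Definition smooth_family (p : 'I_n * bool) : 'rV[R]_d :=
  sn^-1 *: smooth_res p.1 + flip (sn^-1 *: b) p.2.

Let sn_gt0 : 0 < sn. Proof. by rewrite sqrtr_gt0 ltr0n. Qed.
Let sq_gt0 : 0 < Num.sqrt q. Proof. by rewrite sqrtr_gt0. Qed.
Let sq2 : Num.sqrt q ^+ 2 = q. Proof. by rewrite sqr_sqrtr// ltW. Qed.
Let sn2 : sn ^+ 2 = n%:R. Proof. by rewrite sqr_sqrtr. Qed.

Lemma sum_pair_bool (F : 'I_n * bool -> R) :
  \sum_p F p = \sum_i (F (i, true) + F (i, false)).
Proof.
transitivity (\sum_i \sum_s F (i, s)).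
  by rewrite pair_bigA; apply: eq_bigr => -[].
by apply: eq_bigr => i _; rewrite big_bool.
Qed.

Let W_coord i s j : smooth_family (i, s) ord0 j =
  sn^-1 * (smooth_res i ord0 j + (if s then 1 else -1) * b ord0 j).
Proof. by rewrite /smooth_family /flip; case: s; rewrite !mxE/=; ring. Qed.

Let res_coord i j : smooth_res i ord0 j = c i ord0 j - c i ord0 j0 / Num.sqrt q * b ord0 j.
Proof. by rewrite !mxE. Qed.

Lemma smooth_family_sum j : \sum_p smooth_family p ord0 j = 0.
Proof.
rewrite sum_pair_bool.
under eq_bigr => i _.
  rewrite !W_coord res_coord.
  rewrite (_ : _ + _ = 2 * sn^-1 * c i ord0 j - 2 * sn^-1 / Num.sqrt q * b ord0 j * c i ord0 j0); last by ring.
  over.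
by rewrite big_split/= sumrN -!mulr_sumr !c0 !mulr0 subr0.
Qed.

Let sum_cc j k : \sum_i c i ord0 j * c i ord0 k = n%:R * scov j k.
Proof. by rewrite /scov mulrA divff ?mul1r// pnatr_eq0 -lt0n. Qed.

(** Summing over the two signs cancels the mixed terms. The residuals have covariance [scov] minus
    the rank-one matrix of [smooth_dir], and the sign restores exactly this matrix. *)
Lemma smooth_family_cov j k : avg_cov smooth_family j k = scov j k / n%:R.
Proof.
rewrite /avg_cov sum_pair_bool card_prod card_ord card_bool.
have sqE : Num.sqrt q != 0 by rewrite gt_eqF.
have alg (t s x y z u v : R) : s != 0 ->
    t * (x - z / s * u + 1 * u) * (t * (y - z / s * v + 1 * v)) +
    t * (x - z / s * u + -1 * u) * (t * (y - z / s * v + -1 * v)) =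
    2 * t ^+ 2 * (x * y) - 2 * t ^+ 2 / s * v * (x * z) - 2 * t ^+ 2 / s * u * (y * z)
    + 2 * t ^+ 2 / s ^+ 2 * u * v * (z * z) + 2 * t ^+ 2 * u * v.
  by move=> s0; field.
under eq_bigr => i _.
  rewrite !W_coord !res_coord alg//.
  over.
rewrite !big_split/= !sumrN -!mulr_sumr !sum_cc sumr_const card_ord.
rewrite -[b ord0 k *+ n]mulr_natl !mxE (exprVn sn 2) sn2 natrM.
have nE : n%:R != 0 :> R by rewrite pnatr_eq0 -lt0n.
move: sq2 sqE nE; move: (Num.sqrt q) => s.
move: q (scov j k) (scov j j0) (scov k j0) (n%:R : R).
by move=> Q x y z m <- s0 m0; field; rewrite ?s0 ?m0.
Qed.

Lemma smooth_family_nsq :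
  #|{: 'I_n * bool}|%:R^-1 * (\sum_p nsq (smooth_family p)) = strace / n%:R.
Proof.
rewrite /nsq exchange_big/= mulr_sumr /strace mulr_suml; apply: eq_bigr => j _.
by rewrite -smooth_family_cov /avg_cov; congr (_ * _); apply: eq_bigr => p _; rewrite expr2.
Qed.

Lemma strace_nsq : strace = n%:R^-1 * \sum_i nsq (c i).
Proof.
rewrite /strace /nsq exchange_big/= mulr_sumr; apply: eq_bigr => j _.
by rewrite /scov; congr (_ * _); apply: eq_bigr => i _; rewrite expr2.
Qed.

Lemma strace_ge0 : 0 <= strace.
Proof. by rewrite strace_nsq mulr_ge0 ?invr_ge0// sumr_ge0// => i _; exact: nsq_ge0. Qed.

Lemma smooth_dir_ge : q <= nsq b.
Proof.
rewrite (le_trans _ (coord_sq_le b j0))// mxE exprMn exprVn sq2.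
by rewrite expr2 mulfK// gt_eqF.
Qed.

Lemma scov_sq_le j : scov j j0 ^+ 2 <= scov j j * q.
Proof.
have n0 : 0 < n%:R :> R by rewrite ltr0n.
pose t := scov j j0 / q.
have : 0 <= n%:R^-1 * \sum_i (c i ord0 j - t * c i ord0 j0) ^+ 2.
  by rewrite mulr_ge0 ?invr_ge0// sumr_ge0// => i _; exact: sqr_ge0.
have -> : n%:R^-1 * \sum_i (c i ord0 j - t * c i ord0 j0) ^+ 2 =
    scov j j - 2 * t * scov j j0 + t ^+ 2 * q.
  rewrite /scov 2![_ * (n%:R^-1 * _)]mulrCA -mulrBr -mulrDr; congr (_ * _).
  rewrite !mulr_sumr -sumrB -big_split/=; apply: eq_bigr => i _; ring.
move=> h; rewrite -subr_ge0.
have qE : q != 0 by rewrite gt_eqF.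
have -> : scov j j * q - scov j j0 ^+ 2 = q * (scov j j - 2 * t * scov j j0 + t ^+ 2 * q).
  by rewrite /t; move: q (scov j j) (scov j j0) qE => Q x y Q0; field.
by rewrite mulr_ge0// ltW.
Qed.

Lemma smooth_dir_le : nsq b <= strace.
Proof.
apply: ler_sum => j _; rewrite mxE exprMn exprVn sq2 ler_pdivrMr//.
exact: scov_sq_le.
Qed.

(** The longest vector of the family is controlled by the longest observation, so Lindeberg's
    condition passes from the data to the replaced vectors. *)
Lemma smooth_family_le (mu : R) p : (forall i, nsq (c i) <= mu) ->
  nsq (smooth_family p) <= (4 * mu + 4 * (mu * strace / q) + 2 * strace) / n%:R.
Proof.
move=> cmu; have t0 := strace_ge0; have bt := smooth_dir_le.
case: p => i s; rewrite /smooth_family/=.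
have -> : flip (sn^-1 *: b) s = sn^-1 *: flip b s by rewrite /flip; case: s; rewrite ?scalerN.
rewrite -scalerDr nsqZ exprVn sn2 mulrC ler_wpM2r ?invr_ge0//.
rewrite (le_trans (nsqD_le _ _))//.
have -> : nsq (flip b s) = nsq b.
  by rewrite /flip; case: s => //; apply: eq_bigr => j _; rewrite mxE sqrrN.
have hr : nsq (smooth_res i) <= 2 * mu + 2 * (mu * strace / q).
  rewrite /smooth_res -scaleNr (le_trans (nsqD_le _ _))// lerD ?ler_wpM2l//.
  rewrite nsqZ sqrrN exprMn exprVn sq2 mulrAC ler_wpM2r ?invr_ge0 ?(ltW q_gt0)//.
  rewrite ler_pM ?sqr_ge0 ?nsq_ge0// (le_trans _ (cmu i))// coord_sq_le//.
lra.
Qed.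

End smoothing.

(** * Comparing two rows of a triangular array *)

Section probability_of_ball.
Context {R : realType} {d} {T : measurableType d} (P : probability T R).

Lemma Rintegral_indic (A : set T) : measurable A -> \int[P]_t \1_A t = fine (P A).
Proof. by move=> mA; rewrite /Rintegral integral_indic// setIT. Qed.

Lemma integrable_indicR (A : set T) : measurable A ->
  P.-integrable setT (EFin \o \1_A).
Proof.
move=> mA; apply: (@bounded_integrable _ _ _ _ _ 1) => // t.
by rewrite indicE; case: (_ \in _); rewrite ?normr1 ?normr0.
Qed.

Lemma prob_le_Rintegral (A : set T) (g : T -> R) : measurable A ->
  P.-integrable setT (EFin \o g) -> (forall t, 0 <= g t) ->
  (forall t, A t -> 1 <= g t) -> fine (P A) <= \int[P]_t g t.
Proof.
move=> mA ig g0 g1; rewrite -Rintegral_indic//; apply: le_Rintegral => //.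
  exact: integrable_indicR.
move=> t _; rewrite indicE; case: (boolP (t \in A)) => [/set_mem /g1//|_].
exact: g0.
Qed.

Lemma Rintegral_le_prob (A : set T) (g : T -> R) : measurable A ->
  P.-integrable setT (EFin \o g) -> (forall t, g t <= 1) ->
  (forall t, ~ A t -> g t <= 0) -> \int[P]_t g t <= fine (P A).
Proof.
move=> mA ig g0 g1; rewrite -Rintegral_indic//; apply: le_Rintegral => //.
  exact: integrable_indicR.
move=> t _; rewrite indicE; case: (boolP (t \in A)) => [_|/negP tA]; first exact: g0.
by apply: g1 => At; apply: tA; exact: mem_set.
Qed.

Lemma measurable_sublevel (f : T -> R) (x : R) : measurable_fun setT f ->
  measurable [set t | f t <= x].
Proof.
move=> mf; have := measurable_fun_ler mf (@measurable_cst _ _ T R setT x).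
by move=> /(_ measurableT [set true] I); rewrite setTI; congr measurable.
Qed.

End probability_of_ball.

Section row.
Context {R : realType} {d : nat}.

(* Row [z (Y 0), ..., z (Y (n - 1))] of a triangular array: independent centered
   summands with common covariance [Q] and Lindeberg remainder at most [r]. *)
Record centered_row {d1 d2} {T : measurableType d1} {E : measurableType d2}
    (P : probability T R) (Y : nat -> T -> E) (z : E -> 'rV[R]_d) (n : nat)
    (Q : 'I_d -> 'I_d -> R) (r : R) : Prop := CenteredRow {
  row_mY : forall k, measurable_fun setT (Y k);
  row_indep : independent_upto P Y n;
  row_mz : forall j, measurable_fun setT (fun e => z e ord0 j);
  row_sq : forall k, (k < n)%N -> P.-integrable setT (EFin \o (fun t => nsq (z (Y k t))));
  row_mean : forall k j, (k < n)%N -> \int[P]_t z (Y k t) ord0 j = 0;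
  row_cov : forall k i j, (k < n)%N ->
    \int[P]_t (z (Y k t) ord0 i * z (Y k t) ord0 j) = Q i j;
  row_rem : forall k, (k < n)%N -> \int[P]_t lrem (z (Y k t)) <= r }.

Definition ball_prob {d1 d2} {T : measurableType d1} {E : measurableType d2}
    (P : probability T R) (Y : nat -> T -> E) (z : E -> 'rV[R]_d) (n : nat) (x : R) : R :=
  fine (P [set t | nsq (psum Y z n t) <= x]).

Lemma measurable_psum_ball {d1 d2} {T : measurableType d1} {E : measurableType d2}
    (Y : nat -> T -> E) (z : E -> 'rV[R]_d) (n : nat) (x : R) :
  (forall k, measurable_fun setT (Y k)) ->
  (forall j, measurable_fun setT (fun e => z e ord0 j)) ->
  measurable [set t | nsq (psum Y z n t) <= x].
Proof.
move=> mY mz; apply: measurable_sublevel; apply: coord_measurable_nsq => j.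
exact: (past_measurable_fun mY (@psum_past _ _ _ _ _ _ _ _ mz n j)).
Qed.

(** The indicator of the ball lies between [rstep] at [x - 3 * delta] and at [x]; both are compared
    with the family [w] by replacement. *)
Lemma ball_prob_sandwich {d1 d2} {T : measurableType d1} {E : measurableType d2}
    (P : probability T R) (Y : nat -> T -> E) (z : E -> 'rV[R]_d) (n : nat)
    (Q : 'I_d -> 'I_d -> R) (r : R)
    {I : finType} (w : I -> 'rV[R]_d) (r' delta K x : R) :
  centered_row P Y z n Q r -> (0 < #|I|)%N -> (forall j, \sum_k w k ord0 j = 0) ->
  #|I|%:R^-1 * (\sum_k lrem (w k)) <= r' -> 0 < delta -> 0 <= K -> x <= K ->
  forall err, err = n%:R * (rstep_bound delta K * replacement_error Q r w r') ->
  iter n (Avg w) (rstep delta (x - 3 * delta)) 0 - err <= ball_prob P Y z n x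
    <= iter n (Avg w) (rstep delta x) 0 + err.
Proof.
move=> row I0 w0 wr d0 K0 xK err errE.
case: (row) => mY indep mz isq mean0 covQ rem_le.
have mS : measurable_fun setT (fun t => nsq (psum Y z n t)).
  apply: coord_measurable_nsq => j.
  exact: (past_measurable_fun mY (@psum_past _ _ _ _ _ _ _ _ mz n j)).
have mA := measurable_psum_ball n x mY mz.
have C0 := rstep_bound_ge0 K d0.
have cmp u : u <= K ->
    `|\int[P]_t rstep delta u (psum Y z n t) - iter n (Avg w) (rstep delta u) 0| <= err.
  move=> uK; rewrite errE; apply: (lindeberg_compare mY indep mz isq mean0 covQ rem_le I0 w0 wr C0).
  exact: lindeberg_rstep.
have iu u : P.-integrable setT (EFin \o (fun t => rstep delta u (psum Y z n t))).
  apply: (@bounded_integrable _ _ _ _ _ 1).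
    apply: (measurableT_comp measurable_step); apply: measurable_funM => //.
    exact: measurable_funB.
  by move=> t; have /andP[? ?] := rstep_itv delta u (psum Y z n t); rewrite ger0_norm.
have x3 : x - 3 * delta <= K by lra.
have up : ball_prob P Y z n x <= \int[P]_t rstep delta x (psum Y z n t).
  apply: prob_le_Rintegral => // t.
    by case/andP: (rstep_itv delta x (psum Y z n t)).
  by move=> /= tx; rewrite rstep_eq1.
have low : \int[P]_t rstep delta (x - 3 * delta) (psum Y z n t) <= ball_prob P Y z n x.
  apply: Rintegral_le_prob => // t.
    by case/andP: (rstep_itv delta (x - 3 * delta) (psum Y z n t)).
  by move=> /= /negP; rewrite -ltNge => tx; rewrite rstep_eq0// subrK ltW.
have := cmp _ xK; have := cmp _ x3; rewrite !ler_norml => /andP[? ?] /andP[? ?].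
by apply/andP; split; lra.
Qed.

End row.

Section sandwich.
Context {R : realType} {d n : nat}.
Variables (c : 'I_n -> 'rV[R]_d) (j0 : 'I_d).
Hypothesis n_gt0 : (0 < n)%N.
Hypothesis c0 : forall j, \sum_i c i ord0 j = 0.
Hypothesis q_gt0 : 0 < scov c j0 j0.
Variables (delta : R).
Hypothesis delta_gt0 : 0 < delta.

Local Notation w := (smooth_family c j0).
Local Notation B x := (iter n (Avg w) (rstep delta x) 0).

(** The difference of the two steps is at most 1 and positive only in the shell of squared radii
    [x - 3 * delta] to [x + 3 * delta]. Averaging over the residuals costs nothing, since the bound
    for signs is uniform in the starting point. The scaling of [b] cancels the factor [1 / sqrt n]
    in the main term, leaving it only in the rounding term. *)
Lemma smooth_anticoncentration x :
  B x - B (x - 3 * delta) <=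
    Num.sqrt (6 * delta / scov c j0 j0) + 2 / Num.sqrt n%:R.
Proof.
rewrite -iter_AvgB.
pose v i := (Num.sqrt n%:R)^-1 *: smooth_res c j0 i.
pose b := (Num.sqrt n%:R)^-1 *: smooth_dir c j0.
have -> : smooth_family c j0 = fun p => v p.1 + flip b p.2 by [].
rewrite iter_AvgM.
have n0 : 0 < n%:R :> R by rewrite ltr0n.
have qb := smooth_dir_ge q_gt0.
have B0 : 0 < nsq (smooth_dir c j0) by exact: lt_le_trans qb.
have bE : nsq b = nsq (smooth_dir c j0) / n%:R.
  by rewrite nsqZ exprVn sqr_sqrtr// mulrC.
apply: iter_Avg_ub => [|y]; first by rewrite card_ord.
apply: (@le_trans _ _ (2 / Num.sqrt n%:R *
    (Num.sqrt (((x + 3 * delta) - (x - 3 * delta)) / (4 * nsq b)) + 1))).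
  have dl := delta_gt0.
  apply: flip_anticoncentration => //.
  - by rewrite bE divr_gt0.
  - lra.
  - move=> u; have /andP[? ?] := rstep_itv delta x u.
    have /andP[? ?] := rstep_itv delta (x - 3 * delta) u; lra.
  move=> u fu; apply/andP; split.
    rewrite leNgt; apply/negP => ux; move: fu.
    rewrite (@rstep_eq1 _ _ _ _ (x - 3 * delta)) ?(ltW ux)// subr_gt0.
    have /andP[? ?] := rstep_itv delta x u; lra.
  rewrite leNgt; apply/negP => ux; move: fu.
  rewrite (@rstep_eq0 _ _ _ _ x) ?(ltW ux)// sub0r.
  have /andP[? ?] := rstep_itv delta (x - 3 * delta) u; lra.
rewrite mulrDr mulr1 lerD2r bE.
have -> : (x + 3 * delta - (x - 3 * delta)) / (4 * (nsq (smooth_dir c j0) / n%:R)) =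
    (n%:R / 4) * (6 * delta / nsq (smooth_dir c j0)).
  have e (N m : R) : N != 0 -> m != 0 ->
      (x + 3 * delta - (x - 3 * delta)) / (4 * (m / N)) = (N / 4) * (6 * delta / m).
    by move=> N0 m0; field; rewrite N0 m0.
  by apply: e; rewrite gt_eqF.
have s4 : Num.sqrt (n%:R / 4) = Num.sqrt n%:R / 2 :> R.
  rewrite sqrtrM// sqrtrV//; congr (_ / _).
  by rewrite (_ : 4 = 2 ^+ 2 :> R) ?sqrtr_sqr ?ger0_norm//; ring.
have sn0 : Num.sqrt n%:R != 0 :> R by rewrite gt_eqF// sqrtr_gt0.
rewrite sqrtrM ?divr_ge0// s4 mulrA.
have -> : 2 / Num.sqrt n%:R * (Num.sqrt n%:R / 2) = 1 :> R.
  by move: (Num.sqrt _) sn0 => s s0; field.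
rewrite mul1r; apply: ler_wsqrtr; rewrite ler_wpM2l ?mulr_ge0 ?(ltW delta_gt0)//.
by rewrite lef_pV2.
Qed.

Lemma smooth_tight x : 0 < x -> 1 - B x <= strace c / x.
Proof.
move=> x0.
have h (y : 'rV[R]_d) : 1 - x^-1 * nsq y <= rstep delta x y.
  have [yx|xy] := lerP (nsq y) x.
    by rewrite rstep_eq1// gerBl mulr_ge0 ?nsq_ge0 ?invr_ge0// ltW.
  have /andP[s0 _] := rstep_itv delta x y; rewrite (le_trans _ s0)// subr_le0.
  by rewrite mulrC ler_pdivlMr// mul1r ltW.
have I0 : (0 < #|{: 'I_n * bool}|)%N by rewrite card_prod card_ord card_bool muln_gt0 n_gt0.
have := iter_Avg_le w n h 0.
rewrite (iter_Avg_nsq I0 _ _ _ (smooth_family_sum _ c0) (smooth_family_nsq n_gt0 q_gt0)).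
have -> : nsq (0 : 'rV[R]_d) = 0.
  by apply: big1 => j _; rewrite mxE expr0n.
have n0 : n%:R != 0 :> R by rewrite pnatr_eq0 -lt0n.
rewrite add0r [n%:R * _]mulrC mulfVK// [strace c / x]mulrC; lra.
Qed.

(** Up to [K] both functions lie in the same sandwich, whose width is bounded by anticoncentration.
    Beyond [K] monotonicity places both between their values at [K] and 1, and [smooth_tight] at
    [K - 3 * delta] bounds this gap. *)
Lemma sandwich_distance (F F' : R -> R) (K e e' : R) : 3 * delta < K ->
  (forall x y, x <= y -> F x <= F y) -> (forall x y, x <= y -> F' x <= F' y) ->
  (forall x, F x <= 1) -> (forall x, F' x <= 1) -> 0 <= e -> 0 <= e' ->
  (forall x, x <= K -> B (x - 3 * delta) - e <= F x <= B x + e) ->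
  (forall x, x <= K -> B (x - 3 * delta) - e' <= F' x <= B x + e') ->
  forall x, `|F x - F' x| <= e + e' +
    (Num.sqrt (6 * delta / scov c j0 j0) + 2 / Num.sqrt n%:R) + strace c / (K - 3 * delta).
Proof.
move=> K3 Fm Fm' F1 F1' e0 e0' FB FB' x.
have Kd : 0 < K - 3 * delta by rewrite subr_gt0.
have t0 : 0 <= strace c / (K - 3 * delta) by rewrite divr_ge0 ?strace_ge0// ltW.
have s0 : 0 <= Num.sqrt (6 * delta / scov c j0 j0) + 2 / Num.sqrt n%:R.
  by rewrite addr_ge0 ?divr_ge0 ?sqrtr_ge0.
have [xK|Kx] := lerP x K.
  have /andP[? ?] := FB _ xK; have /andP[? ?] := FB' _ xK.
  have := smooth_anticoncentration x => ?.
  by rewrite ler_norml; apply/andP; split; lra.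
have := smooth_tight Kd => ?.
have /andP[? _] := FB _ (lexx K); have /andP[? _] := FB' _ (lexx K).
have := Fm _ _ (ltW Kx); have := Fm' _ _ (ltW Kx); have := F1 x; have := F1' x => *.
by rewrite ler_norml; apply/andP; split; lra.
Qed.

End sandwich.

(** * The strong law of large numbers *)

Section summable.
Context {R : realType} {d} {T : measurableType d} (P : probability T R).

(** Borel-Cantelli in integral form: the series has a finite integral, so it converges almost
    everywhere and its terms tend to 0. *)
Lemma ae_cvg0_summable (F : nat -> T -> R) (K : R) :
  (forall n, P.-integrable setT (EFin \o F n)) -> (forall n t, 0 <= F n t) ->
  (forall N, \sum_(n < N) \int[P]_t F n t <= K) ->
  {ae P, forall t, F n t @[n --> \oo] --> 0}.
Proof.
move=> iF F0 FK.
have mF n : measurable_fun setT (EFin \o F n) by exact: measurable_int (iF n).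
pose G t := (\sum_(n <oo) (F n t)%:E)%E.
have mG : measurable_fun setT G.
  have F0E n t : setT t -> predT n -> (0 <= (F n t)%:E)%E by rewrite lee_fin.
  exact: (@ge0_emeasurable_sum _ _ R setT _ predT F0E (fun n _ => mF n)).
have iG : P.-integrable setT G.
  apply/integrableP; split => //.
  have -> : (\int[P]_t `|G t| = \int[P]_t G t)%E.
    apply: eq_integral => t _; rewrite gee0_abs//.
    by apply: nneseries_ge0 => n _ _; rewrite lee_fin.
  rewrite integral_nneseries//; last by move=> n t _; rewrite lee_fin.
  apply: (@le_lt_trans _ _ K%:E); last exact: ltry.
  apply: lime_le.
    by apply: is_cvg_nneseries => n _ _; apply: integral_ge0 => t _; rewrite lee_fin.
  apply: nearW => N; rewrite big_mkord.
  rewrite (eq_bigr (fun n : 'I_N => (\int[P]_t F n t)%:E)); last first.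
    by move=> n _; rewrite /Rintegral fineK//; exact: (integrable_fin_num measurableT (iF n)).
  by rewrite sumEFin lee_fin; exact: FK.
have := integrable_ae measurableT iG; apply: filterS => t /= /(_ I) fG.
apply: cvg_series_cvg_0; apply: nondecreasing_is_cvgn.
  by move=> n m nm; apply: nondecreasing_series nm => i _ _; exact: F0.
exists (fine (G t)) => _ [N _ <-]; rewrite -lee_fin fineK// /series/=.
rewrite -sumEFin; apply: nneseries_lim_ge => n _ _.
by rewrite lee_fin.
Qed.

Lemma independent2_comp (U W : T -> R) (u w : R -> R) : independent2 P U W ->
  measurable_fun setT u -> measurable_fun setT w ->
  independent2 P (u \o U) (w \o W).
Proof.
move=> indep mu mw A B mA mB; apply: (indep (u @^-1` A) (w @^-1` B)).
- by rewrite -[X in measurable X]setTI; exact: mu.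
- by rewrite -[X in measurable X]setTI; exact: mw.
Qed.

Lemma eq_distribution_Rintegral d' (E : measurableType d') (X Y : T -> E) (u : E -> R) :
  measurable_fun setT X -> measurable_fun setT Y -> measurable_fun setT u ->
  (forall A, measurable A -> P (X @^-1` A) = P (Y @^-1` A)) ->
  P.-integrable setT (EFin \o (u \o X)) ->
  P.-integrable setT (EFin \o (u \o Y)) /\ \int[P]_t u (Y t) = \int[P]_t u (X t).
Proof.
move=> mX mY mu XY iX.
pose mfX := mfun_Sub (mem_set mX : X \in mfun).
pose mfY := mfun_Sub (mem_set mY : Y \in mfun).
have mEu : measurable_fun setT (EFin \o u) by exact/measurable_EFinP.
have E1 (f : E -> \bar R) :
    (\int[distribution P mfX]_y f y = \int[distribution P mfY]_y f y)%E.
  by apply: eq_measure_integral => A mA _; exact: XY.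
have iY : P.-integrable setT (EFin \o (u \o Y)).
  apply/integrableP; split; first exact: (measurableT_comp mEu mY).
  move/integrableP : iX => [_].
  have mabs : measurable_fun setT (fun e => `|(EFin \o u) e|%E).
    exact: measurableT_comp.
  have := @ge0_integral_distribution _ _ _ _ _ P mfX _ mabs (fun=> abse_ge0 _).
  have := @ge0_integral_distribution _ _ _ _ _ P mfY _ mabs (fun=> abse_ge0 _).
  by move=> /= <- <-; rewrite E1.
split => //; rewrite /Rintegral.
have := @integral_distribution _ _ _ _ _ P mfX _ mEu iX.
have := @integral_distribution _ _ _ _ _ P mfY _ mEu iY.
by move=> /= <- <-; rewrite E1.
Qed.

Lemma sum_variance k (W : nat -> T -> R) (M : R) :
  (forall i, measurable_fun setT (W i)) -> (forall i t, `|W i t| <= M) ->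
  (forall i, \int[P]_t W i t = 0) ->
  (forall i j, i != j -> independent2 P (W i) (W j)) ->
  \int[P]_t ((\sum_(i < k) W i t) ^+ 2) = \sum_(i < k) \int[P]_t (W i t ^+ 2).
Proof.
move=> mW bW W0 indep.
have iW i : P.-integrable setT (EFin \o W i).
  exact: (bounded_integrable _ (mW i) (bW i)).
have iWW i j : P.-integrable setT (EFin \o (fun t => W i t * W j t)).
  apply: (@bounded_integrable _ _ _ _ _ (M * M)) => [|t].
    exact: measurable_funM.
  by rewrite normrM ler_pM.
transitivity (\int[P]_t (\sum_(i < k) \sum_(j < k) W i t * W j t)).
  by apply: eq_Rintegral => t _; rewrite expr2 big_distrlr.
rewrite Rintegral_sumR; last by move=> i _; apply: integrable_sumR => j _.
apply: eq_bigr => i _; rewrite Rintegral_sumR// (bigD1 i)//= big1 ?addr0.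
  by apply: eq_Rintegral => t _; rewrite expr2.
move=> j ji; have [] := Rintegral_independentM (iW i) (iW j) _.
  by apply: indep; rewrite eq_sym.
by move=> _ ->; rewrite W0 mul0r.
Qed.

End summable.

Section dyadic.
Context {R : realType}.
Variable c : nat.
Hypothesis c_gt0 : (0 < c)%N.

Definition dyad (n : nat) : R := (c * 2 ^ n)%:R.

Lemma dyad_gt0 n : 0 < dyad n.
Proof. by rewrite ltr0n muln_gt0 c_gt0 expn_gt0. Qed.

Lemma dyadS n : dyad n.+1 = 2 * dyad n.
Proof. by rewrite /dyad expnS mulnCA natrM. Qed.

(** Since [dyad] doubles, the terms below [y] sum to at most twice the largest of them. This will
    sum the probabilities that truncation changes a variable. *)
Lemma dyad_sum_lt (y : R) N : 0 <= y ->
  \sum_(n < N) (if dyad n < y then dyad n else 0) <= 2 * y.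
Proof.
move=> y0.
have geo M : \sum_(n < M) (if dyad n < y then dyad n else 0) <= dyad M.
  elim: M => [|M IH]; first by rewrite big_ord0 ltW// dyad_gt0.
  rewrite big_ord_recr/= dyadS mulr_natl mulr2n lerD//.
  by case: ifP => // _; rewrite ltW// dyad_gt0.
elim: N => [|N IH]; first by rewrite big_ord0 mulr_ge0.
rewrite big_ord_recr/=; case: ifP => yN; last by rewrite addr0.
by have := geo N; lra.
Qed.

Lemma dyad_sum_ge (y : R) N : 0 <= y ->
  \sum_(n < N) (if y <= dyad n then y ^+ 2 / dyad n else 0) <= 2 * y.
Proof.
(* The strengthened bound reserves [2 * (y / dyad N)], the full geometric tail from [N] on; the
   maximum with 0 covers the indices where [dyad N] is still small against [y]. *)
move=> y0; suff h : \sum_(n < N) (if y <= dyad n then y / dyad n else 0) <=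
    Num.max 0 (2 - 2 * (y / dyad N)).
  rewrite (eq_bigr (fun n : 'I_N => y * (if y <= dyad n then y / dyad n else 0))).
    rewrite -mulr_sumr [leRHS]mulrC ler_wpM2l// (le_trans h)// ge_max ler0n/=.
    by rewrite gerBl mulr_ge0// divr_ge0// ltW// dyad_gt0.
  by move=> n _; case: ifP; rewrite ?mulr0// expr2 mulrA.
elim: N => [|N IH]; first by rewrite big_ord0 le_max lexx.
rewrite big_ord_recr/= dyadS.
have D0 := dyad_gt0 N.
have half (D : R) : D != 0 -> 2 * (y / (2 * D)) = y / D by move=> ?; field.
rewrite half ?gt_eqF//.
case: ifP => yN.
  have q1 : y / dyad N <= 1 by rewrite ler_pdivrMr// mul1r.
  move: IH; rewrite !max_r; lra.
have /ltW : 1 < y / dyad N by rewrite ltr_pdivlMr// mul1r ltNge yN.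
move=> q1; move: IH; rewrite max_l; last by lra.
by move=> h; rewrite addr0 (le_trans h)// le_max lexx.
Qed.

End dyadic.

Section strong_law.
Context {R : realType} {d} {T : measurableType d} (P : probability T R).

Section nonnegative.
Variable Y : nat -> T -> R.
Hypothesis mY : forall i, measurable_fun setT (Y i).
Hypothesis Y_ge0 : forall i t, 0 <= Y i t.
Hypothesis iY : P.-integrable setT (EFin \o Y 0%N).
Hypothesis identY : forall i A, measurable A -> P (Y i @^-1` A) = P (Y 0%N @^-1` A).
Hypothesis indepY : forall i j, i != j -> independent2 P (Y i) (Y j).

Definition truncate (k y : R) : R := if y <= k then y else 0.

Lemma measurable_truncate k : measurable_fun setT (truncate k).
Proof.
apply: measurable_fun_ifT => //; exact: measurable_fun_ler.
Qed.

Lemma truncate_itv k y : 0 <= y -> 0 <= truncate k y <= y.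
Proof. by rewrite /truncate; case: ifP => _ y0; rewrite ?lexx ?y0. Qed.

Lemma truncate_le k y : 0 <= k -> truncate k y <= k.
Proof. by rewrite /truncate; case: ifP. Qed.

Let eqd i (u : R -> R) : measurable_fun setT u ->
  P.-integrable setT (EFin \o (u \o Y 0%N)) ->
  P.-integrable setT (EFin \o (u \o Y i)) /\
  \int[P]_t u (Y i t) = \int[P]_t u (Y 0%N t).
Proof.
move=> mu iu; apply: (@eq_distribution_Rintegral _ _ _ P _ _ (Y 0%N) (Y i)) => //.
by move=> A mA; exact/esym/identY.
Qed.

Variable c : nat.
Hypothesis c_gt0 : (0 < c)%N.
Local Notation k n := (c * 2 ^ n)%N.
Local Notation kR n := (dyad c n : R).

Let kR_gt0 n : 0 < kR n. Proof. exact: dyad_gt0. Qed.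

Let m n : R := \int[P]_t truncate (kR n) (Y 0%N t).

Let m_cvg : m n @[n --> \oo] --> \int[P]_t Y 0%N t.
Proof.
pose f n t := (truncate (kR n) (Y 0%N t))%:E.
have mf n : measurable_fun setT (f n).
  by apply/measurable_EFinP; apply: (measurableT_comp (measurable_truncate _)).
have kR_inf (y : R) : \forall n \near \oo, y <= kR n.
  near=> n; have h : y <= n%:R.
    by near: n; exact: nbhs_infty_ger.
  rewrite (le_trans h)// /dyad ler_nat (leq_trans (ltnW (ltn_expl n (ltnSn 1))))//.
  by rewrite leq_pmull.
have ff : \forall t \ae P, setT t -> f n t @[n --> \oo] --> (EFin \o Y 0%N) t.
  apply: aeW => t _; apply: cvg_near_cst; near=> n.
  rewrite /f/= /truncate ifT//; near: n; exact: kR_inf.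
have fg : \forall t \ae P, forall n, setT t -> (`|f n t| <= (EFin \o Y 0%N) t)%E.
  apply: aeW => t n _; rewrite /f/= lee_fin.
  by have /andP[? ?] := truncate_itv (kR n) (Y_ge0 0 t); rewrite ger0_norm.
have [_ _ h] := dominated_convergence measurableT mf (measurable_int P iY) ff iY fg.
have e : (\int[P]_t (EFin \o Y 0%N) t = (\int[P]_t Y 0%N t)%:E)%E.
  by rewrite /Rintegral fineK//; exact: (integrable_fin_num measurableT iY).
by rewrite e in h; exact: (fine_cvg h).
Unshelve. all: by end_near. Qed.

Let center n i t : R := truncate (kR n) (Y i t) - m n.

Let mtr n i : measurable_fun setT (fun t => truncate (kR n) (Y i t)).
Proof. exact: (measurableT_comp (measurable_truncate _)). Qed.

Let itr n i : P.-integrable setT (EFin \o (fun t => truncate (kR n) (Y i t))).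
Proof.
apply: (@bounded_integrable _ _ _ _ _ (kR n)) => // t.
have /andP[h _] := truncate_itv (kR n) (Y_ge0 i t).
by rewrite ger0_norm// truncate_le// ltW.
Qed.

Let m_itv n : 0 <= m n <= kR n.
Proof.
apply/andP; split.
  by apply: Rintegral_ge0 => t _; case/andP: (truncate_itv (kR n) (Y_ge0 0 t)).
rewrite /m -[leRHS](Rintegral_cstR P); apply: le_Rintegral => //.
- exact: finite_measure_integrable_cst.
- by move=> t _; rewrite truncate_le// ltW.
Qed.

Let center_bound n i t : `|center n i t| <= kR n.
Proof.
rewrite /center; have /andP[h _] := truncate_itv (kR n) (Y_ge0 i t).
have h1 := truncate_le (Y i t) (ltW (kR_gt0 n)).
by have /andP[? ?] := m_itv n; rewrite ler_norml; apply/andP; split; lra.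
Qed.

Let center_measurable n i : measurable_fun setT (center n i).
Proof. exact: measurable_funB. Qed.

Let center_mean0 n i : \int[P]_t center n i t = 0.
Proof.
rewrite RintegralB//; last exact: finite_measure_integrable_cst.
rewrite Rintegral_cstR; have [_ ->] := eqd i (measurable_truncate (kR n)) (itr n 0%N).
by rewrite subrr.
Qed.

(** [F] is the squared deviation of the truncated average, and [G] counts the first [k n] variables
    that truncation changes. Both have summable expectations. *)
Let F n t := ((\sum_(i < k n) center n i t) / kR n) ^+ 2.
Let G n t := \sum_(i < k n) (if kR n < Y i t then 1 else 0 : R).

Let trsq n : P.-integrable setT (EFin \o (fun t => truncate (kR n) (Y 0%N t) ^+ 2)).
Proof.
apply: (@bounded_integrable _ _ _ _ _ (kR n ^+ 2)) => [|t]; first exact: measurable_funX.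
have /andP[h _] := truncate_itv (kR n) (Y_ge0 0 t).
rewrite ger0_norm ?exprn_ge0// lerXn2r ?nnegrE ?(ltW (kR_gt0 n))//.
by rewrite truncate_le// ltW.
Qed.

Let center_sq n i : \int[P]_t (center n i t ^+ 2) <= \int[P]_t (truncate (kR n) (Y 0%N t) ^+ 2).
Proof.
have msq : measurable_fun setT (fun y => truncate (kR n) y ^+ 2).
  by apply: measurable_funX; exact: measurable_truncate.
have [iS <-] := eqd i msq (trsq n).
have [_ mE] := eqd i (measurable_truncate (kR n)) (itr n 0%N).
have -> : \int[P]_t (center n i t ^+ 2) =
    \int[P]_t (truncate (kR n) (Y i t) ^+ 2) - m n ^+ 2.
  transitivity (\int[P]_t (truncate (kR n) (Y i t) ^+ 2
      - (2 * m n * truncate (kR n) (Y i t) - m n ^+ 2))).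
    by apply: eq_Rintegral => t _; rewrite /center; ring.
  have i1 := integrableZlR (2 * m n) (itr n i).
  have i2 : P.-integrable setT (EFin \o (fun _ : T => m n ^+ 2)).
    exact: finite_measure_integrable_cst.
  rewrite RintegralB//; last exact: (integrableB measurableT i1 i2).
  rewrite RintegralB// RintegralZl// mE Rintegral_cstR.
  rewrite /m; ring.
by rewrite gerBl sqr_ge0.
Qed.

Let F_measurable n : measurable_fun setT (F n).
Proof.
by apply: measurable_funX; apply: measurable_funM => //; apply: measurable_sum.
Qed.

Let iF n : P.-integrable setT (EFin \o F n).
Proof.
apply: (@bounded_integrable _ _ _ _ _ ((\sum_(i < k n) kR n / kR n) ^+ 2)) => // t.
rewrite /F ger0_norm ?sqr_ge0// -real_normK ?num_real//.
have S0 : 0 <= \sum_(i < k n) kR n / kR n.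
  by apply: sumr_ge0 => i _; rewrite divr_ge0// ltW.
rewrite lerXn2r ?nnegrE// mulr_suml (le_trans (ler_norm_sum _ _ _))// ler_sum// => i _.
rewrite normrM [`|_^-1|]ger0_norm ?invr_ge0 ?(ltW (kR_gt0 n))//.
by rewrite ler_wpM2r ?invr_ge0 ?(ltW (kR_gt0 n)).
Qed.

Let F_le n : \int[P]_t F n t <=
  \int[P]_t (if Y 0%N t <= kR n then Y 0%N t ^+ 2 / kR n else 0).
Proof.
have -> : \int[P]_t F n t =
    (\sum_(i < k n) \int[P]_t (center n i t ^+ 2)) * (kR n)^-1 ^+ 2.
  rewrite -(@sum_variance _ _ _ _ _ _ (kR n))//.
    rewrite -RintegralZr//; first by apply: eq_Rintegral => t _; rewrite /F exprMn.
    apply: (@bounded_integrable _ _ _ _ _ ((\sum_(i < k n) kR n) ^+ 2)) => [|t].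
      by apply: measurable_funX; exact: measurable_sum.
    rewrite ger0_norm ?sqr_ge0// -real_normK ?num_real//.
    have S0 : 0 <= \sum_(i < k n) kR n by apply: sumr_ge0 => i _; rewrite ltW.
    by rewrite lerXn2r ?nnegrE// (le_trans (ler_norm_sum _ _ _))// ler_sum.
  move=> i j ij; apply: (independent2_comp (u := fun y => truncate (kR n) y - m n)
    (w := fun y => truncate (kR n) y - m n)); first exact: indepY.
  - by apply: measurable_funB => //; exact: measurable_truncate.
  - by apply: measurable_funB => //; exact: measurable_truncate.
apply: (@le_trans _ _ ((\sum_(i < k n) \int[P]_t (truncate (kR n) (Y 0%N t) ^+ 2))
    * (kR n)^-1 ^+ 2)).
  by rewrite ler_wpM2r ?sqr_ge0// ler_sum.
rewrite sumr_const card_ord -mulr_natl -/(kR n).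
have -> : \int[P]_t (if Y 0%N t <= kR n then Y 0%N t ^+ 2 / kR n else 0) =
    \int[P]_t (truncate (kR n) (Y 0%N t) ^+ 2) / kR n.
  rewrite -RintegralZr//; apply: eq_Rintegral => t _; rewrite /truncate.
  by case: ifP => // _; rewrite expr0n/= mul0r.
rewrite le_eqVlt; apply/orP; left; apply/eqP.
have : kR n != 0 by rewrite gt_eqF.
by move: (kR n) (Rintegral _ _ _) => D I D0; field.
Qed.

Let mexc n i : measurable_fun setT (fun t => if kR n < Y i t then 1 else 0 : R).
Proof. by apply: measurable_fun_ifT => //; exact: measurable_fun_ltr. Qed.

Let iexc n i : P.-integrable setT (EFin \o (fun t => if kR n < Y i t then 1 else 0 : R)).
Proof.
apply: (@bounded_integrable _ _ _ _ _ (1)) => // t.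
by case: ifP; rewrite ?normr1 ?normr0.
Qed.

Let G_le n : \int[P]_t G n t <= \int[P]_t (if kR n < Y 0%N t then kR n else 0).
Proof.
rewrite /G Rintegral_sumR//.
have mu : measurable_fun setT (fun y : R => if kR n < y then 1 else 0 : R).
  by apply: measurable_fun_ifT => //; exact: measurable_fun_ltr.
rewrite (eq_bigr (fun=> \int[P]_t (if kR n < Y 0%N t then 1 else 0))); last first.
  by move=> i _; have [_ ->] := eqd i mu (iexc n 0%N).
rewrite sumr_const card_ord -mulr_natl -/(kR n) -RintegralZl//.
rewrite le_eqVlt; apply/orP; left; apply/eqP; apply: eq_Rintegral => t _.
by case: ifP; rewrite ?mulr1 ?mulr0.
Qed.

(** The sum over [n] is taken inside the integral, where the dyadic bounds [2 * y] hold pointwise;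
    this is why a finite first moment suffices. *)
Let sum_le (H : nat -> T -> R) (h : R -> nat -> R) :
  (forall n, \int[P]_t H n t <= \int[P]_t h (Y 0%N t) n) ->
  (forall n, measurable_fun setT (h^~ n)) ->
  (forall n y, 0 <= y -> 0 <= h y n) ->
  (forall N y, 0 <= y -> \sum_(n < N) h y n <= 2 * y) ->
  forall N, \sum_(n < N) \int[P]_t H n t <= 2 * \int[P]_t Y 0%N t.
Proof.
move=> Hh mh h0 hs N; apply: (@le_trans _ _ (\sum_(n < N) \int[P]_t h (Y 0%N t) n)).
  exact: ler_sum.
have ih n : P.-integrable setT (EFin \o (fun t => h (Y 0%N t) n)).
  apply: (le_integrableR (g := fun t => 2 * Y 0%N t)).
  - exact: (measurableT_comp (mh n)).
  - move=> t; rewrite ger0_norm ?h0//.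
    rewrite (le_trans _ (hs n.+1 _ (Y_ge0 0 t)))// big_ord_recr/= lerDr.
    by apply: sumr_ge0 => i _; exact: h0.
  - exact: integrableZlR.
rewrite -Rintegral_sumR// -RintegralZl//; apply: le_Rintegral => //.
- exact: integrable_sumR.
- exact: integrableZlR.
- by move=> t _; exact: hs.
Qed.

Let F_cvg0 : {ae P, forall t, F n t @[n --> \oo] --> 0}.
Proof.
apply: (ae_cvg0_summable (K := 2 * \int[P]_t Y 0%N t)) => //.
  by move=> n t; exact: sqr_ge0.
apply: (sum_le (h := fun y n => if y <= kR n then y ^+ 2 / kR n else 0)) => //.
- move=> n; apply: measurable_fun_ifT => //; first exact: measurable_fun_ler.
  by apply: measurable_funM => //; exact: measurable_funX.
- by move=> n y y0; case: ifP => // _; rewrite divr_ge0 ?exprn_ge0// ltW.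
- by move=> N y y0; exact: (dyad_sum_ge c_gt0).
Qed.

Let G_cvg0 : {ae P, forall t, G n t @[n --> \oo] --> 0}.
Proof.
apply: (ae_cvg0_summable (K := 2 * \int[P]_t Y 0%N t)).
- by move=> n; exact: integrable_sumR.
- by move=> n t; apply: sumr_ge0 => i _; case: ifP.
apply: (sum_le (h := fun y n => if kR n < y then kR n else 0)) => //.
- by move=> n; apply: measurable_fun_ifT => //; exact: measurable_fun_ltr.
- by move=> n y y0; case: ifP => // _; rewrite ltW.
- by move=> N y y0; exact: (dyad_sum_lt c_gt0).
Qed.

Lemma strong_law_dyadic :
  {ae P, forall t, (\sum_(i < k n) Y i t) / kR n @[n --> \oo] --> \int[P]_t Y 0%N t}.
Proof.
apply: filterS2 F_cvg0 G_cvg0 => t Ft Gt.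
have Tt : (\sum_(i < k n) center n i t) / kR n @[n --> \oo] --> 0.
  apply/cvgr0Pnorm_lt => e e0.
  have e2 : 0 < e ^+ 2 by rewrite exprn_gt0.
  move/cvgr0Pnorm_lt : Ft => /(_ _ e2); apply: filterS => n.
  rewrite /F ger0_norm ?sqr_ge0// -real_normK ?num_real//.
  by rewrite ltr_pXn2r// nnegrE// ltW.
have h : (\sum_(i < k n) center n i t) / kR n + m n @[n --> \oo] --> \int[P]_t Y 0%N t.
  by rewrite -[X in _ --> X]add0r; exact: cvgD.
(* [G n t] is a count, so once it is below 1 no term up to [k n] exceeds the level and truncation
   changes nothing. *)
apply: (cvg_trans (near_eq_cvg _) h); move/cvgr0Pnorm_lt : Gt => /(_ _ ltr01).
apply: filterS => n Gn.
have small (i : 'I_(k n)) : Y i t <= kR n.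
  rewrite leNgt; apply/negP => Yk; move: Gn; rewrite ltNge => /negP; apply.
  rewrite /G ger0_norm; last by apply: sumr_ge0 => j _; case: ifP.
  by rewrite (bigD1 i)//= Yk lerDl; apply: sumr_ge0 => j _; case: ifP.
rewrite /center big_split/= sumrN sumr_const card_ord -mulr_natl -/(kR n).
rewrite mulrDl mulNr mulrAC divff ?mul1r ?subrK ?gt_eqF//.
by congr (_ / _); apply: eq_bigr => i _; rewrite /truncate small.
Qed.

End nonnegative.
End strong_law.

(** * From the sizes [c * 2 ^ n] to all sample sizes *)

Section interpolation.
Context {R : realType}.

(** With [n] the largest exponent for which [p * 2 ^ n <= m], the quotient [c = m %/ 2 ^ n]
    satisfies [p <= c < 2 * p]. Thus [m] lies between [c * 2 ^ n] and [c.+1 * 2 ^ n], a gap of at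
    most [m / p], and monotone partial sums transfer the limit up to a relative error of order
    [1 / p]. *)
Lemma dyadic_interpolation (a : nat -> R) (l : R) : (forall i, 0 <= a i) -> 0 <= l ->
  (forall c, (0 < c)%N ->
     (\sum_(i < c * 2 ^ n) a i) / (c * 2 ^ n)%:R @[n --> \oo] --> l) ->
  (\sum_(i < m) a i) / m%:R @[m --> \oo] --> l.
Proof.
move=> a0 l0 h; pose S m := \sum_(i < m) a i.
have S_mono m m' : (m <= m')%N -> S m <= S m'.
  move=> mm; rewrite /S -(subnKC mm) big_split_ord/= lerDl.
  by apply: sumr_ge0 => i _.
apply/cvgrPdist_le => e e0.
(* The bound 1 lets the error over the gap be absorbed in [l + 1], which [p] is then chosen to
   beat. *)
pose e1 := Num.min 1 (e / 2).
have e10 : 0 < e1 by rewrite lt_min ltr01 divr_gt0.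
have [e11 e12] : e1 <= 1 /\ e1 <= e / 2 by split; rewrite /e1 ge_min ?lexx ?orbT.
have [p p0 pE] : exists2 p, (0 < p)%N & (l + 1) <= e / 2 * p%:R.
  exists (Num.truncn ((l + 1) / (e / 2))).+1 => //.
  rewrite mulrC -ler_pdivrMr ?divr_gt0//; apply/ltW.
  exact: truncnS_gt.
(* Only the multipliers up to [2 * p] occur, so finitely many limits give one common threshold. *)
have [N NP] : exists N, forall n c, (N <= n)%N -> (0 < c <= 2 * p)%N ->
    `|l - S (c * 2 ^ n)%N / (c * 2 ^ n)%:R| <= e1.
  have hc c : exists N, forall n, (N <= n)%N -> (0 < c)%N ->
      `|l - S (c * 2 ^ n)%N / (c * 2 ^ n)%:R| <= e1.
    case: (posnP c) => [->|c0]; first by exists 0%N.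
    have /cvgrPdist_le/(_ _ e10)[N _ NP] := h c c0.
    by exists N => n Nn _; exact: NP.
  have {hc} [f fP] := choice hc.
  exists (\max_(c < (2 * p).+1) f c) => n c Nn /andP[c0 cp].
  apply: fP => //; apply: leq_trans Nn.
  exact: (@leq_bigmax _ (fun c : 'I__ => f c) (Ordinal (cp : (c < (2 * p).+1)%N))).
near=> m.
have m0 : (p * 2 ^ N <= m)%N by near: m; exact: nbhs_infty_ge.
pose n := trunc_log 2 (m %/ p); pose c := (m %/ 2 ^ n)%N.
have q0 : (2 ^ N <= m %/ p)%N by rewrite leq_divRL// mulnC.
have qpos : (0 < m %/ p)%N by rewrite (leq_trans _ q0)// expn_gt0.
have Nn : (N <= n)%N by rewrite /n trunc_log_max.
have n1 : (2 ^ n * p <= m)%N by rewrite -leq_divRL// trunc_logP.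
have n2 : (m < 2 ^ n.+1 * p)%N by rewrite -ltn_divLR// trunc_log_ltn.
have P2 : (0 < 2 ^ n)%N by rewrite expn_gt0.
have c1 : (p <= c)%N by rewrite leq_divRL// mulnC.
have c2 : (c < 2 * p)%N by rewrite ltn_divLR// mulnAC -expnS.
have cm : (c * 2 ^ n <= m)%N by exact: leq_trunc_div.
have mc : (m < c.+1 * 2 ^ n)%N by exact: ltn_ceil.
have cpos : (0 < c)%N by exact: leq_trans c1.
have mpos : (0 < m)%N by rewrite (leq_trans _ cm)// muln_gt0 cpos.
have h1 := NP n c Nn; have h2 := NP n c.+1 Nn.
have {}h1 := h1 ltac:(by rewrite cpos ltnW).
have {}h2 := h2 ltac:(by rewrite /= c2).
have s1 := S_mono _ _ cm; have s2 := S_mono _ _ (ltnW mc).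
pose M : R := m%:R; pose A : R := (c * 2 ^ n)%:R; pose D : R := (2 ^ n)%:R.
have M0 : 0 < M by rewrite ltr0n.
have A0 : 0 < A by rewrite ltr0n muln_gt0 cpos.
have D0 : 0 < D by rewrite ltr0n.
have AD : (c.+1 * 2 ^ n)%:R = A + D by rewrite mulSn addnC natrD.
rewrite AD in h2.
have AM : A <= M by rewrite ler_nat.
have MA : M <= A + D by rewrite -AD ler_nat ltnW.
have DM : p%:R * D <= M by rewrite -natrM ler_nat mulnC.
have lD : (l + 1) * D <= e / 2 * M.
  apply: (@le_trans _ _ (e / 2 * p%:R * D)); first by rewrite ler_wpM2r// ltW.
  by rewrite -mulrA ler_wpM2l// divr_ge0// ltW.
have AD0 : 0 < A + D by rewrite addr_gt0.
move: h1 h2; rewrite -/A !ler_norml => /andP[u1 u2] /andP[u3 u4].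
have {u2} u2 : (l - e1) * A <= S (c * 2 ^ n)%N.
  by rewrite -ler_pdivlMr//; lra.
have {u3} u3 : S (c.+1 * 2 ^ n)%N <= (l + e1) * (A + D).
  by rewrite -ler_pdivrMr//; lra.
have e1M : e1 * M <= e / 2 * M by rewrite ler_wpM2r// ltW.
have e1D : e1 * D <= D by rewrite ler_piMl// ltW.
have e1A : e1 * A <= e1 * M by rewrite ler_wpM2l// ltW.
have lA : l * A <= l * M by rewrite ler_wpM2l.
have lMA : l * M <= l * (A + D) by rewrite ler_wpM2l.
have v1 : S m / M <= l + e by rewrite ler_pdivrMr//; lra.
have v2 : l - e <= S m / M by rewrite ler_pdivlMr//; lra.
by rewrite -/(S m) -/M; apply/andP; split; lra.
Unshelve. all: by end_near. Qed.

End interpolation.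

Section strong_law_real.
Context {R : realType} {d} {T : measurableType d} (P : probability T R).

Lemma strong_law_ge0 (Y : nat -> T -> R) :
  (forall i, measurable_fun setT (Y i)) -> (forall i t, 0 <= Y i t) ->
  P.-integrable setT (EFin \o Y 0%N) ->
  (forall i A, measurable A -> P (Y i @^-1` A) = P (Y 0%N @^-1` A)) ->
  (forall i j, i != j -> independent2 P (Y i) (Y j)) ->
  {ae P, forall t, (\sum_(i < m) Y i t) / m%:R @[m --> \oo] --> \int[P]_t Y 0%N t}.
Proof.
move=> mY Y0 iY idY inY.
have all_c : {ae P, forall t, forall c,
    (\sum_(i < c.+1 * 2 ^ n) Y i t) / dyad c.+1 n @[n --> \oo] --> \int[P]_t Y 0%N t}.
  by apply: ae_foralln => c; exact: (strong_law_dyadic mY Y0 iY idY inY (ltn0Sn c)).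
move: all_c; apply: filterS => t tP; apply: (dyadic_interpolation (a := fun i => Y i t)) => //.
  by apply: Rintegral_ge0 => s _; exact: Y0.
by case=> // c _; exact: tP.
Qed.

Lemma strong_law (Y : nat -> T -> R) :
  (forall i, measurable_fun setT (Y i)) ->
  P.-integrable setT (EFin \o Y 0%N) ->
  (forall i A, measurable A -> P (Y i @^-1` A) = P (Y 0%N @^-1` A)) ->
  (forall i j, i != j -> independent2 P (Y i) (Y j)) ->
  {ae P, forall t, (\sum_(i < m) Y i t) / m%:R @[m --> \oo] --> \int[P]_t Y 0%N t}.
Proof.
move=> mY iY idY inY.
have part (u : R -> R) : measurable_fun setT u -> (forall y, 0 <= u y <= `|y|) ->
    P.-integrable setT (EFin \o (fun t => u (Y 0%N t))) /\
    {ae P, forall t, (\sum_(i < m) u (Y i t)) / m%:R @[m --> \oo]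
      --> \int[P]_t u (Y 0%N t)}.
  move=> mu u0.
  have iu : P.-integrable setT (EFin \o (fun t => u (Y 0%N t))).
    apply: (le_integrableR (g := fun t => `|Y 0%N t|)).
    - exact: (measurableT_comp mu).
    - by move=> t; have /andP[? ?] := u0 (Y 0%N t); rewrite ger0_norm.
    - exact: (integrable_norm iY).
  split => //; apply: (strong_law_ge0 (Y := fun i t => u (Y i t))) => //.
  - by move=> i; exact: (measurableT_comp mu).
  - by move=> i t; case/andP: (u0 (Y i t)).
  - move=> i A mA; apply: (idY i (u @^-1` A)).
    by rewrite -[X in measurable X]setTI; exact: mu.
  - by move=> i j ij; exact: (independent2_comp (inY i j ij) mu mu).
have [iP aeP] := part (fun y => Num.max y 0) ltac:(by apply: measurable_maxr)
  ltac:(by move=> y; rewrite le_max lexx orbT/= ge_max ler_norm normr_ge0).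
have [iN aeN] := part (fun y => Num.max (- y) 0)
  ltac:(by apply: measurable_maxr => //; exact: measurable_funN)
  ltac:(by move=> y; rewrite le_max lexx orbT/= ge_max -normrN ler_norm normr_ge0).
have dec (y : R) : y = Num.max y 0 - Num.max (- y) 0.
  by case: (lerP y 0) => y0; case: (lerP (- y) 0) => ny0; lra.
have -> : \int[P]_t Y 0%N t =
    \int[P]_t Num.max (Y 0%N t) 0 - \int[P]_t Num.max (- Y 0%N t) 0.
  by rewrite -RintegralB//; apply: eq_Rintegral => t _; exact: dec.
apply: filterS2 aeP aeN => t tP tN.
apply: (cvg_trans (near_eq_cvg _) (cvgB tP tN)); apply: nearW => m /=.
transitivity ((\sum_(i < m) Num.max (Y i t) 0) / m%:R -
  (\sum_(i < m) Num.max (- Y i t) 0) / m%:R) => //.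
by rewrite -mulrBl -sumrB; congr (_ / _); apply: eq_bigr => i _; exact/esym/dec.
Qed.

End strong_law_real.

(** * Resampling indices and coordinates *)

Section maximum.
Context {R : realType}.

(** A term is the increment [S i.+1 - S i], and both partial sums are linear with slope [l] up to a
    small multiple of [i]. The finitely many early terms are bounded by the fixed number
    [S N.+1]. *)
Lemma average_cvg_max (a : nat -> R) (l : R) : (forall i, 0 <= a i) ->
  (\sum_(i < n) a i) / n%:R @[n --> \oo] --> l ->
  forall e, 0 < e -> \forall n \near \oo, forall i, (i < n)%N -> a i <= e * n%:R.
Proof.
move=> a0 al e e0; pose S n := \sum_(i < n) a i.
have e4 : 0 < e / 4 by rewrite divr_gt0.
have S_mono m m' : (m <= m')%N -> S m <= S m'.
  by move=> mm; rewrite /S -(subnKC mm) big_split_ord/= lerDl sumr_ge0.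
have SS i : S i.+1 = S i + a i by rewrite /S big_ord_recr.
have S0 n : 0 <= S n by exact: sumr_ge0.
have /cvgrPdist_le/(_ _ e4)[N _ NP] := al.
have bd n : (N < n)%N -> (l - e / 4) * n%:R <= S n <= (l + e / 4) * n%:R.
  move=> Nn; have n0 : 0 < n%:R :> R by rewrite ltr0n (leq_ltn_trans _ Nn).
  have : `|l - S n / n%:R| <= e / 4 := NP n (ltnW Nn).
  rewrite ler_norml => /andP[h1 h2]; apply/andP; split.
    by rewrite -ler_pdivlMr//; lra.
  by rewrite -ler_pdivrMr//; lra.
near=> n.
have big : (S N.+1 + `|l|) <= e / 2 * n%:R.
  rewrite mulrC -ler_pdivrMr ?divr_gt0//.
  by near: n; exact: nbhs_infty_ger.
move=> i; have l1 := ler_norm l; have l2 := normr_ge0 l.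
have [iN|Ni] := leqP i N => lt_in.
  have := S_mono i.+1 N.+1 iN; rewrite SS; have := S0 i.
  have : 0 <= e / 2 * n%:R by rewrite mulr_ge0// divr_ge0// ltW.
  by lra.
have /andP[_ h1] := bd i.+1 (ltnW Ni); have /andP[h2 _] := bd i Ni.
have h3 : e / 4 * (2 * i.+1%:R) <= e / 4 * (2 * n%:R).
  by rewrite ler_wpM2l ?(ltW e4)// ler_wpM2l// ler_nat.
have iE : i.+1%:R = i%:R + 1 :> R by rewrite natr1.
have := SS i; have := S0 N.+1; move: h1 h2 h3; rewrite iE => *; lra.
Unshelve. all: by end_near. Qed.

End maximum.

Section uniform.
Context {R : realType} {d} {T : measurableType d} (P : probability T R).

(** The [n] prescribed masses [1 / n] already add up to 1, so [i] is below [n] almost surely and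
    [u (i t)] agrees almost everywhere with a finite combination of indicators. *)
Lemma uniform_Rintegral n (i : {RV P >-> nat}) (u : nat -> R) : (0 < n)%N ->
  uniform_index n i ->
  P.-integrable setT (EFin \o (u \o i)) /\
  \int[P]_t u (i t) = n%:R^-1 * \sum_(j < n) u j.
Proof.
move=> n0 unif.
have mi (j : nat) : measurable (i @^-1` [set j]).
  by rewrite -[X in measurable X]setTI; exact: (measurable_funP i).
have mui (v : nat -> R) : measurable_fun setT (v \o i).
  by apply: measurableT_comp.
have bool_indic j : (fun t => (i t == j)%:R : R) = \1_(i @^-1` [set j]).
  apply/funext => t; rewrite indicE; congr (_%:R); congr nat_of_bool.
  by apply/eqP/idP => [h|/set_mem//]; exact: mem_set.
have intj j : (j < n)%N -> \int[P]_t ((i t == j)%:R) = n%:R^-1.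
  move=> jn; rewrite (_ : (fun t => _) = \1_(i @^-1` [set j])) ?bool_indic//.
  by rewrite Rintegral_indic//; have /= := unif j jn; rewrite /distribution/pushforward => ->.
have ij j : P.-integrable setT (EFin \o (fun t => (i t == j)%:R)).
  by rewrite bool_indic; exact: integrable_indicR.
pose v t := \sum_(j < n) u j * (i t == j)%:R.
have iv : P.-integrable setT (EFin \o v).
  by apply: integrable_sumR => j _; exact: integrableZlR.
have vE : \int[P]_t v t = n%:R^-1 * \sum_(j < n) u j.
  rewrite Rintegral_sumR; last by move=> j _; exact: integrableZlR.
  rewrite mulr_sumr; apply: eq_bigr => j _.
  by rewrite RintegralZl// intj// mulrC.
pose N := [set t | (n <= i t)%N].
have mN : measurable N.
  by rewrite -[X in measurable X]setTI; exact: (measurable_funP i _ [set k | (n <= k)%N]).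
have PN : P N = 0%E.
  have h : fine (P (~` N)) = 1.
    rewrite -Rintegral_indic; last exact: measurableC.
    transitivity (\int[P]_t (\sum_(j < n) (i t == j)%:R)).
      apply: eq_Rintegral => t _; rewrite indicE.
      have [it|it] := ltnP (i t) n.
        rewrite (bigD1 (Ordinal it))//= eqxx big1 ?addr0.
          by rewrite mem_set//= /N/=; apply/negP; rewrite -ltnNge.
        by move=> j; rewrite -val_eqE/= eq_sym => /negPf ->.
      rewrite big1; last first.
        by move=> j _; case: eqP => // ijE; move: it; rewrite ijE leqNgt ltn_ord.
      by rewrite memNset//= /N/= => /(_ it).
    rewrite Rintegral_sumR//.
    rewrite (eq_bigr (fun=> n%:R^-1)); last by move=> j _; exact: intj.
    by rewrite sumr_const card_ord -[_ *+ n]mulr_natl divff// pnatr_eq0 -lt0n.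
  have Nfin : P N \is a fin_num by exact: fin_num_measure.
  have : fine (1 - P N)%E = 1.
    transitivity (fine (P (~` N))) => //; congr fine.
    exact: (esym (probability_setC P mN)).
  rewrite fineB// => /eqP; rewrite subr_eq addrC -subr_eq subrr eq_sym => /eqP.
  by move=> h0; rewrite -(fineK Nfin) h0.
have uv : {in setT `\` N, EFin \o v =1 EFin \o (u \o i)}.
  move=> t /set_mem[_ /negP]; rewrite -ltnNge => it /=; congr EFin.
  rewrite /v (bigD1 (Ordinal it))//= eqxx mulr1 big1 ?addr0// => j.
  by rewrite -val_eqE/= eq_sym => /negPf ->; rewrite mulr0.
have mE (w : T -> R) : measurable_fun setT w -> measurable_fun setT (EFin \o w).
  by move=> ?; exact/measurable_EFinP.
have mD : measurable (setT `\` N) by exact: measurableD.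
have iu : P.-integrable setT (EFin \o (u \o i)).
  apply/(negligible_integrable mN measurableT (mE _ (mui u)) PN).
  apply: (@eq_integrable _ _ _ P _ mD (EFin \o v) _ uv).
  exact/(negligible_integrable mN measurableT (measurable_int P iv) PN).
split => //; rewrite -vE /Rintegral.
rewrite (negligible_integral mN measurableT iu PN).
rewrite (negligible_integral mN measurableT iv PN).
by congr fine; apply: eq_integral => t tN; exact/esym/uv.
Qed.

End uniform.

Lemma measurable_borel_coord (R : realType) (d : nat) (j : 'I_d) :
  measurable_fun setT (fun e : borel_rV R d => (e : 'rV[R]_d) ord0 j).
Proof.
apply: (measurability _ (RGenOpens.measurableE R)).
move=> _ [_ [a [b ->] <-]]; rewrite setTI; apply: sub_sigma_algebra.
have /continuousP := @coord_continuous R 1 d ord0 j.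
by apply; exact: interval_open.
Qed.

(** * The rows of the statistic and of its bootstrap version *)

Section rows.
Context {R : realType} {d : nat} {dO} {Omega : measurableType dO} (P : probability Omega R).

Lemma mutually_independent_upto {dE} {E : measurableType dE} (X : nat -> {RV P >-> E}) n :
  mutually_independent X -> independent_upto P (fun k => X k) n.
Proof.
move=> indep A mA; have := indep (iota 0 n) A (iota_uniq 0 n) (fun j _ => mA j).
rewrite -(big_mkord predT (fun i => P (X i @^-1` A i))) /index_iota subn0 => <-.
congr (P _); apply/seteqP; split => t h k /= kn; apply: h => /=.
  by move: kn; rewrite mem_iota.
by rewrite mem_iota.
Qed.

(** Pads a finite row with a constant, to fit the sequences over [nat] of the replacement
    argument. *)
Definition extend_row {dE} {E : measurableType dE} (e0 : E) n
  (Y : 'I_n -> {RV P >-> E}) (k : nat) : Omega -> E :=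
  if insub k is Some i then Y i else cst e0.

Lemma extend_rowE {dE} {E : measurableType dE} (e0 : E) n (Y : 'I_n -> {RV P >-> E})
  (i : 'I_n) : extend_row e0 Y i = Y i.
Proof. by rewrite /extend_row valK. Qed.

Lemma measurable_extend_row {dE} {E : measurableType dE} (e0 : E) n
  (Y : 'I_n -> {RV P >-> E}) k : measurable_fun setT (extend_row e0 Y k).
Proof. by rewrite /extend_row; case: insubP => [i _ _|_]; last exact: measurable_cst. Qed.

Lemma extend_row_independent {dE} {E : measurableType dE} (e0 : E) n
    (Y : 'I_n -> {RV P >-> E}) :
  mutually_independent Y -> independent_upto P (extend_row e0 Y) n.
Proof.
move=> indep A mA; have := indep (enum 'I_n) (fun i => A i) (enum_uniq _) (fun j _ => mA j).
rewrite big_enum/= => prodE.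
transitivity (\prod_(i < n) P (Y i @^-1` A i))%E; last first.
  by apply: eq_bigr => i _; rewrite extend_rowE.
rewrite -prodE; congr (P _); apply/seteqP; split => t h.
  move=> i _; have : A i (extend_row e0 Y i t) := h i (ltn_ord i).
  by rewrite extend_rowE.
move=> k kn; have : A k (Y (Ordinal kn) t) by apply: (h (Ordinal kn)); rewrite /= mem_enum.
by rewrite -(extend_rowE e0 Y).
Qed.

Lemma mutually_independent_pair {dE} {E : measurableType dE} (X : nat -> {RV P >-> E})
    (f : E -> R) i j : measurable_fun setT f ->
  mutually_independent X -> i != j -> independent2 P (f \o X i) (f \o X j).
Proof.
move=> mf indep ij A B mA mB.
have mfA (C : set R) : measurable C -> measurable (f @^-1` C).
  by move=> mC; rewrite -[X in measurable X]setTI; exact: mf.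
have := indep [:: i; j] (fun k => if k == i then f @^-1` A else f @^-1` B).
rewrite /= inE ij => /(_ isT) h.
have {}h := h (fun k _ => ltac:(by case: ifP => _; exact: mfA)).
rewrite !big_cons big_nil mule1 eqxx eq_sym (negPf ij) in h.
move: h => /= <-; congr (P _); apply/seteqP; split => t /=.
  move=> [tA tB] k /=; rewrite !inE => /orP[/eqP ->|/eqP ->]; first by rewrite eqxx.
  by rewrite eq_sym (negPf ij).
move=> h; split.
  by have := h i; rewrite /= !inE eqxx => /(_ isT).
by have := h j; rewrite /= !inE eqxx orbT eq_sym (negPf ij) => /(_ isT).
Qed.

Lemma enormZ (a : R) (x : 'rV[R]_d) : 0 <= a -> enorm (a *: x) = a * enorm x.
Proof.
move=> a0; rewrite /enorm -/(nsq (a *: x)) -/(nsq x) nsqZ.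
by rewrite sqrtrM ?sqr_ge0// sqrtr_sqr ger0_norm.
Qed.

Variable X : nat -> {RV P >-> borel_rV R d}.
Local Notation XV k w := (X k w : 'rV[R]_d).
Hypothesis indep : mutually_independent X.
Hypothesis ident : identically_distributed X.
Hypothesis mean0 : forall j : 'I_d, ('E_P[fun w => XV 0%N w ord0 j] = 0)%E.
Hypothesis sq : ('E_P[fun w => (enorm (XV 0%N w) ^+ 2)%R] < +oo)%E.

Let identX k A : measurable A -> P (X k @^-1` A) = P (X 0%N @^-1` A).
Proof. by move=> mA; exact: ident. Qed.

Lemma borel_coord_measurable (f : 'rV[R]_d -> R) : coord_measurable f ->
  measurable_fun setT (f : borel_rV R d -> R).
Proof. by move=> mf; apply: (mf _ (borel_rV R d) id) => j; exact: measurable_borel_coord. Qed.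

Let mXf f k : coord_measurable f -> measurable_fun setT (fun w => f (XV k w)).
Proof.
by move=> /borel_coord_measurable mf; exact: (measurableT_comp mf (measurable_funP (X k))).
Qed.

Lemma integrable_nsq0 : P.-integrable setT (EFin \o (fun w => nsq (XV 0%N w))).
Proof.
apply/integrableP; split.
  by apply/measurable_EFinP; apply: mXf; exact: coord_measurable_nsq.
move: sq; rewrite unlock; apply: le_lt_trans.
rewrite le_eqVlt; apply/orP; left; apply/eqP; apply: eq_integral => w _ /=.
by rewrite enorm_sq ger0_norm// nsq_ge0.
Qed.

Lemma Rintegral_X f k : coord_measurable f ->
  P.-integrable setT (EFin \o (fun w => f (XV 0%N w))) ->
  P.-integrable setT (EFin \o (fun w => f (XV k w))) /\
  \int[P]_w f (XV k w) = \int[P]_w f (XV 0%N w).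
Proof.
move=> /borel_coord_measurable mf i0.
apply: (@eq_distribution_Rintegral _ _ _ P _ (borel_rV R d) (X 0%N) (X k) f) => //.
by move=> A mA; exact/esym/identX.
Qed.

Definition second_moment (i j : 'I_d) : R :=
  \int[P]_w (XV 0%N w ord0 i * XV 0%N w ord0 j).

Lemma coord_measurable_coord (j : 'I_d) : coord_measurable (fun x : 'rV[R]_d => x ord0 j).
Proof. by move=> d1 T u; exact. Qed.

Lemma coord_measurable_coordM (i j : 'I_d) :
  coord_measurable (fun x : 'rV[R]_d => x ord0 i * x ord0 j).
Proof. by move=> d1 T u mu; exact: measurable_funM. Qed.

Lemma integrable_coordM0 i j :
  P.-integrable setT (EFin \o (fun w => XV 0%N w ord0 i * XV 0%N w ord0 j)).
Proof.
apply: (le_integrableR _ (fun w => coordM_le (XV 0%N w) i j)); last exact: integrable_nsq0.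
exact: (mXf 0 (coord_measurable_coordM i j)).
Qed.

Lemma integrable_coord0 j : P.-integrable setT (EFin \o (fun w => XV 0%N w ord0 j)).
Proof.
apply: (le_integrableR _ (fun w => coord_le (XV 0%N w) j)).
  exact: (mXf 0 (coord_measurable_coord j)).
apply: (integrableDR _ integrable_nsq0); exact: finite_measure_integrable_cst.
Qed.

Lemma Rintegral_coord0 j : \int[P]_w XV 0%N w ord0 j = 0.
Proof. by have := mean0 j; rewrite unlock /Rintegral => ->. Qed.

Lemma strong_law_X f : coord_measurable f ->
  P.-integrable setT (EFin \o (fun w => f (XV 0%N w))) ->
  {ae P, forall w, (\sum_(i < m) f (XV i w)) / m%:R @[m --> \oo]
     --> \int[P]_w f (XV 0%N w)}.
Proof.
move=> mf i0; apply: (strong_law (Y := fun k w => f (XV k w))) => //.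
- by move=> k; exact: mXf.
- move=> k A mA; apply: (identX k (A := (f : borel_rV R d -> R) @^-1` A)).
  by rewrite -[X in measurable X]setTI; exact: (borel_coord_measurable mf).
- move=> i j ij; apply: (mutually_independent_pair (f := f : borel_rV R d -> R)) => //.
  exact: borel_coord_measurable.
Qed.

Local Notation sn n := (Num.sqrt n%:R : R).
Definition row_remainder n : R := \int[P]_w lrem ((sn n)^-1 *: XV 0%N w).

Let mscale n f : coord_measurable f -> coord_measurable (fun x : 'rV[R]_d => f ((sn n)^-1 *: x)).
Proof.
move=> mf d1 T u mu; apply: mf => j; under eq_fun do rewrite mxE.
exact: measurable_funM.
Qed.

Lemma centered_row_X n : (0 < n)%N ->
  centered_row P (fun k => X k) (fun e : borel_rV R d => (sn n)^-1 *: (e : 'rV[R]_d)) n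
    (fun i j => second_moment i j / n%:R) (row_remainder n).
Proof.
move=> n0; have sn2 : (sn n)^-1 ^+ 2 = n%:R^-1 by rewrite exprVn sqr_sqrtr.
split.
- by move=> k; exact: measurable_funP.
- exact: mutually_independent_upto.
- move=> j; exact: (borel_coord_measurable (mscale n (coord_measurable_coord j))).
- move=> k _; have [iX _] := Rintegral_X k coord_measurable_nsq integrable_nsq0.
  have -> : (fun w => nsq ((sn n)^-1 *: XV k w)) = (fun w => (sn n)^-1 ^+ 2 * nsq (XV k w)).
    by apply/funext => w; rewrite nsqZ.
  exact: integrableZlR.
- move=> k j _; have [iX E0] := Rintegral_X k (coord_measurable_coord j) (integrable_coord0 j).
  transitivity (\int[P]_w ((sn n)^-1 * XV k w ord0 j)).
    by apply: eq_Rintegral => w _; rewrite mxE.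
  by rewrite RintegralZl// E0 Rintegral_coord0 mulr0.
- move=> k i j _.
  have [iX E0] := Rintegral_X k (coord_measurable_coordM i j) (integrable_coordM0 i j).
  transitivity (\int[P]_w ((sn n)^-1 ^+ 2 * (XV k w ord0 i * XV k w ord0 j))).
    by apply: eq_Rintegral => w _; rewrite !mxE; ring.
  by rewrite RintegralZl// E0 sn2 mulrC.
- move=> k _; have il : P.-integrable setT (EFin \o (fun w => lrem ((sn n)^-1 *: XV 0%N w))).
    apply: (le_integrableR (g := fun w => (sn n)^-1 ^+ 2 * nsq (XV 0%N w))).
    + exact: (mXf 0 (mscale n coord_measurable_lrem)).
    + by move=> w; rewrite ger0_norm ?lrem_ge0// -nsqZ lrem_le.
    + exact: integrableZlR integrable_nsq0.
  by have [_ ->] := Rintegral_X k (mscale n coord_measurable_lrem) il.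
Qed.

(** Lindeberg's condition by dominated convergence: the integrand is at most [|X|^2], which is
    integrable, and at most [|X|^3 / sqrt n], which tends to 0 pointwise. *)
Lemma row_remainder_cvg0 : n%:R * row_remainder n @[n --> \oo] --> 0.
Proof.
pose f n w := (n%:R * lrem ((sn n)^-1 *: XV 0%N w))%:E.
have mf n : measurable_fun setT (f n).
  apply/measurable_EFinP; apply: measurable_funM => //.
  exact: (mXf 0 (mscale n coord_measurable_lrem)).
have fle n w : 0 <= n%:R * lrem ((sn n)^-1 *: XV 0%N w) <= nsq (XV 0%N w).
  rewrite mulr_ge0 ?lrem_ge0//=.
  case: (posnP n) => [->|n0]; first by rewrite mul0r nsq_ge0.
  have n1 : 0 < n%:R :> R by rewrite ltr0n.
  rewrite mulrC -ler_pdivlMr// (le_trans (lrem_le _))// nsqZ exprVn sqr_sqrtr//.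
  by rewrite mulrC.
have fle2 n w : n%:R * lrem ((sn n)^-1 *: XV 0%N w) <= (enorm (XV 0%N w) * nsq (XV 0%N w)) / sn n.
  case: (posnP n) => [->|n0].
    by rewrite mul0r divr_ge0 ?mulr_ge0 ?enorm_ge0 ?nsq_ge0 ?sqrtr_ge0.
  have n1 : 0 < n%:R :> R by rewrite ltr0n.
  have s0 : 0 <= (sn n)^-1 by rewrite invr_ge0 sqrtr_ge0.
  rewrite mulrC -ler_pdivlMr//.
  rewrite (le_trans (lrem_le_max (t := (sn n)^-1 * enorm (XV 0%N w)) _))//.
    by rewrite enormZ.
  rewrite nsqZ exprVn sqr_sqrtr// le_eqVlt; apply/orP; left; apply/eqP; ring.
have ff : \forall w \ae P, setT w -> f n w @[n --> \oo] --> (cst 0%E : Omega -> \bar R) w.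
  apply: aeW => w _; apply: cvg_EFin; first by near=> n.
  apply/cvgr0Pnorm_le => e e0.
  pose a := enorm (XV 0%N w) * nsq (XV 0%N w).
  have a0 : 0 <= a by rewrite mulr_ge0 ?enorm_ge0 ?nsq_ge0.
  near=> n.
  have n1 : 0 < n%:R :> R by rewrite ltr0n; near: n; exact: nbhs_infty_gt.
  have s0 : 0 < sn n by rewrite sqrtr_gt0.
  have /andP[l0 _] := fle n w; rewrite /f/= ger0_norm// (le_trans (fle2 n w))//.
  rewrite ler_pdivrMr// -/a -ler_pdivrMl// mulrC.
  have ae : 0 <= a / e by rewrite divr_ge0// ltW.
  rewrite -(ger0_norm ae) -sqrtr_sqr ler_wsqrtr//.
  by near: n; exact: nbhs_infty_ger.
have fg : \forall w \ae P, forall n, setT w -> (`|f n w| <= (EFin \o (fun w => nsq (XV 0%N w))) w)%E.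
  by apply: aeW => w n _; rewrite /f/= lee_fin; have /andP[? ?] := fle n w; rewrite ger0_norm.
have [_ _ h] := dominated_convergence measurableT mf (@measurable_cst _ _ _ _ setT 0%E) ff
  integrable_nsq0 fg.
have h0 : (\int[P]_w cst 0%E w = 0%:E :> \bar R)%E by rewrite integral0.
rewrite h0 in h; apply: (cvg_trans (near_eq_cvg _) (fine_cvg h)).
apply: nearW => n /=; rewrite /row_remainder -RintegralZl//.
apply: (le_integrableR (g := fun w => (sn n)^-1 ^+ 2 * nsq (XV 0%N w))).
- exact: (mXf 0 (mscale n coord_measurable_lrem)).
- by move=> w; rewrite ger0_norm ?lrem_ge0// -nsqZ lrem_le.
- exact: integrableZlR integrable_nsq0.
Unshelve. all: by end_near. Qed.

End rows.

Section bootstrap_row.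
Context {R : realType} {d : nat} {d'} {T : measurableType d'} (P : probability T R).
Variables (n : nat) (x : nat -> 'rV[R]_d) (idx : 'I_n -> {RV P >-> nat}).
Hypothesis n_gt0 : (0 < n)%N.
Hypothesis indep : mutually_independent idx.
Hypothesis unif : forall k, uniform_index n (idx k).

Local Notation sn := (Num.sqrt n%:R : R).

Definition data_mean : 'rV[R]_d := n%:R^-1 *: \sum_(i < n) x i.
Definition centered_data (i : 'I_n) : 'rV[R]_d := x i - data_mean.
(** With the data frozen, a bootstrap summand is a fixed function of a random index; the index plays
    the role of [Y k] in a [centered_row]. *)
Definition boot_summand (m : nat) : 'rV[R]_d := sn^-1 *: (x m - data_mean).

Lemma centered_data_sum j : \sum_i centered_data i ord0 j = 0.
Proof.
under eq_bigr do rewrite mxE [X in _ + X]mxE.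
rewrite big_split/= sumr_const card_ord /data_mean mxE summxE -[_ *+ n]mulr_natl.
by rewrite mulrN mulrA divff ?mul1r ?subrr// pnatr_eq0 -lt0n.
Qed.

(** Expectations over a uniform index are empirical averages, so the conditional mean is exactly 0
    and the conditional covariance exactly the empirical one. *)
Lemma centered_row_boot :
  centered_row P (extend_row 0%N idx) boot_summand n
    (fun i j => scov centered_data i j / n%:R)
    (n%:R^-1 * \sum_i lrem (sn^-1 *: centered_data i)).
Proof.
have sn2 : sn^-1 ^+ 2 = n%:R^-1 by rewrite exprVn sqr_sqrtr.
have U k (kn : (k < n)%N) (u : nat -> R) :
    P.-integrable setT (EFin \o (u \o extend_row 0%N idx k)) /\
    \int[P]_t u (extend_row 0%N idx k t) = n%:R^-1 * \sum_(j < n) u j.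
  have := uniform_Rintegral u n_gt0 (unif (Ordinal kn)).
  by rewrite -(extend_rowE 0%N idx).
split.
- exact: measurable_extend_row.
- exact: extend_row_independent.
- by [].
- by move=> k kn; have [] := U k kn (fun m => nsq (boot_summand m)).
- move=> k j kn; have [_ ->] := U k kn (fun m => boot_summand m ord0 j).
  rewrite (eq_bigr (fun i : 'I_n => sn^-1 * centered_data i ord0 j)); last first.
    by move=> i _; rewrite mxE.
  by rewrite -mulr_sumr centered_data_sum !mulr0.
- move=> k i j kn.
  have [_ ->] := U k kn (fun m => boot_summand m ord0 i * boot_summand m ord0 j).
  rewrite (eq_bigr (fun m : 'I_n => sn^-1 ^+ 2 *
      (centered_data m ord0 i * centered_data m ord0 j))); last first.
    by move=> m _; rewrite !mxE; ring.
  by rewrite -mulr_sumr sn2 mulrCA mulrC /scov.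
- by move=> k kn; have [_ ->] := U k kn (fun m => lrem (boot_summand m)).
Qed.

End bootstrap_row.

Section statistics.
Context {R : realType} {d : nat} {dO dO'} {Omega : measurableType dO} {Omega' : measurableType dO'}.
Variables (P : probability Omega R) (P' : probability Omega' R).
Variables (X : nat -> {RV P >-> borel_rV R d}) (idx : forall n : nat, 'I_n -> {RV P' >-> nat}).
Arguments idx : clear implicits.
Local Notation XV k w := (X k w : 'rV[R]_d).
Local Notation data w := (fun k => XV k w).

Lemma nsq_mean n (S : 'rV[R]_d) : (0 < n)%N ->
  n%:R * enorm (n%:R^-1 *: S) ^+ 2 = nsq ((Num.sqrt n%:R)^-1 *: S).
Proof.
move=> n0; rewrite enorm_sq !nsqZ !exprVn sqr_sqrtr// mulrA; congr (_ * _).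
by rewrite expr2 invfM mulrA divff ?mul1r// pnatr_eq0 -lt0n.
Qed.

Lemma V_statE n w : (0 < n)%N ->
  V_stat X n w = nsq (psum (fun k => X k)
    (fun e : borel_rV R d => (Num.sqrt n%:R)^-1 *: (e : 'rV[R]_d)) n w).
Proof.
move=> n0; rewrite /V_stat /sample_mean nsq_mean// /psum scaler_sumr.
by [].
Qed.

Lemma V_bootE n w w' : (0 < n)%N ->
  V_boot X idx n w w' = nsq (psum (extend_row 0%N (idx n))
    (boot_summand n (data w)) n w').
Proof.
move=> n0; rewrite /V_boot /xi_mean nsq_mean// /psum scaler_sumr; congr nsq.
by apply: eq_bigr => k _; rewrite extend_rowE.
Qed.

Lemma ball_prob_mono {d1 d2} {T : measurableType d1} {E : measurableType d2}
    (Q : probability T R) (Y : nat -> T -> E) (z : E -> 'rV[R]_d) n x y :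
  (forall k, measurable_fun setT (Y k)) ->
  (forall j, measurable_fun setT (fun e => z e ord0 j)) ->
  x <= y -> ball_prob Q Y z n x <= ball_prob Q Y z n y.
Proof.
move=> mY mz xy; rewrite /ball_prob fine_le ?fin_num_measure//.
- exact: measurable_psum_ball.
- exact: measurable_psum_ball.
- apply: le_measure; rewrite ?inE.
  + exact: measurable_psum_ball.
  + exact: measurable_psum_ball.
  + by move=> t /= tx; exact: le_trans xy.
Qed.

Lemma ball_prob_le1 {d1 d2} {T : measurableType d1} {E : measurableType d2}
    (Q : probability T R) (Y : nat -> T -> E) (z : E -> 'rV[R]_d) n x :
  (forall k, measurable_fun setT (Y k)) ->
  (forall j, measurable_fun setT (fun e => z e ord0 j)) ->
  ball_prob Q Y z n x <= 1.
Proof.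
move=> mY mz; have mA := measurable_psum_ball n x mY mz.
rewrite /ball_prob -lee_fin fineK ?fin_num_measure//.
exact: probability_le1.
Qed.

Hypothesis indep : mutually_independent X.
Hypothesis ident : identically_distributed X.
Hypothesis mean0 : forall j : 'I_d, ('E_P[fun w => XV 0%N w ord0 j] = 0)%E.
Hypothesis sq : ('E_P[fun w => (enorm (XV 0%N w) ^+ 2)%R] < +oo)%E.
Hypothesis indep' : forall n : nat, mutually_independent (idx n).
Hypothesis unif : forall (n : nat) (k : 'I_n), uniform_index n (idx n k).

Local Notation V := (second_moment X).
Local Notation c n w := (centered_data (n := n) (data w)).

(** For a frozen sample and a fixed [n] all errors are measured by one [t]. The factor [3 * tau + 2]
    is the sum of [tau + 2] for the statistic (its remainder, that of the smoothed family, the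
    covariance mismatch) and [2 * tau] for the bootstrap, where the covariance matches exactly. *)
Lemma bootstrap_close n w (j0 : 'I_d) (q tau delta K t : R) :
  (0 < n)%N -> 0 < q -> 0 < delta -> 3 * delta < K -> 0 <= t ->
  q <= scov (c n w) j0 j0 -> strace (c n w) <= tau ->
  (forall p, enorm (smooth_family (c n w) j0 p) <= t) ->
  (forall i, enorm ((Num.sqrt n%:R)^-1 *: c n w i) <= t) ->
  n%:R * row_remainder X n <= t ->
  \sum_i \sum_j `|V i j - scov (c n w) i j| <= t ->
  forall x, `|fine (P' [set w' | V_boot X idx n w w' <= x]) - fine (P [set w0 | V_stat X n w0 <= x])|
    <= rstep_bound delta K * (t * (3 * tau + 2)) + Num.sqrt (6 * delta / q)
      + 2 / Num.sqrt n%:R + tau / (K - 3 * delta).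
Proof.
move=> n0 q0 d0 K3 t0 qs tr Wt ct rt Vt x.
have q1 : 0 < scov (c n w) j0 j0 by exact: lt_le_trans qs.
have c0 := @centered_data_sum R d n (data w) n0.
have rowX := centered_row_X indep ident mean0 sq n0.
have rowB := centered_row_boot (data w) n0 (@indep' n) (@unif n).
have I0 : (0 < #|{: 'I_n * bool}|)%N by rewrite card_prod card_ord card_bool muln_gt0 n0.
have K0 : 0 <= K by lra.
have C0 := rstep_bound_ge0 K d0.
have n1 : n%:R != 0 :> R by rewrite pnatr_eq0 -lt0n.
have n2 : 0 < n%:R :> R by rewrite ltr0n.
have ts : t * strace (c n w) <= t * tau by rewrite ler_wpM2l.
(* All vectors of the family have norm at most [t], so their average remainder is at most [t] times
   their average squared norm. *)
pose rw := t * (strace (c n w) / n%:R).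
have wr : #|{: 'I_n * bool}|%:R^-1 * (\sum_p lrem (smooth_family (c n w) j0 p)) <= rw.
  rewrite /rw -(smooth_family_nsq n0 q1) mulrCA [t * _]mulr_sumr.
  by apply: avg_le => p; exact: lrem_le_max.
pose err Q r := n%:R * (rstep_bound delta K * replacement_error Q r (smooth_family (c n w) j0) rw).
have errE Q r : err Q r = rstep_bound delta K * (n%:R * r + t * strace (c n w)
    + \sum_i \sum_j `|n%:R * Q i j - scov (c n w) i j|).
  rewrite /err mulrCA; congr (_ * _); rewrite /replacement_error !mulrDr; congr (_ + _ + _).
    by rewrite /rw mulrCA [n%:R * _]mulrC mulfVK.
  rewrite mulr_sumr; apply: eq_bigr => i _; rewrite mulr_sumr; apply: eq_bigr => j _.
  rewrite smooth_family_cov// -[X in X * _](ger0_norm (ltW n2)) -normrM mulrBr.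
  by rewrite [n%:R * (_ / _)]mulrC mulfVK.
pose e1 := err (fun i j => V i j / n%:R) (row_remainder X n).
pose e2 := err (fun i j => scov (c n w) i j / n%:R)
  (n%:R^-1 * \sum_i lrem ((Num.sqrt n%:R)^-1 *: c n w i)).
have sand1 u (uK : u <= K) := ball_prob_sandwich rowX I0 (smooth_family_sum j0 c0) wr d0 K0 uK (erefl e1).
have sand2 u (uK : u <= K) := ball_prob_sandwich rowB I0 (smooth_family_sum j0 c0) wr d0 K0 uK (erefl e2).
have e1_le : e1 <= rstep_bound delta K * (t * (tau + 2)).
  rewrite /e1 errE ler_wpM2l//.
  under eq_bigr do under eq_bigr do rewrite [n%:R * (_ / _)]mulrC mulfVK//.
  lra.
have e2_le : e2 <= rstep_bound delta K * (t * (2 * tau)).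
  rewrite /e2 errE ler_wpM2l//.
  rewrite [X in _ + X]big1; last first.
    move=> i _; rewrite big1// => j _.
    by rewrite [n%:R * (_ / _)]mulrC mulfVK// subrr normr0.
  rewrite mulVKf//.
  suff : \sum_i lrem ((Num.sqrt n%:R)^-1 *: c n w i) <= t * strace (c n w) by lra.
  rewrite strace_nsq// mulrCA !mulr_sumr; apply: ler_sum => i _.
  rewrite (le_trans (lrem_le_max (ct i)))// nsqZ exprVn sqr_sqrtr//.
  by rewrite mulrCA.
have err_ge0 Q r : 0 <= r -> 0 <= err Q r.
  move=> r0; rewrite errE mulr_ge0// !addr_ge0 ?mulr_ge0 ?strace_ge0//.
  by apply: sumr_ge0 => i _; apply: sumr_ge0.
have e10 : 0 <= e1 by apply: err_ge0; apply: Rintegral_ge0 => w0 _; exact: lrem_ge0.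
have e20 : 0 <= e2.
  by apply: err_ge0; rewrite mulr_ge0 ?invr_ge0// sumr_ge0// => i _; exact: lrem_ge0.
have mz1 := row_mz rowX; have mY1 := row_mY rowX.
have mz2 := row_mz rowB; have mY2 := row_mY rowB.
have := sandwich_distance n0 c0 q1 d0 K3
  (fun u v uv => ball_prob_mono P n mY1 mz1 uv) (fun u v uv => ball_prob_mono P' n mY2 mz2 uv)
  (fun u => ball_prob_le1 P n u mY1 mz1) (fun u => ball_prob_le1 P' n u mY2 mz2)
  e10 e20 sand1 sand2 x.
rewrite distrC /ball_prob.
have -> : [set w' | V_boot X idx n w w' <= x] =
    [set w' | nsq (psum (extend_row 0%N (idx n)) (boot_summand n (data w)) n w') <= x].
  by apply/seteqP; split => w' /=; rewrite V_bootE.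
have -> : [set w0 | V_stat X n w0 <= x] = [set w0 | nsq (psum (fun k => X k)
    (fun e : borel_rV R d => (Num.sqrt n%:R)^-1 *: (e : 'rV[R]_d)) n w0) <= x].
  by apply/seteqP; split => w0 /=; rewrite V_statE.
move=> h; apply: (le_trans h).
have h1 : Num.sqrt (6 * delta / scov (c n w) j0 j0) <= Num.sqrt (6 * delta / q).
  apply: ler_wsqrtr; rewrite ler_wpM2l ?mulr_ge0 ?(ltW d0)//.
  by rewrite lef_pV2.
have h2 : strace (c n w) / (K - 3 * delta) <= tau / (K - 3 * delta).
  by rewrite ler_wpM2r// invr_ge0 subr_ge0 ltW.
lra.
Qed.

End statistics.

(** * Almost sure convergence *)

Lemma cvg_sumr (R : realType) (I : finType) (f : I -> nat -> R) (l : I -> R) :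
  (forall i, f i n @[n --> \oo] --> l i) ->
  \sum_i f i n @[n --> \oo] --> \sum_i l i.
Proof.
move=> fl; elim: (index_enum I) => [|i s IH].
  by rewrite big_nil; under eq_fun do rewrite big_nil; exact: cvg_cst.
by rewrite big_cons; under eq_fun do rewrite big_cons; exact: cvgD.
Qed.

Lemma cvg_sumr0 (R : realType) (I : finType) (f : I -> nat -> R) :
  (forall i, f i n @[n --> \oo] --> 0) -> \sum_i f i n @[n --> \oo] --> 0.
Proof. by move=> f0; have := cvg_sumr f0; rewrite big1. Qed.

(** * Empirical moments of one fixed sequence of observations *)

Section data_asymptotics.
Context {R : realType} {d : nat}.
Variables (x : nat -> 'rV[R]_d) (V : 'I_d -> 'I_d -> R).
Hypothesis mean_cvg : forall j, (\sum_(i < m) x i ord0 j) / m%:R @[m --> \oo] --> 0.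
Hypothesis cov_cvg : forall j k,
  (\sum_(i < m) x i ord0 j * x i ord0 k) / m%:R @[m --> \oo] --> V j k.

Local Notation c n := (centered_data (n := n) x).

Lemma data_mean_cvg j : data_mean n x ord0 j @[n --> \oo] --> 0.
Proof.
apply: (cvg_trans (near_eq_cvg _) (mean_cvg j)); apply: nearW => n.
by rewrite /data_mean mxE summxE mulrC.
Qed.

Lemma scov_centered n j k : (0 < n)%N -> scov (c n) j k =
  (\sum_(i < n) x i ord0 j * x i ord0 k) / n%:R
  - data_mean n x ord0 j * data_mean n x ord0 k.
Proof.
move=> n0; have n1 : n%:R != 0 :> R by rewrite pnatr_eq0 -lt0n.
have sumE l : \sum_(i < n) x i ord0 l = n%:R * data_mean n x ord0 l.
  by rewrite /data_mean mxE summxE mulVKf.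
rewrite /scov (eq_bigr (fun i : 'I_n => x i ord0 j * x i ord0 k
   - data_mean n x ord0 k * x i ord0 j - data_mean n x ord0 j * x i ord0 k
   + data_mean n x ord0 j * data_mean n x ord0 k)); last first.
  move=> i _; rewrite [c n i _ _]mxE [X in (_ + X) * _]mxE.
  by rewrite [c n i _ _]mxE [X in _ * (_ + X)]mxE; ring.
rewrite !big_split/= !sumrN -!mulr_sumr !sumE sumr_const card_ord.
rewrite -[data_mean n x ord0 k *+ n]mulr_natl.
move: (\sum_(i < n) _) (data_mean n x ord0 j) (data_mean n x ord0 k) (n%:R : R) n1.
by move=> S a b N N0; field.
Qed.

Lemma scov_cvg j k : scov (c n) j k @[n --> \oo] --> V j k.
Proof.
have h : (\sum_(i < n) x i ord0 j * x i ord0 k) / n%:R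
    - data_mean n x ord0 j * data_mean n x ord0 k @[n --> \oo] --> V j k.
  rewrite -[X in _ --> X]subr0; apply: cvgB; first exact: cov_cvg.
  by rewrite -[X in _ --> X](mul0r 0); apply: cvgM; exact: data_mean_cvg.
apply: (cvg_trans (near_eq_cvg _) h); near=> n.
by rewrite scov_centered//; near: n; exact: nbhs_infty_gt.
Unshelve. all: by end_near. Qed.

Lemma strace_cvg : strace (c n) @[n --> \oo] --> \sum_j V j j.
Proof.
by apply: cvg_sumr => j; exact: scov_cvg.
Qed.

Lemma scov_distance_cvg : \sum_i \sum_j `|V i j - scov (c n) i j| @[n --> \oo] --> 0.
Proof.
apply: cvg_sumr0 => i; apply: cvg_sumr0 => j.
have h : V i j - scov (c n) i j @[n --> \oo] --> 0.
  by rewrite -[X in _ --> X](subrr (V i j)); apply: cvgB; [exact: cvg_cst|exact: scov_cvg].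
by rewrite -[X in _ --> X](@normr0 _ R); exact: (cvg_norm h).
Qed.

(** Averages of [nsq (x i)] converge, so the largest is [o(n)]. Two allowances of [e / 4], for the
    observation and for the mean, are doubled by [nsqD_le]. *)
Lemma centered_data_small e : 0 < e ->
  \forall n \near \oo, forall i : 'I_n, nsq (c n i) <= e * n%:R.
Proof.
move=> e0; have e8 : 0 < e / 4 by rewrite divr_gt0.
have avg : (\sum_(i < m) nsq (x i)) / m%:R @[m --> \oo] --> \sum_j V j j.
  have h : \sum_j (\sum_(i < m) x i ord0 j * x i ord0 j) / m%:R @[m --> \oo] --> \sum_j V j j.
    by apply: cvg_sumr => j; exact: cov_cvg.
  apply: (cvg_trans (near_eq_cvg _) h); apply: nearW => m.
  rewrite /nsq exchange_big/= mulr_suml; apply: eq_bigr => j _.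
  by congr (_ / _); apply: eq_bigr => i _; rewrite expr2.
have m0 : nsq (data_mean n x) @[n --> \oo] --> 0.
  apply: cvg_sumr0 => j; rewrite -[X in _ --> X](mul0r 0).
  under eq_fun do rewrite expr2.
  by apply: cvgM; exact: data_mean_cvg.
have small := average_cvg_max (fun i => nsq_ge0 (x i)) avg e8.
have m1 : \forall n \near \oo, nsq (data_mean n x) <= e / 4.
  move/cvgr0Pnorm_le : m0 => /(_ _ e8); apply: filterS => n.
  by rewrite ger0_norm// nsq_ge0.
near=> n => i.
have n1 : 1 <= n%:R :> R by rewrite ler1n; near: n; exact: nbhs_infty_gt.
have h1 : forall i, (i < n)%N -> nsq (x i) <= e / 4 * n%:R by near: n.
have h2 : nsq (data_mean n x) <= e / 4 by near: n.
have := h1 i (ltn_ord i); have := nsqD_le (x i) (- data_mean n x).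
have -> : nsq (- data_mean n x) = nsq (data_mean n x).
  by apply: eq_bigr => j _; rewrite mxE sqrrN.
have : e / 4 <= e / 4 * n%:R by rewrite ler_peMr// ltW.
rewrite -/(c n i); lra.
Unshelve. all: by end_near. Qed.

End data_asymptotics.

(** The point [u0] makes the family nonempty, so the supremum is at least 0; with a finite upper
    bound it is a real number and convergence is checked in [R]. *)
Lemma ereal_sup_cvg0 (R : realType) (U : Type) (f g : nat -> U -> \bar R) (u0 : U) :
  (forall e : R, 0 < e -> \forall n \near \oo, forall u, (`|f n u - g n u| <= e%:E)%E) ->
  (fun n => ereal_sup [set `|f n u - g n u|%E | u in [set: U]]) @ \oo --> 0%E.
Proof.
move=> h; pose s n := ereal_sup [set `|f n u - g n u|%E | u in [set: U]].
have s0 n : (0 <= s n)%E.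
  by apply: (le_trans (abse_ge0 (f n u0 - g n u0))); apply: ereal_sup_ubound; exists u0.
have se e : 0 < e -> \forall n \near \oo, (s n <= e%:E)%E.
  move=> e0; apply: filterS (h e e0) => n hn.
  by apply: ge_ereal_sup => _ [u _ <-]; exact: hn.
apply/fine_cvgP; split.
  apply: filterS (se 1 ltr01) => n sn1.
  have : s n \is a fin_num by rewrite ge0_fin_numE//; exact: (le_lt_trans sn1 (ltry _)).
  by [].
apply/cvgr0Pnorm_le => e e0; apply: filterS (se e e0) => n sne.
have sfin : s n \is a fin_num by rewrite ge0_fin_numE//; exact: (le_lt_trans sne (ltry _)).
have : `|fine (s n)| <= e by rewrite ger0_norm ?fine_ge0// -lee_fin fineK.
by [].
Qed.

(** * The case of a coordinate with positive variance *)

Section nondegenerate.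
Context {R : realType} {d : nat} {dO dO'} {Omega : measurableType dO} {Omega' : measurableType dO'}.
Variables (P : probability Omega R) (P' : probability Omega' R).
Variables (X : nat -> {RV P >-> borel_rV R d}) (idx : forall n : nat, 'I_n -> {RV P' >-> nat}).
Arguments idx : clear implicits.
Local Notation XV k w := (X k w : 'rV[R]_d).
Local Notation data w := (fun k => XV k w).
Hypothesis indep : mutually_independent X.
Hypothesis ident : identically_distributed X.
Hypothesis mean0 : forall j : 'I_d, ('E_P[fun w => XV 0%N w ord0 j] = 0)%E.
Hypothesis sq : ('E_P[fun w => (enorm (XV 0%N w) ^+ 2)%R] < +oo)%E.
Hypothesis indep' : forall n : nat, mutually_independent (idx n).
Hypothesis unif : forall (n : nat) (k : 'I_n), uniform_index n (idx n k).
Local Notation V := (second_moment X).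

Lemma bootstrap_consistent w (j0 : 'I_d) : 0 < V j0 j0 ->
  (forall j, (\sum_(i < m) XV i w ord0 j) / m%:R @[m --> \oo] --> 0) ->
  (forall j k, (\sum_(i < m) XV i w ord0 j * XV i w ord0 k) / m%:R @[m --> \oo] --> V j k) ->
  forall e : R, 0 < e -> \forall n \near \oo, forall x : R,
    `|fine (P' [set w' | V_boot X idx n w w' <= x]) - fine (P [set w0 | V_stat X n w0 <= x])| <= e.
Proof.
move=> V0 m0 cV e e0.
(* Each of the four terms of [bootstrap_close] receives [e / 4]: [delta] settles the
   anticoncentration, [K] the tail, then [t], which depends on both through [C], and last
   [n >= (8 / e) ^ 2]. Halving in [q] and adding 1 in [tau] leave room for the empirical values. *)
pose q := V j0 j0 / 2; have q0 : 0 < q by rewrite divr_gt0.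
have VV0 : 0 <= \sum_j V j j.
  apply: sumr_ge0 => j _; apply: Rintegral_ge0 => t _.
  by rewrite -expr2 sqr_ge0.
pose tau := \sum_j V j j + 1; have tau0 : 0 < tau by rewrite ltr_wpDl.
pose delta := q * (e / 4) ^+ 2 / 6.
have e4 : 0 < e / 4 by rewrite divr_gt0.
have d0 : 0 < delta by rewrite divr_gt0// mulr_gt0// exprn_gt0.
pose K := 3 * delta + tau / (e / 4).
have K3 : 3 * delta < K by rewrite /K ltrDl divr_gt0.
have K0 : 0 <= K by rewrite ltW// (lt_trans _ K3)// mulr_gt0.
pose C := rstep_bound delta K; have C0 : 0 <= C := rstep_bound_ge0 K d0.
have t3 : 0 < 3 * tau + 2 by rewrite addr_gt0// mulr_gt0.
have C1 : 0 < C + 1 by rewrite ltr_wpDl.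
pose t := e / 4 / ((C + 1) * (3 * tau + 2)).
have t0 : 0 < t by rewrite divr_gt0// mulr_gt0.
have tq : 0 < 1 + tau / q by rewrite addr_gt0// divr_gt0.
(* For squared observations up to [ep * n], [smooth_family_le] leads to at most
   [4 * ep * (1 + tau / q) + 2 * tau / n]. The first part is [t ^ 2 / 2] by this choice, and the
   second is no larger once [n >= 4 * tau / t ^ 2]. *)
pose ep := t ^+ 2 / (8 * (1 + tau / q)).
have ep0 : 0 < ep by rewrite divr_gt0 ?exprn_gt0// mulr_gt0.
have t20 : 0 < t ^+ 2 by rewrite exprn_gt0.
have scvg : \forall n \near \oo, q <= scov (centered_data (n := n) (data w)) j0 j0.
  have : q < V j0 j0 by rewrite /q ltr_pdivrMr// ltr_pMr// ltr1n.
  by move=> /(cvgr_gt _ (@scov_cvg _ _ (data w) V m0 cV j0 j0)); apply: filterS => n /ltW.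
have tcvg : \forall n \near \oo, strace (centered_data (n := n) (data w)) <= tau.
  have : \sum_j V j j < tau by rewrite /tau ltrDl.
  by move=> /(cvgr_lt _ (@strace_cvg _ _ (data w) V m0 cV)); apply: filterS => n /ltW.
have rcvg : \forall n \near \oo, n%:R * row_remainder X n <= t.
  by move: t0 => /(cvgr_lt _ (row_remainder_cvg0 sq)); apply: filterS => n /ltW.
have vcvg : \forall n \near \oo,
    \sum_i \sum_j `|V i j - scov (centered_data (n := n) (data w)) i j| <= t.
  by move: t0 => /(cvgr_lt _ (@scov_distance_cvg _ _ (data w) V m0 cV)); apply: filterS => n /ltW.
have smallc := @centered_data_small _ _ (data w) V m0 cV ep ep0.
near=> n.
have n0 : (0 < n)%N by near: n; exact: nbhs_infty_gt.
have n1 : 0 < n%:R :> R by rewrite ltr0n.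
have hs : q <= scov (centered_data (n := n) (data w)) j0 j0 by near: n.
have ht : strace (centered_data (n := n) (data w)) <= tau by near: n.
have hr : n%:R * row_remainder X n <= t by near: n.
have hv : \sum_i \sum_j `|V i j - scov (centered_data (n := n) (data w)) i j| <= t by near: n.
have hc : forall i : 'I_n, nsq (centered_data (data w) i) <= ep * n%:R by near: n.
have hn : 4 * tau / t ^+ 2 <= n%:R by near: n; exact: nbhs_infty_ger.
have hsn : (8 / e) ^+ 2 <= n%:R by near: n; exact: nbhs_infty_ger.
have enorm_le (y : 'rV[R]_d) : nsq y <= t ^+ 2 -> enorm y <= t.
  move=> yt; rewrite -(ger0_norm (ltW t0)) -sqrtr_sqr; exact: ler_wsqrtr.
have ep_half : 4 * ep * (1 + tau / q) = t ^+ 2 / 2.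
  rewrite /ep; have := lt0r_neq0 tq; move: (1 + tau / q) (t ^+ 2) => a b a0.
  by field.
have ep_le : ep <= t ^+ 2.
  have : ep * 1 <= ep * (1 + tau / q) by rewrite ler_wpM2l ?(ltW ep0)// lerDl divr_ge0 ?(ltW tau0) ?(ltW q0).
  lra.
have q1 : 0 < scov (centered_data (n := n) (data w)) j0 j0 by exact: lt_le_trans hs.
have c0 := @centered_data_sum R d n (data w) n0.
have s0 := @strace_ge0 R d n (centered_data (data w)).
have hW p : enorm (smooth_family (centered_data (n := n) (data w)) j0 p) <= t.
  apply: enorm_le; apply: (le_trans (smooth_family_le n0 q1 p hc)).
  set s := strace _ in ht s0 *; set Q := scov _ _ _ in hs q1 *.
  rewrite ler_pdivrMr//.
  have h1 : ep * n%:R * s / Q <= ep * n%:R * (tau / q).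
    rewrite -[leLHS]mulrA; apply: ler_wpM2l; first by rewrite mulr_ge0// ltW.
    by apply: ler_pM => //; rewrite ?invr_ge0 ?(ltW q1)// lef_pV2.
  have h2 : 4 * tau <= t ^+ 2 * n%:R by rewrite [leRHS]mulrC -ler_pdivrMr.
  have h3 : 4 * (ep * n%:R) + 4 * (ep * n%:R * (tau / q)) = t ^+ 2 / 2 * n%:R.
    by rewrite -ep_half; ring.
  lra.
have hC i : enorm ((Num.sqrt n%:R)^-1 *: centered_data (n := n) (data w) i) <= t.
  apply: enorm_le; rewrite nsqZ exprVn sqr_sqrtr// mulrC ler_pdivrMr//.
  by rewrite (le_trans (hc i))// ler_wpM2r.
move=> x; apply: (le_trans (bootstrap_close indep ident mean0 sq indep' unif n0 q0 d0 K3
  (ltW t0) hs ht hW hC hr hv x)).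
have b1 : rstep_bound delta K * (t * (3 * tau + 2)) <= e / 4.
  rewrite -/C /t.
  have -> : e / 4 / ((C + 1) * (3 * tau + 2)) * (3 * tau + 2) = e / 4 / (C + 1).
    have := lt0r_neq0 t3; have := lt0r_neq0 C1.
    by move: (C + 1) (3 * tau + 2) => a b a0 b0; field; rewrite a0 b0.
  rewrite mulrCA -[leRHS]mulr1 ler_wpM2l ?(ltW e4)// ler_pdivrMr// mul1r.
  by rewrite lerDl.
have b2 : Num.sqrt (6 * delta / q) = e / 4.
  have cancel6 (a b : R) : a != 0 -> 6 * (a * b ^+ 2 / 6) / a = b ^+ 2.
    by move=> a0; field.
  by rewrite /delta cancel6 ?gt_eqF// sqrtr_sqr ger0_norm// ltW.
have b3 : 2 / Num.sqrt n%:R <= e / 4.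
  have s8 : 8 / e <= Num.sqrt n%:R.
    rewrite -[leLHS]ger0_norm ?divr_ge0 ?(ltW e0)// -sqrtr_sqr; exact: ler_wsqrtr.
  rewrite ler_pdivrMr ?sqrtr_gt0//.
  have : e / 4 * (8 / e) <= e / 4 * Num.sqrt n%:R by rewrite ler_wpM2l// ltW.
  have -> : e / 4 * (8 / e) = 2 by field; rewrite gt_eqF.
  by [].
have b4 : tau / (K - 3 * delta) = e / 4.
  rewrite /K addrAC subrr add0r invf_div mulrCA divff ?mulr1//.
  by rewrite gt_eqF.
rewrite b2 b4; lra.
Unshelve. all: by end_near. Qed.

End nondegenerate.

(** * The case of vanishing second moments *)

Section degenerate.
Context {R : realType} {d : nat} {dO dO'} {Omega : measurableType dO} {Omega' : measurableType dO'}.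
Variables (P : probability Omega R) (P' : probability Omega' R).
Variables (X : nat -> {RV P >-> borel_rV R d}) (idx : forall n : nat, 'I_n -> {RV P' >-> nat}).
Arguments idx : clear implicits.
Local Notation XV k w := (X k w : 'rV[R]_d).
Hypothesis ident : identically_distributed X.
Hypothesis sq : ('E_P[fun w => (enorm (XV 0%N w) ^+ 2)%R] < +oo)%E.

Lemma measurable_V_stat n : measurable_fun setT (V_stat X n).
Proof.
apply: measurable_funM => //; rewrite (_ : (fun w => _) = fun w => nsq (sample_mean X n w)).
  apply: coord_measurable_nsq => j; under eq_fun do rewrite mxE summxE.
  apply: measurable_funM => //; apply: measurable_sum => i.
  exact: (measurableT_comp (measurable_borel_coord j) (measurable_funP (X i))).
by apply/funext => w; rewrite enorm_sq.
Qed.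

Lemma measurable_V_boot n w : measurable_fun setT (V_boot X idx n w).
Proof.
apply: measurable_funM => //; rewrite (_ : (fun w' => _) = fun w' => nsq (xi_mean X idx n w w')).
  apply: coord_measurable_nsq => j; under eq_fun do rewrite mxE summxE.
  apply: measurable_funM => //; apply: measurable_sum => k.
  exact: (measurableT_comp (f := fun m => (XV m w - sample_mean X n w) ord0 j)).
by apply/funext => w'; rewrite enorm_sq.
Qed.

(** The nonnegative [nsq] of each observation has integral 0, so it vanishes almost surely; the null
    sets are joined over the countably many [k]. *)
Lemma second_moment0_ae : (forall j, second_moment X j j = 0) ->
  {ae P, forall w, forall k, XV k w = 0}.
Proof.
move=> V0; apply: ae_foralln => k.
have [ik Ek] := Rintegral_X ident k coord_measurable_nsq (integrable_nsq0 sq).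
have E0 : \int[P]_w nsq (XV 0%N w) = 0.
  rewrite /nsq Rintegral_sumR; last first.
    move=> j _; under eq_fun do rewrite expr2.
    exact: integrable_coordM0.
  apply: big1 => j _; rewrite -[RHS](V0 j).
  by apply: eq_Rintegral => w _; rewrite expr2.
have h : (\int[P]_(w in setT) `|(EFin \o (fun w => nsq (XV k w))) w| = 0)%E.
  rewrite (eq_integral (EFin \o (fun w => nsq (XV k w)))); last first.
    by move=> w _ /=; rewrite ger0_norm// nsq_ge0.
  rewrite -(fineK (integrable_fin_num measurableT ik)).
  by congr EFin; rewrite -E0 -Ek.
move/(ae_eq_integral_abs P measurableT (measurable_int P ik)) : h.
apply: filterS => w /= /(_ I) [] w0.
apply/rowP => j; rewrite mxE; apply/eqP; rewrite -sqrf_eq0 eq_le sqr_ge0 andbT.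
by rewrite -w0 coord_sq_le.
Qed.

Lemma V_stat_zero n w : (forall k, XV k w = 0) -> V_stat X n w = 0.
Proof.
move=> X0; rewrite /V_stat enorm_sq /sample_mean.
rewrite big1; last by move=> i _; exact: X0.
by rewrite scaler0 /nsq big1 ?mulr0// => j _; rewrite mxE expr0n.
Qed.

Lemma V_boot_zero n w w' : (forall k, XV k w = 0) -> V_boot X idx n w w' = 0.
Proof.
move=> X0; rewrite /V_boot enorm_sq /xi_mean /sample_mean big1.
  by rewrite scaler0 /nsq big1 ?mulr0// => j _; rewrite mxE expr0n.
move=> k _; rewrite /xi X0 sub0r big1 ?scaler0 ?oppr0// => i _; exact: X0.
Qed.

Lemma prob_V_stat_zero n (x : R) : {ae P, forall w, forall k, XV k w = 0} ->
  P [set w | V_stat X n w <= x] = if 0 <= x then 1%E else 0%E.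
Proof.
move=> X0; case: ifP => x0.
  have mA := measurable_sublevel x (measurable_V_stat n).
  have PC : P (~` [set w | V_stat X n w <= x]) = 0%E.
    apply: measure_negligible; first exact: measurableC.
    by apply: negligibleS X0 => w /= wx X0; apply: wx; rewrite V_stat_zero.
  rewrite -[X in P X]setCK probability_setC; last exact: measurableC.
  by rewrite PC sube0.
rewrite (_ : [set w | V_stat X n w <= x] = set0) ?measure0//.
apply/seteqP; split => // w /= wx; move: x0; rewrite (le_trans _ wx)//.
by rewrite /V_stat mulr_ge0// exprn_ge0// enorm_ge0.
Qed.

End degenerate.

Theorem corollary1 (R : realType)
    (dO dO' : measure_display)
    (Omega : measurableType dO) (Omega' : measurableType dO')
    (P : probability Omega R) (P' : probability Omega' R)
    (d : nat) (d_gt0 : (0 < d)%N)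
    (X : nat -> {RV P >-> borel_rV R d})
    (idx : forall n : nat, 'I_n -> {RV P' >-> nat}) :
  mutually_independent X ->
  identically_distributed X ->
  (forall j : 'I_d, ('E_P[fun w => (X 0%N w : 'rV[R]_d) ord0 j] = 0)%E) ->
  ('E_P[fun w => (enorm (X 0%N w : 'rV[R]_d) ^+ 2)%R] < +oo)%E ->
  (forall n : nat, mutually_independent (idx n)) ->
  (forall (n : nat) (k : 'I_n), uniform_index n (idx n k)) ->
  {ae P, forall w : Omega,
    (fun n : nat =>
       ereal_sup [set `|P' [set w' | (V_boot X idx n w w' <= x)%R]
                        - P [set w0 | (V_stat X n w0 <= x)%R]|%E
                 | x in [set: R]])
      @ \oo --> 0%E}.
Proof.
move=> indep ident mean0 sq indep' unif.
have [deg|[j0 V0]] : (forall j, second_moment X j j = 0) \/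
    exists j, 0 < second_moment X j j.
  have [|none] := pselect (exists j, 0 < second_moment X j j); first by right.
  left => j; apply/eqP; rewrite eq_le; apply/andP; split.
    by rewrite leNgt; apply/negP => h; apply: none; exists j.
  by apply: Rintegral_ge0 => w _; rewrite -expr2 sqr_ge0.
  (* A point mass at 0 has no anticoncentration; instead the two distribution functions coincide for
     every [n] and [x]. *)
  have X0 := second_moment0_ae ident sq deg.
  apply: filterS X0 => w w0; apply: (ereal_sup_cvg0 (0 : R)) => e e0.
  apply: nearW => n x; rewrite prob_V_stat_zero//; last exact: second_moment0_ae.
  have -> : [set w' | V_boot X idx n w w' <= x] = if 0 <= x then setT else set0.
    apply/seteqP; split => w' /=; rewrite V_boot_zero//; case: ifP => //.
  by case: ifP => _; rewrite ?probability_setT ?measure0 subee// abse0 lee_fin ltW.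
have aeM : {ae P, forall w, forall j : 'I_d,
    (\sum_(i < m) (X i w : 'rV[R]_d) ord0 j) / m%:R @[m --> \oo] --> 0}.
  apply: filter_forall => j.
  have := strong_law_X indep ident (coord_measurable_coord j) (integrable_coord0 sq j).
  by rewrite Rintegral_coord0.
have aeV : {ae P, forall w, forall j k : 'I_d,
    (\sum_(i < m) (X i w : 'rV[R]_d) ord0 j * (X i w : 'rV[R]_d) ord0 k) / m%:R
      @[m --> \oo] --> second_moment X j k}.
  apply: filter_forall => j; apply: filter_forall => k.
  exact: (strong_law_X indep ident (coord_measurable_coordM j k) (integrable_coordM0 sq j k)).
apply: filterS2 aeM aeV => w wM wV; apply: (ereal_sup_cvg0 (0 : R)) => e e0.
have close := bootstrap_consistent indep ident mean0 sq indep' unif V0 wM wV e0.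
near=> n => x.
have n0 : (0 < n)%N by near: n; exact: nbhs_infty_gt.
have : forall x : R, `|fine (P' [set w' | V_boot X idx n w w' <= x])
    - fine (P [set w0 | V_stat X n w0 <= x])| <= e by near: n.
move=> /(_ x).
have f1 : P' [set w' | V_boot X idx n w w' <= x] \is a fin_num.
  exact/fin_num_measure/measurable_sublevel/measurable_V_boot.
have f2 : P [set w0 | V_stat X n w0 <= x] \is a fin_num.
  exact/fin_num_measure/measurable_sublevel/measurable_V_stat.
by rewrite -lee_fin => h; rewrite -(fineK f1) -(fineK f2) -EFinB abse_EFin.
Unshelve. all: by end_near. Qed.
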